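(* Let $\theta_1,\theta_2\in H^\infty$ be singular inner functions with singular measures $\mu_1$ and $\mu_2$ respectively. Then $\theta_1$ and $\theta_2$ are coprime if and only if $\mu_1\perp\mu_2$.
   Context: $\mathbb D$ is the open unit disk, $\mathbb T$ the unit circle, and $H^\infty$ the algebra of bounded analytic functions on $\mathbb D$. A singular inner function is a function of the form $\theta(z)=\exp\left(-\int_{\mathbb T}\frac{t+z}{t-z}\,d\mu(t)\right)$ $(z\in\mathbb D)$, where $\mu$ is a finite positive Borel measure on $\mathbb T$ which is singular with respect to Lebesgue measure; $\mu$ is called the singular measure of $\theta$. An inner function $\omega$ is an inner divisor of an inner function $\theta$ if $\theta=\omega\theta'$ for some inner function $\theta'$. Two inner functions are coprime if they have no nonconstant common inner divisor. $\mu_1\perp\mu_2$ means that $\mu_1$ and $\mu_2$ are mutually singular, i.e., there are disjoint Borel sets $A,B$ such that $\mu_1$ is concentrated on $A$ and $\mu_2$ is concentrated on $B$ (a measure $\mu$ is concentrated on $A$ if $\mu(E)=\mu(A\cap E)$ for every Borel set $E$). *)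

(* Defs.v *)
From HB Require Import structures.
From mathcomp Require Import all_boot all_order all_algebra complex.
From mathcomp Require Import all_classical all_reals all_analysis.

Set Implicit Arguments.
Unset Strict Implicit.
Unset Printing Implicit Defensive.
Import Order.TTheory GRing.Theory Num.Theory numFieldNormedType.Exports.
Local Open Scope classical_set_scope.
Local Open Scope complex_scope.
Local Open Scope ring_scope.

HB.instance Definition _ (R : realType) := NormedModule.copy R[i] R[i]^o.

Definition circle (R : realType) : Type := set_type [set z : R[i] | `|z| = 1].

Definition circle_val (R : realType) (t : circle R) : R[i] := set_val t.

Lemma circle_subproof (R : realType) (z : R[i]) :
  `|z| = 1 -> z \in [set w : R[i] | `|w| = 1].
Proof. by move=> z1; exact/mem_set. Qed.

Definition mk_circle (R : realType) (z : R[i]) (z1 : `|z| = 1) : circle R :=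
  exist _ z (circle_subproof z1).

HB.instance Definition _ (R : realType) :=
  Topological.copy (circle R) (set_type [set z : R[i] | `|z| = 1]).
HB.instance Definition _ (R : realType) :=
  isPointed.Build (circle R) (mk_circle (normr1 R[i])).
HB.instance Definition _ (R : realType) :=
  Measurable.copy (circle R) (g_sigma_algebraType (@open (circle R))).

Lemma normc_cos_sin (R : realType) (x : R) : `|cos x +i* sin x| = 1 :> R[i].
Proof. by rewrite normc_def /= cos2Dsin2 sqrtr1. Qed.

Definition expi (R : realType) (x : R) : circle R :=
  mk_circle (normc_cos_sin x).

Lemma continuous_expi (R : realType) : continuous (@expi R).
Proof.
apply/continuous_comp_initial => x.
have toC (f : R -> R) : {for x, continuous f} ->
    (f y)%:C @[y --> x] --> ((f x)%:C : R[i]).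
  move=> fx; apply/cvgrPdist_lt => e e0.
  have [eR ee] : e = (complex.Re e)%:C /\ 0 < complex.Re e.
    by move: e0; case: e => a b; rewrite ltcE /= => /andP[/eqP-> ?].
  move/cvgrPdist_lt : fx => /(_ _ ee); apply: filterS => y fxy.
  by rewrite eR -rmorphB /= normc_def /= expr0n addr0 sqrtr_sqr ltcR.
rewrite /continuous_at.
have E : set_val \o @expi R =
    (fun y => (cos y)%:C + 'i%C * (sin y)%:C) :> (R -> R[i]).
  by apply/funext => y; apply/eqP; rewrite eq_complex /=; simpc.
rewrite E; apply: cvgD; first exact/toC/continuous_cos.
by apply: cvgMr; exact/toC/continuous_sin.
Qed.

Lemma measurable_expi (R : realType) :
  measurable_fun [set: measurableTypeR R] (@expi R).
Proof.
apply: (@measurability _ _ _ _ _ _ (@open (circle R))) => //.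
move=> _ [U oU <-]; rewrite setTI; apply: measurable_realfun.open_measurable.
by move/continuousP : (@continuous_expi R); exact.
Qed.

(* Unnormalised: the whole circle has mass 2 * pi. *)
Definition arc_length (R : realType) : set (circle R) -> \bar R :=
  pushforward
    (mrestr (@lebesgue_measure R)
       (measurable_itv `[0, 2 * pi[ : measurable `[(0 : R), 2 * pi[%classic))
    (@expi R : measurableTypeR R -> circle R).

Section arc_length_measure.
Variable R : realType.

Let leb := mrestr (@lebesgue_measure R)
  (measurable_itv `[0, 2 * pi[ : measurable `[(0 : R), 2 * pi[%classic).
Let m : {measure set (circle R) -> \bar R} :=
  measure_function_pushforward__canonical__measure_function_Measure
    leb (@measurable_expi R).

HB.instance Definition _ := Measure.copy (@arc_length R) m.
End arc_length_measure.

Definition cexp (R : realType) (z : R[i]) : R[i] :=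
  (expR (complex.Re z))%:C * (cos (complex.Im z) +i* sin (complex.Im z)).

Definition cintegral (d : measure_display) (T : measurableType d)
    (R : realType) (mu : {measure set T -> \bar R}) (f : T -> R[i]) : R[i] :=
  (\int[mu]_t complex.Re (f t)) +i* (\int[mu]_t complex.Im (f t)).

Definition concentrated_on (d : measure_display) (T : measurableType d)
    (R : realType) (mu : set T -> \bar R) (A : set T) :=
  forall E, measurable E -> mu E = mu (A `&` E).

Definition mutually_singular (d : measure_display) (T : measurableType d)
    (R : realType) (mu1 mu2 : set T -> \bar R) :=
  exists A B : set T, [/\ measurable A, measurable B, A `&` B = set0,
    concentrated_on mu1 A & concentrated_on mu2 B].

Definition unit_disk (R : realType) : set R[i] := [set z | `|z| < 1].
Arguments unit_disk : clear implicits.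

(* Functions on the disk are represented by total functions on R[i]; every
   predicate below only depends on their values on unit_disk. *)

Definition Hinfty (R : realType) (f : R[i] -> R[i]) :=
  (forall z, unit_disk R z -> derivable f z 1) /\
  (exists M : R, forall z, unit_disk R z -> `|f z| <= M%:C).

Definition inner_function (R : realType) (f : R[i] -> R[i]) :=
  Hinfty f /\
  {ae @arc_length R, forall t : circle R,
    exists2 l : R[i], f (r%:C * circle_val t) @[r --> (1 : R)^'-] --> l & `|l| = 1}.

Definition singular_inner_with (R : realType) (theta : R[i] -> R[i])
    (mu : {finite_measure set (circle R) -> \bar R}) :=
  mutually_singular mu (@arc_length R) /\
  (forall z, unit_disk R z ->
    theta z = cexp (- cintegral mu (fun t : circle R => (circle_val t + z) / (circle_val t - z)))).

Definition inner_divisor (R : realType) (omega theta : R[i] -> R[i]) :=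
  inner_function omega /\
  (exists2 theta' : R[i] -> R[i], inner_function theta' &
    forall z, unit_disk R z -> theta z = omega z * theta' z).

Definition constant_on_disk (R : realType) (f : R[i] -> R[i]) :=
  exists c : R[i], forall z, unit_disk R z -> f z = c.

Definition coprime_inner (R : realType) (theta1 theta2 : R[i] -> R[i]) :=
  ~ (exists omega : R[i] -> R[i],
      [/\ inner_divisor omega theta1, inner_divisor omega theta2 &
          ~ constant_on_disk omega]).

(* Main.v *)
(* Write [theta_i = exp (- F_i)]; the real part of [F_i] is the Poisson integral
   of [mu_i].

   If [mu1] and [mu2] are not mutually singular, Hahn decompositions of
   [mu1 - mu2 / (n + 1)] give a set [E] with [mu2 E > 0] and [e > 0] such that
   [nu := e * mu2] restricted to [E] is below both measures.  The function
   [S := exp (- F_nu)] is a nonconstant divisor of [theta1] and [theta2], since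
   positivity of the Poisson kernel bounds the quotients by 1.  That [S] has
   unimodular radial limits follows from splitting [nu] into a part carried by a
   compact null set, off which everything extends continuously, and a part of
   small mass, for which [1 - Re S] is nonnegative, has a small mean, and obeys
   the Hardy-Littlewood weak-type inequality.

   Conversely a common inner divisor [w] satisfies
   [0 <= - ln |w| <= min (Re F_1) (Re F_2)], and the mean of [- ln |w|] over a
   circle of radius [s < 1] is at least [- ln |w 0|].  If [mu1] and [mu2] are
   nearly carried by disjoint compact sets, cut the circle into two parts, one
   away from each of them, and use [Re F_1] on one part and [Re F_2] on the other:
   as [s] tends to 1 these Poisson integrals are bounded by the small masses left
   out, whence [|w 0| = 1] and [w] is constant. *)

Require Import Defs.
From HB Require Import structures.
From mathcomp Require Import all_boot all_order all_algebra complex.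
From mathcomp Require Import all_classical all_reals all_analysis.
From mathcomp Require Import measurable_realfun.
From mathcomp Require Import ring lra.

Set Implicit Arguments.
Unset Strict Implicit.
Unset Printing Implicit Defensive.
Import Order.TTheory GRing.Theory Num.Theory numFieldNormedType.Exports.
Local Open Scope classical_set_scope.
Local Open Scope complex_scope.
Local Open Scope ring_scope.

(** Holomorphy here is complex differentiability in the open disk, and nothing is assumed on the
    circle. Cauchy theory is therefore built from Goursat's theorem on rectangles, carried to annuli
    by the exponential map, and boundary formulas are applied to dilates [f (q z)] with [q < 1]
    before [q] tends to 1. The bound [|w| <= 1], on which the converse rests, is not part of the
    definition of an inner function: it is recovered from the radial limits, the Poisson formula and
    bounded convergence. The decay of the Poisson integrals of [mu_i] comes from the symmetry of the
    kernel. By Fubini, integrating the Poisson integral of [mu_i] over a set [V] of the circle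
    amounts to integrating the Poisson integral of the indicator of [V] against [mu_i]. The latter
    is at most [2 pi] and tends to 0 at each point away from [V]; pointwise convergence is then
    enough, and no uniform distance between the two parts is needed. *)

(** * Real-valued modulus and epsilon-delta form of complex differentiability *)

Section complex_modulus.
Variable R : realType.
Notation C := R[i].
Notation Re := (@complex.Re _).
Notation Im := (@complex.Im _).
Implicit Types (z w : C) (f g : C -> C).

(** The norm of [R[i]] takes its values in [R[i]], whose order is partial; a modulus with values in
    [R] lets estimates be made in an ordered field. *)
Definition cabs z : R := Num.sqrt (Re z ^+ 2 + Im z ^+ 2).

Lemma normcE z : `|z| = (cabs z)%:C.
Proof. exact: normc_def. Qed.

Lemma cabs_ge0 z : 0 <= cabs z. Proof. exact: sqrtr_ge0. Qed.

Lemma cabsM z w : cabs (z * w) = cabs z * cabs w.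
Proof. by apply: complexI; rewrite rmorphM /= -!normcE normrM. Qed.

Lemma cabsV z : cabs z^-1 = (cabs z)^-1.
Proof. by apply: complexI; rewrite fmorphV /= -!normcE normfV. Qed.

Lemma cabsX z n : cabs (z ^+ n) = cabs z ^+ n.
Proof. by apply: complexI; rewrite rmorphXn /= -!normcE normrX. Qed.

Lemma cabsN z : cabs (- z) = cabs z.
Proof. by apply: complexI; rewrite -!normcE normrN. Qed.

Lemma cabsB z w : cabs (z - w) = cabs (w - z).
Proof. by apply: complexI; rewrite -!normcE distrC. Qed.

Lemma cabsD z w : cabs (z + w) <= cabs z + cabs w.
Proof. by rewrite -lecR rmorphD /= -!normcE ler_normD. Qed.

Lemma cabsD_dist z w : cabs z - cabs w <= cabs (z - w).
Proof. by rewrite lerBlDr (le_trans _ (cabsD _ _)) ?subrK. Qed.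

Lemma cabs_real (x : R) : cabs x%:C = `|x|.
Proof. by rewrite /cabs /= expr0n addr0 sqrtr_sqr. Qed.

Lemma cabs0 : cabs 0 = 0. Proof. by rewrite (cabs_real 0) normr0. Qed.

Lemma cabs1 : cabs 1 = 1. Proof. by rewrite (cabs_real 1) normr1. Qed.

Lemma cabs_eq0 z : (cabs z == 0) = (z == 0).
Proof. by rewrite -(inj_eq (@complexI R)) -normcE normr_eq0. Qed.

Lemma cabs_gt0 z : (0 < cabs z) = (z != 0).
Proof. by rewrite lt_def cabs_eq0 cabs_ge0 andbT. Qed.

Lemma cabs_sqr z : cabs z ^+ 2 = Re z ^+ 2 + Im z ^+ 2.
Proof. by rewrite sqr_sqrtr// addr_ge0// sqr_ge0. Qed.

Lemma ler_Re_cabs z : `|Re z| <= cabs z.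
Proof. by rewrite -sqrtr_sqr ler_wsqrtr// lerDl sqr_ge0. Qed.

Lemma ler_Im_cabs z : `|Im z| <= cabs z.
Proof. by rewrite -sqrtr_sqr ler_wsqrtr// lerDr sqr_ge0. Qed.

Lemma cabs_le_ReIm z : cabs z <= `|Re z| + `|Im z|.
Proof.
rewrite -(@ler_pXn2r _ 2)// ?nnegrE ?addr_ge0 ?cabs_ge0//.
by rewrite cabs_sqr sqrrD !real_normK ?num_real// lerD2r lerDl mulrn_wge0// mulr_ge0.
Qed.

Lemma cabs_lt1 z : unit_disk R z <-> cabs z < 1.
Proof. by rewrite /unit_disk /= normcE -ltcR. Qed.

Lemma ReD z w : Re (z + w) = Re z + Re w. Proof. by case: z w => ? ? []. Qed.
Lemma ImD z w : Im (z + w) = Im z + Im w. Proof. by case: z w => ? ? []. Qed.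
Lemma ReN z : Re (- z) = - Re z. Proof. by case: z. Qed.
Lemma ImN z : Im (- z) = - Im z. Proof. by case: z. Qed.
Lemma ReM z w : Re (z * w) = Re z * Re w - Im z * Im w.
Proof. by case: z w => ? ? []. Qed.
Lemma ImM z w : Im (z * w) = Re z * Im w + Im z * Re w.
Proof. by case: z w => ? ? []. Qed.

Lemma complex_ext z w : Re z = Re w -> Im z = Im w -> z = w.
Proof. by case: z w => ? ? [? ?] /= -> ->. Qed.

Lemma nbhs_cabs z (P : set C) :
  nbhs z P <-> exists2 d : R, 0 < d & forall w, cabs (w - z) < d -> P w.
Proof.
split.
  move=> /nbhs_ballP[e /= e0 H].
  (* The radius of a ball is a positive element of [R[i]], hence real. *)
  have [eR ee] : e = (Re e)%:C /\ 0 < Re e.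
    by move: e0; case: e {H} => a b; rewrite ltcE /= => /andP[/eqP-> ?].
  exists (Re e) => // w wz; apply: H.
  by rewrite /ball /= eR normcE cabsB ltcR.
move=> [d d0 H]; apply/nbhs_ballP; exists d%:C; first by rewrite /= ltcR.
by move=> w; rewrite /ball /= normcE cabsB ltcR; exact: H.
Qed.

Lemma cvg_cabs {T} (F : set_system T) {FF : Filter F} (h : T -> C) l :
  h @ F --> l <-> forall e : R, 0 < e -> \forall x \near F, cabs (h x - l) < e.
Proof.
split.
  move=> hl e e0; apply: (hl [set w | cabs (w - l) < e]).
  by apply/nbhs_cabs; exists e.
move=> H P /nbhs_cabs[d d0 HP]; apply: filterS (H _ d0) => x; exact: HP.
Qed.

Lemma continuous_cabsP f z : {for z, continuous f} <->
  forall e : R, 0 < e -> exists2 d : R, 0 < d & forall w, cabs (w - z) < d ->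
    cabs (f w - f z) < e.
Proof.
split=> [/(@cvg_cabs _ (nbhs z)) H e /H /nbhs_cabs//|H].
by apply/(@cvg_cabs _ (nbhs z)) => e /H /nbhs_cabs.
Qed.

Lemma cderD f g z : derivable f z 1 -> derivable g z 1 ->
  derivable (fun w => f w + g w) z 1.
Proof. exact: derivableD. Qed.

Lemma cderB f g z : derivable f z 1 -> derivable g z 1 ->
  derivable (fun w => f w - g w) z 1.
Proof. exact: derivableB. Qed.

Lemma cderM f g z : derivable f z 1 -> derivable g z 1 ->
  derivable (fun w => f w * g w) z 1.
Proof. exact: derivableM. Qed.

Lemma cderV f z : f z != 0 -> derivable f z 1 ->
  derivable (fun w => (f w)^-1) z 1.
Proof. exact: derivableV. Qed.

Lemma cder_id z : derivable (fun w : C => w) z 1.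
Proof. exact: derivable_id. Qed.

Lemma cder_cst (c : C) z : derivable (fun=> c) z 1.
Proof. exact: derivable_cst. Qed.

Lemma cder_comp f g z : derivable f z 1 -> derivable g (f z) 1 ->
  derivable (fun w => g (f w)) z 1.
Proof.
move=> /derivable1_diffP df /derivable1_diffP dg; apply/derivable1_diffP.
exact: (@differentiable_comp _ _ _ _ f g z df dg).
Qed.

Lemma cder_continuous f z : derivable f z 1 -> {for z, continuous f}.
Proof. by move=> /derivable1_diffP; exact: differentiable_continuous. Qed.

(** The difference quotient is multiplied out, so the case [w = z] needs no exclusion. *)
Lemma cderP f z : derivable f z 1 <-> exists d : C, forall e : R, 0 < e ->
  exists2 r : R, 0 < r & forall w, cabs (w - z) < r ->
    cabs (f w - f z - d * (w - z)) <= e * cabs (w - z).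
Proof.
pose quot (d w : C) := w^-1 *: (f (w *: 1 + z) - f z) - d.
have quotE d w : w != z -> f w - f z - d * (w - z) = quot d (w - z) * (w - z).
  move=> wz; rewrite /quot [_ *: 1]mulr1 subrK.
  by rewrite [_ *: _]mulrC mulrBl divfK// subr_eq0.
split.
  move=> /cvg_ex[d /(@cvg_cabs _ 0^') H]; exists d => e e0.
  have /nbhs_cabs[r r0 {}H] := H e e0.
  exists r => // w wz; have [->|wzn] := eqVneq w z.
    by rewrite !subrr mulr0 subr0 cabs0 mulr0.
  rewrite quotE// cabsM ler_wpM2r ?cabs_ge0//.
  by apply/ltW/H; rewrite ?subr0// subr_eq0.
move=> [d H]; apply/cvg_ex; exists d; apply/(@cvg_cabs _ 0^') => e e0.
have [|r r0 {}H] := H (e / 2); first by rewrite divr_gt0.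
apply/nbhs_cabs; exists r => // w; rewrite subr0 => wr w0.
have := H (w + z); rewrite addrK => /(_ wr).
have wz : w + z != z by rewrite -subr_eq0 addrK.
have := quotE d _ wz; rewrite addrK => ->.
rewrite cabsM ler_pM2r ?cabs_gt0// => /le_lt_trans; apply.
by rewrite ltr_pdivrMr// ltr_pMr// ltr1n.
Qed.

(** Meant for integrals with a parameter: a quadratic remainder of the kernel can be bounded under
    the integral sign. *)
Lemma cder_quadratic f z (d : C) (K r : R) : 0 < r ->
  (forall h, cabs h < r -> cabs (f (z + h) - f z - d * h) <= K * cabs h ^+ 2) ->
  derivable f z 1.
Proof.
move=> r0 H; apply/cderP; exists d => e e0.
have K0 : 0 < `|K| + 1 by rewrite ltr_wpDl.
exists (Num.min r (e / (`|K| + 1))); first by rewrite lt_min r0 divr_gt0.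
move=> w; rewrite lt_min => /andP[wr we].
have := H _ wr; rewrite [z + _]addrC subrK => /le_trans; apply.
rewrite expr2 mulrA ler_wpM2r ?cabs_ge0//.
move: we; rewrite ltr_pdivlMr// mulrC => /ltW; apply: le_trans.
by rewrite ler_wpM2r ?cabs_ge0// (le_trans (ler_norm _))// lerDl.
Qed.

End complex_modulus.

(** * The complex exponential *)

Section complex_exponential.
Variable R : realType.
Notation C := R[i].
Notation Re := (@complex.Re _).
Notation Im := (@complex.Im _).
Implicit Types (z w : C).

Lemma is_derive0_le (f : R -> R) (d e : R) : is_derive (0 : R) 1 f d -> 0 < e ->
  exists2 r : R, 0 < r & forall x, `|x| < r -> `|f x - f 0 - d * x| <= e * `|x|.
Proof.
move=> [df <-] e0.
have /cvgrPdist_le/(_ _ e0)/nbhs_ballP[r /= r0 H] := df.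
exists r => // x xr; have [->|x0] := eqVneq x 0.
  by rewrite subrr mulr0 subrr normr0 mulr0.
have := H x; rewrite /ball /= sub0r normrN => /(_ xr x0).
rewrite /shift /= [_ *: 1]mulr1 addr0 => {}H.
have -> : f x - f 0 - 'D_1 f 0 * x = (x^-1 * (f x - f 0) - 'D_1 f 0) * x.
  by field.
by rewrite normrM distrC ler_wpM2r.
Qed.

Lemma cexpD z w : cexp (z + w) = cexp z * cexp w.
Proof.
rewrite /cexp ReD ImD expRD cosD sinD; simpc.
by apply: complex_ext => /=; ring.
Qed.

Lemma cexp0 : cexp 0 = 1 :> C.
Proof. by rewrite /cexp expR0 cos0 sin0; simpc. Qed.

Lemma cabs_cexp z : cabs (cexp z) = expR (Re z).
Proof.
rewrite /cexp cabsM cabs_real ger0_norm ?expR_ge0//.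
by rewrite [cabs (_ +i* _)]/cabs /= cos2Dsin2 sqrtr1 mulr1.
Qed.

Lemma cexp_neq0 z : cexp z != 0.
Proof. by rewrite -cabs_gt0 cabs_cexp expR_gt0. Qed.

(** By [cexpD] it is enough to differentiate at 0, where the real derivatives of [expR], [cos] and
    [sin] are combined. *)
Lemma derivable_cexp z : derivable (@cexp R) z 1.
Proof.
suff H : derivable (@cexp R) 0 1.
  have -> : @cexp R = fun w => cexp z * cexp (w - z).
    by apply/funext => w; rewrite -cexpD addrC subrK.
  apply: cderM; first exact: cder_cst.
  apply: cder_comp; first by apply: cderB; [exact: cder_id|exact: cder_cst].
  by rewrite subrr.
apply/cderP; exists 1 => e e0.
(* With [c] the modulus of the increment, the four error terms below are at most [k c], [3 k c],
   [2 k c] and [3 k c]: in all [9 k c]. *)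
have [k [k0 k1 ke]] : exists k : R, [/\ 0 < k, k <= 1 & 9 * k <= e].
  exists (Num.min (e / 9) 1); rewrite lt_min ltr01 divr_gt0// ge_min lexx orbT.
  by split=> //; rewrite mulrC -ler_pdivlMr// ge_min lexx.
have [r1 r10 H1] := is_derive0_le (is_derive_expR 0) k0.
have [r2 r20 H2] := is_derive0_le (is_derive_cos 0) k0.
have [r3 r30 H3] := is_derive0_le (is_derive_sin 0) k0.
exists (Num.min (Num.min r1 r2) (Num.min r3 k)).
  by rewrite !lt_min r10 r20 r30 k0.
move=> [x y]; rewrite subr0 !lt_min => /andP[/andP[w1 w2] /andP[w3 wk]].
have xw := ler_Re_cabs (x +i* y); have yw := ler_Im_cabs (x +i* y).
move: xw yw => /= xw yw.
have := H1 _ (le_lt_trans xw w1); rewrite expR0 mul1r => {}H1.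
have := H2 _ (le_lt_trans yw w2); rewrite cos0 sin0 oppr0 mul0r subr0 => {}H2.
have := H3 _ (le_lt_trans yw w3); rewrite sin0 cos0 mul1r subr0 => {}H3.
rewrite cexp0 mul1r.
set c := cabs _ in w1 w2 w3 wk xw yw *.
apply: (le_trans (cabs_le_ReIm _)); rewrite /cexp /=.
set E := expR x in H1 *; set a := E - 1 - x in H1; set b := cos y - 1 in H2.
set d := sin y - y in H3.
have x1 : `|x| <= k by rewrite (le_trans xw)// ltW.
have Ex : `|E - 1| <= 2 * `|x|.
  have -> : E - 1 = a + x by rewrite /a; ring.
  rewrite (le_trans (ler_normD _ _))// mulrDl mul1r lerD2r (le_trans H1)//.
  by rewrite ler_piMl.
have E3 : `|E| <= 3.
  have -> : E = (E - 1) + 1 by ring.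
  by rewrite (le_trans (ler_normD _ _))// normr1; move: Ex x1 k1; lra.
have -> : (E * cos y - 0 * sin y - 1 - x) = a + E * b.
  by rewrite /a /b; ring.
have -> : (E * sin y + 0 * cos y - 0 - y) = (E - 1) * y + E * d.
  by rewrite /d; ring.
have T1 := ler_normD a (E * b); have T2 := ler_normD ((E - 1) * y) (E * d).
move: T1 T2; rewrite !normrM => T1 T2.
have Eb : `|E| * `|b| <= 3 * (k * c).
  by apply: ler_pM => //; rewrite (le_trans H2)// ler_wpM2l// ltW.
have Ed : `|E| * `|d| <= 3 * (k * c).
  by apply: ler_pM => //; rewrite (le_trans H3)// ler_wpM2l// ltW.
have Ey : `|E - 1| * `|y| <= 2 * (k * c).
  by rewrite mulrA; apply: ler_pM => //; rewrite (le_trans Ex)// ler_wpM2l.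
have ak : `|a| <= k * c by rewrite (le_trans H1)// ler_wpM2l// ltW.
have c0 : 0 <= c by exact: cabs_ge0.
have := ler_wpM2r c0 ke.
by move: T1 T2 Eb Ed Ey ak; rewrite -!mulrA; lra.
Qed.

Lemma derivable_affine (a b : C) z : derivable (fun w => a * w + b) z 1.
Proof.
apply: cderD; last exact: cder_cst.
by apply: cderM; [exact: cder_cst|exact: cder_id].
Qed.

End complex_exponential.

Arguments cder_id {R} z.
Arguments cder_cst {R} c z.
Arguments cderD {R f g z} _ _.
Arguments cderB {R f g z} _ _.
Arguments cderM {R f g z} _ _.
Arguments cderV {R f z} _ _.
Arguments cder_comp {R f g z} _ _.
Arguments derivable_cexp {R} z.
Arguments derivable_affine {R} a b z.

(** * Bounded measurable functions, real and complex *)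

Section bounded_measurable.
Context d (T : measurableType d) (R : realType).
Notation C := R[i].
Notation Re := (@complex.Re _).
Notation Im := (@complex.Im _).
Implicit Types (D : set T) (f g : T -> R) (u v : T -> C).

(** This class is stable under the algebraic operations and integrable on sets of finite measure, so
    that integrability becomes a structural check. *)
Definition bmf D f := measurable_fun D f /\ exists M : R, forall x, D x -> `|f x| <= M.

Definition cbmf D u := bmf D (Re \o u) /\ bmf D (Im \o u).

Lemma bmf_cst D (r : R) : bmf D (fun=> r).
Proof. by split; [exact: measurable_cst|exists `|r|]. Qed.

Lemma bmfD D f g : bmf D f -> bmf D g -> bmf D (fun x => f x + g x).
Proof.
move=> [mf [M fM]] [mg [N gN]]; split; first exact: measurable_funD.
by exists (M + N) => x Dx; rewrite (le_trans (ler_normD _ _))// lerD ?fM ?gN.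
Qed.

Lemma bmfM D f g : bmf D f -> bmf D g -> bmf D (fun x => f x * g x).
Proof.
move=> [mf [M fM]] [mg [N gN]]; split; first exact: measurable_funM.
by exists (M * N) => x Dx; rewrite normrM ler_pM ?fM ?gN.
Qed.

Lemma bmfN D f : bmf D f -> bmf D (fun x => - f x).
Proof.
move=> [mf [M fM]]; split; first exact: measurableT_comp.
by exists M => x Dx; rewrite normrN fM.
Qed.

Lemma bmfB D f g : bmf D f -> bmf D g -> bmf D (fun x => f x - g x).
Proof. by move=> bf bg; apply: bmfD => //; exact: bmfN. Qed.

Lemma bmf_norm D f : bmf D f -> bmf D (fun x => `|f x|).
Proof.
move=> [mf [M fM]]; split; first exact: measurableT_comp.
by exists M => x Dx; rewrite normr_id fM.
Qed.

Lemma bmf_indic D (A : set T) : measurable A -> bmf D (\1_A : T -> R).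
Proof.
move=> mA; split; first exact: measurable_indic.
by exists 1 => x _; rewrite indicE; case: (_ \in _); rewrite ?normr1 ?normr0.
Qed.

Lemma bmfS D D' f : measurable D -> D' `<=` D -> bmf D f -> bmf D' f.
Proof.
move=> mD D'D [mf [M fM]]; split; first exact: measurable_funS mf.
by exists M => x /D'D /fM.
Qed.

Lemma cbmfS D D' u : measurable D -> D' `<=` D -> cbmf D u -> cbmf D' u.
Proof. by move=> mD DD [? ?]; split; apply: bmfS DD _. Qed.

Lemma cbmf_cst D (c : C) : cbmf D (fun=> c).
Proof. by split; exact: bmf_cst. Qed.

Lemma cbmfD D u v : cbmf D u -> cbmf D v -> cbmf D (fun x => u x + v x).
Proof.
move=> [ru iu] [rv iv]; split.
  rewrite (_ : _ \o _ = fun x => Re (u x) + Re (v x)); first exact: bmfD.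
  by apply/funext => x /=; rewrite ReD.
rewrite (_ : _ \o _ = fun x => Im (u x) + Im (v x)); first exact: bmfD.
by apply/funext => x /=; rewrite ImD.
Qed.

Lemma cbmfM D u v : cbmf D u -> cbmf D v -> cbmf D (fun x => u x * v x).
Proof.
move=> [ru iu] [rv iv]; split.
  rewrite (_ : _ \o _ = fun x => Re (u x) * Re (v x) - Im (u x) * Im (v x)).
    by apply: bmfB; exact: bmfM.
  by apply/funext => x /=; rewrite ReM.
rewrite (_ : _ \o _ = fun x => Re (u x) * Im (v x) + Im (u x) * Re (v x)).
  by apply: bmfD; exact: bmfM.
by apply/funext => x /=; rewrite ImM.
Qed.

Lemma cbmfN D u : cbmf D u -> cbmf D (fun x => - u x).
Proof.
move=> [ru iu]; split.
  rewrite (_ : _ \o _ = fun x => - Re (u x)); first exact: bmfN.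
  by apply/funext => x /=; rewrite ReN.
rewrite (_ : _ \o _ = fun x => - Im (u x)); first exact: bmfN.
by apply/funext => x /=; rewrite ImN.
Qed.

Lemma cbmfB D u v : cbmf D u -> cbmf D v -> cbmf D (fun x => u x - v x).
Proof. by move=> bu bv; apply: cbmfD => //; exact: cbmfN. Qed.

End bounded_measurable.

(** * Integrals of complex functions *)

Section complex_integral.
Context d (T : measurableType d) (R : realType).
Variable mu : {measure set T -> \bar R}.
Notation C := R[i].
Notation Re := (@complex.Re _).
Notation Im := (@complex.Im _).
Implicit Types (D : set T) (f g : T -> R) (u v : T -> C).

(** [cintegral] over a subset; for [setT] the two agree by computation. *)
Definition cint D u : C :=
  (\int[mu]_(x in D) Re (u x)) +i* (\int[mu]_(x in D) Im (u x)).

Variable D : set T.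
Hypotheses (mD : measurable D) (finD : (mu D < +oo)%E).

Lemma bmf_integrable f : bmf D f -> mu.-integrable D (EFin \o f).
Proof.
move=> [mf [M fM]]; apply: measurable_bounded_integrable => //.
exists M; split; first exact: num_real.
by move=> N /ltW MN x Dx; exact: le_trans (fM _ Dx) MN.
Qed.

Lemma RintD f g : bmf D f -> bmf D g ->
  \int[mu]_(x in D) (f x + g x) = \int[mu]_(x in D) f x + \int[mu]_(x in D) g x.
Proof. by move=> /bmf_integrable bf /bmf_integrable bg; rewrite RintegralD. Qed.

Lemma RintB f g : bmf D f -> bmf D g ->
  \int[mu]_(x in D) (f x - g x) = \int[mu]_(x in D) f x - \int[mu]_(x in D) g x.
Proof. by move=> /bmf_integrable bf /bmf_integrable bg; rewrite RintegralB. Qed.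

Lemma RintZ (r : R) f : bmf D f ->
  \int[mu]_(x in D) (r * f x) = r * \int[mu]_(x in D) f x.
Proof. by move=> /bmf_integrable bf; rewrite RintegralZl. Qed.

Lemma Rint_le f g : bmf D f -> bmf D g -> (forall x, D x -> f x <= g x) ->
  \int[mu]_(x in D) f x <= \int[mu]_(x in D) g x.
Proof. by move=> /bmf_integrable bf /bmf_integrable bg fg; exact: le_Rintegral. Qed.

Lemma Rint_norm_le f (M : R) : bmf D f -> (forall x, D x -> `|f x| <= M) ->
  `|\int[mu]_(x in D) f x| <= M * fine (mu D).
Proof.
move=> bf fM; apply: (le_trans (le_normr_Rintegral _ (bmf_integrable bf))) => //.
rewrite -Rintegral_cst//; apply: Rint_le => //; last exact: bmf_cst.
exact: bmf_norm.
Qed.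

Lemma cintD u v : cbmf D u -> cbmf D v ->
  cint D (fun x => u x + v x) = cint D u + cint D v.
Proof.
move=> [ru iu] [rv iv]; rewrite /cint; apply: complex_ext => /=.
  rewrite -(RintD ru rv); apply: eq_Rintegral => x _; exact: ReD.
rewrite -(RintD iu iv); apply: eq_Rintegral => x _; exact: ImD.
Qed.

Lemma cintB u v : cbmf D u -> cbmf D v ->
  cint D (fun x => u x - v x) = cint D u - cint D v.
Proof.
move=> [ru iu] [rv iv]; rewrite /cint; apply: complex_ext => /=.
  rewrite -(RintB ru rv); apply: eq_Rintegral => x _; by rewrite ReD ReN.
rewrite -(RintB iu iv); apply: eq_Rintegral => x _; by rewrite ImD ImN.
Qed.

Lemma cintZ (c : C) u : cbmf D u -> cint D (fun x => c * u x) = c * cint D u.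
Proof.
move=> [ru iu]; rewrite /cint; apply: complex_ext => /=; rewrite ?ReM ?ImM /=.
  rewrite -(RintZ _ ru) -(RintZ _ iu) -RintB.
  - by apply: eq_Rintegral => x _; rewrite ReM.
  - by apply: bmfM => //; exact: bmf_cst.
  - by apply: bmfM => //; exact: bmf_cst.
rewrite -(RintZ _ ru) -(RintZ _ iu) -RintD.
- by apply: eq_Rintegral => x _; rewrite ImM.
- by apply: bmfM => //; exact: bmf_cst.
- by apply: bmfM => //; exact: bmf_cst.
Qed.

Lemma eq_cint u v : (forall x, D x -> u x = v x) -> cint D u = cint D v.
Proof.
by move=> uv; congr (_ +i* _); apply: eq_Rintegral => x /set_mem Dx; rewrite uv.
Qed.

Lemma cint_cst (c : C) : cint D (fun=> c) = c * (fine (mu D))%:C.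
Proof.
rewrite /cint !Rintegral_cst//; apply: complex_ext; rewrite ?ReM ?ImM /=.
  by rewrite mulr0 subr0.
by rewrite mulr0 add0r.
Qed.

(* The sharp constant is 1, see [cint_norm_sharp]. *)
Lemma cint_norm_le u (M : R) : cbmf D u -> (forall x, D x -> cabs (u x) <= M) ->
  cabs (cint D u) <= 2 * M * fine (mu D).
Proof.
move=> [ru iu] uM; apply: (le_trans (cabs_le_ReIm _)) => /=.
rewrite -mulrA mulrDl mul1r; apply: lerD; apply: Rint_norm_le => // x Dx /=.
  exact: le_trans (ler_Re_cabs _) (uM _ Dx).
exact: le_trans (ler_Im_cabs _) (uM _ Dx).
Qed.

End complex_integral.

(** * Integrals along segments *)

Section segment_integral.
Variable R : realType.
Notation C := R[i].
Notation Re := (@complex.Re _).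
Notation Im := (@complex.Im _).
Notation leb := (@lebesgue_measure R).
Implicit Types (u : R -> C) (h : R -> R).

Lemma segment_measure (a b : R) : a <= b -> leb `[a, b]%classic = (b - a)%:E.
Proof.
move=> ab; rewrite lebesgue_measure_itv /= lte_fin.
by have [//|ba] := ltP a b; rewrite (le_anti (introT andP (conj ab ba))) subrr.
Qed.

Lemma segment_fin (a b : R) : (leb `[a, b]%classic < +oo)%E.
Proof. by rewrite lebesgue_measure_itv /=; case: ifP => // _; rewrite ltry. Qed.

Lemma continuous_bmf (a b : R) h :
  (forall x, a <= x <= b -> {for x, continuous h}) -> bmf `[a, b]%classic h.
Proof.
move=> ch; have wh : {within `[a, b], continuous h}.
  apply: continuous_in_subspaceT => x /set_mem; rewrite /= in_itv /=.
  exact: ch.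
split; first exact: subspace_continuous_measurable_fun.
have /compact_bounded[M [_ mrt]] :=
  continuous_compact wh (@segment_compact R a b).
exists (M + 1) => x abx; apply: (mrt (M + 1)); first by rewrite ltrDl.
by exists x.
Qed.

Lemma continuous_cbmf (a b : R) u :
  (forall x, a <= x <= b -> {for x, continuous u}) -> cbmf `[a, b]%classic u.
Proof.
move=> cu; split; apply: continuous_bmf => x /cu /cvg_cabs H;
  apply/cvgrPdist_lt => e /H; apply: filterS => y; apply: le_lt_trans.
  by rewrite distrC /= -ReN -ReD; exact: ler_Re_cabs.
by rewrite distrC /= -ImN -ImD; exact: ler_Im_cabs.
Qed.

Lemma cint_split (a m b : R) u : a <= m -> m <= b -> cbmf `[a, b]%classic u ->
  cint leb `[a, b]%classic u =
  cint leb `[a, m]%classic u + cint leb `[m, b]%classic u.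
Proof.
move=> am mb [ru iu]; rewrite /cint; apply: complex_ext => /=.
  apply/eqP; rewrite addrC -subr_eq; apply/eqP.
  have iru := @bmf_integrable _ _ _ leb _ (measurable_itv _) (segment_fin a b) _ ru.
  rewrite (Rintegral_itvB iru) ?bnd_simp// Rintegral_itv_obnd_cbnd//.
  apply: integrableS iru => //.
  by move=> x /=; rewrite !in_itv /= => /andP[/ltW mx ->]; rewrite (le_trans am).
apply/eqP; rewrite addrC -subr_eq; apply/eqP.
have iru := @bmf_integrable _ _ _ leb _ (measurable_itv _) (segment_fin a b) _ iu.
rewrite (Rintegral_itvB iru) ?bnd_simp// Rintegral_itv_obnd_cbnd//.
apply: integrableS iru => //.
by move=> x /=; rewrite !in_itv /= => /andP[/ltW mx ->]; rewrite (le_trans am).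
Qed.

Lemma horizontal_continuous (g : C -> C) (x y : R) :
  {for x +i* y, continuous g} -> {for x, continuous (fun x' => g (x' +i* y))}.
Proof.
move=> /continuous_cabsP H; apply/(@cvg_cabs _ _ (nbhs x)) => e /H[d d0 Hd].
apply/nbhs_ballP; exists d => // x'; rewrite /ball /= => xx; apply: Hd.
have -> : x' +i* y - (x +i* y) = (x' - x)%:C by apply: complex_ext => /=; ring.
by rewrite cabs_real distrC.
Qed.

Lemma vertical_continuous (g : C -> C) (x y : R) :
  {for x +i* y, continuous g} -> {for y, continuous (fun y' => g (x +i* y'))}.
Proof.
move=> /continuous_cabsP H; apply/(@cvg_cabs _ _ (nbhs y)) => e /H[d d0 Hd].
apply/nbhs_ballP; exists d => // y'; rewrite /ball /= => xx; apply: Hd.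
have -> : x +i* y' - (x +i* y) = 'i * (y' - y)%:C.
  by simpc; apply: complex_ext => /=; ring.
by rewrite cabsM cabs_real distrC /cabs /= expr0n expr1n add0r sqrtr1 mul1r.
Qed.

End segment_integral.

(** * Nested rectangles for a subadditive function of rectangles *)

Section bisection.
Variable R : realType.
Variable J : R -> R -> R -> R -> R.
Variables a c W H : R.
Hypotheses (W0 : 0 <= W) (H0 : 0 <= H).
Hypothesis J4 : forall x y w h : R, a <= x -> c <= y -> 0 <= w -> 0 <= h ->
  x + w + w <= a + W -> y + h + h <= c + H ->
  J x (x + w + w) y (y + h + h) <=
    J x (x + w) y (y + h) + J (x + w) (x + w + w) y (y + h) +
    (J x (x + w) (y + h) (y + h + h) + J (x + w) (x + w + w) (y + h) (y + h + h)).

Let w n := W / 2 ^+ n.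
Let h n := H / 2 ^+ n.
Let Jn n (p : R * R) := J p.1 (p.1 + w n) p.2 (p.2 + h n).
(** Chooses a quarter of the rectangle that keeps at least a fourth of [J]. The last quarter needs
    no test: when the other three fail, [J4] forces it. *)
Let step n (p : R * R) : R * R :=
  let big q := Jn n p <= 4 * Jn n.+1 q in
  let p2 := (p.1 + w n.+1, p.2) in
  let p3 := (p.1, p.2 + h n.+1) in
  let p4 := (p.1 + w n.+1, p.2 + h n.+1) in
  if big p then p else if big p2 then p2 else if big p3 then p3 else p4.
Fixpoint corner n : R * R := if n is n'.+1 then step n' (corner n') else (a, c).

Let w_ge0 n : 0 <= w n. Proof. by rewrite divr_ge0// exprn_ge0. Qed.
Let h_ge0 n : 0 <= h n. Proof. by rewrite divr_ge0// exprn_ge0. Qed.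
Let wS n : w n = w n.+1 + w n.+1.
Proof. by rewrite /w exprS; field; rewrite expf_neq0. Qed.
Let hS n : h n = h n.+1 + h n.+1.
Proof. by rewrite /h exprS; field; rewrite expf_neq0. Qed.

Let stepE n p : exists i j : bool, step n p =
  (p.1 + (if i then w n.+1 else 0), p.2 + (if j then h n.+1 else 0)).
Proof.
rewrite /step; case: p => x y /=.
case: ifP => _; first by exists false, false; rewrite !addr0.
case: ifP => _; first by exists true, false; rewrite !addr0.
case: ifP => _; first by exists false, true; rewrite !addr0.
by exists true, true.
Qed.

Let corner_mono n : [/\ (corner n).1 <= (corner n.+1).1,
  (corner n).2 <= (corner n.+1).2,
  (corner n.+1).1 + w n.+1 <= (corner n).1 + w n &
  (corner n.+1).2 + h n.+1 <= (corner n).2 + h n].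
Proof.
rewrite /=; have [i [j ->]] := stepE n (corner n) => /=.
have := w_ge0 n.+1; have := h_ge0 n.+1; have := wS n; have := hS n.
by case: i; case: j => ? ? ? ?; split; lra.
Qed.

Let corner_le m n : (m <= n)%N -> [/\ (corner m).1 <= (corner n).1,
  (corner m).2 <= (corner n).2,
  (corner n).1 + w n <= (corner m).1 + w m &
  (corner n).2 + h n <= (corner m).2 + h m].
Proof.
elim: n => [|n IH]; first by rewrite leqn0 => /eqP ->; rewrite !lexx.
rewrite leq_eqVlt => /predU1P[->|]; first by rewrite !lexx.
rewrite ltnS => /IH[h1 h2 h3 h4]; have [k1 k2 k3 k4] := corner_mono n.
by split; [exact: le_trans k1|exact: le_trans k2|exact: le_trans h3|
  exact: le_trans h4].
Qed.

Let Jn_step n : Jn n (corner n) <= 4 * Jn n.+1 (corner n.+1).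
Proof.
have [] := @corner_le 0 n isT; rewrite /= /w /h expr0 !divr1 -/(w n) -/(h n).
move=> ax cy xW yH; rewrite /= /step.
case: ifPn => [//|]; rewrite -ltNge => N1; case: ifPn => [//|]; rewrite -ltNge => N2.
case: ifPn => [//|]; rewrite -ltNge => N3; move: N1 N2 N3 ax cy xW yH.
case: (corner n) => x y; rewrite /Jn /= => N1 N2 N3 ax cy xW yH.
have := J4 ax cy (w_ge0 n.+1) (h_ge0 n.+1).
move: N1 N2 N3; rewrite -!(addrA _ (w _)) -!(addrA _ (h _)) -wS -hS.
by move=> N1 N2 N3 /(_ xW yH) JJ; move: N1 N2 N3 JJ; lra.
Qed.

(** If [J] were positive on the whole rectangle, nested rectangles carrying at least [J / 4 ^+ n]
    would shrink to a point [(p, q)] near which [J] is negligible against [(w + h) ^+ 2], that is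
    against [4 ^- n]. *)
Lemma bisection :
  (forall p q e : R, a <= p <= a + W -> c <= q <= c + H -> 0 < e ->
    exists2 r : R, 0 < r & forall x y w h : R, a <= x -> c <= y ->
      0 <= w < r -> 0 <= h < r -> x + w <= a + W -> y + h <= c + H ->
      x <= p <= x + w -> y <= q <= y + h ->
      J x (x + w) y (y + h) <= e * (w + h) ^+ 2) ->
  J a (a + W) c (c + H) <= 0.
Proof.
move=> HJ; rewrite leNgt; apply/negP => J0.
have Jge n : J a (a + W) c (c + H) / 4 ^+ n <= Jn n (corner n).
  elim: n => [|n IH]; first by rewrite /Jn /w /h /= !expr0 !divr1.
  rewrite exprS invfM mulrCA ler_pdivrMl//.
  by rewrite (le_trans IH)// Jn_step.
have bnd (f : nat -> R) (g : nat -> R) :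
    (forall m n, (m <= n)%N -> f m <= f n /\ f n + g n <= f m + g m) ->
    (forall n, 0 <= g n) -> exists p, forall n, f n <= p <= f n + g n.
  move=> fg g0.
  have ub m n : f m <= f n + g n.
    have [/fg[+ _]|/ltnW/fg[_]] := leqP m n.
      by move/le_trans; apply; rewrite lerDl.
    by apply: le_trans; rewrite lerDl.
  have hs : has_sup (range f).
    by split; [exists (f 0%N), 0%N|exists (f 0%N + g 0%N) => _ [n _ <-]].
  exists (sup (range f)) => n; apply/andP; split.
    by apply: ub_le_sup; [exact: hs.2|exists n].
  by apply: ge_sup; [exact: hs.1|move=> _ [m _ <-]].
have [p Hp] : exists p, forall n, (corner n).1 <= p <= (corner n).1 + w n.
  by apply: bnd => // m n /corner_le[].
have [q Hq] : exists p, forall n, (corner n).2 <= p <= (corner n).2 + h n.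
  by apply: bnd => // m n /corner_le[].
set J1 := J _ _ _ _ in J0 Jge.
have WH1 : 0 < (W + H) ^+ 2 + 1 by rewrite ltr_wpDl// sqr_ge0.
(* With this tolerance the [n]-th rectangle gets a bound below [J1 / 4 ^+ n]; the [+ 1] covers
   [W + H = 0]. *)
have := HJ p q (J1 / (2 * ((W + H) ^+ 2 + 1))).
case.
- by have := Hp 0%N; rewrite /w expr0 divr1.
- by have := Hq 0%N; rewrite /h expr0 divr1.
- by rewrite divr_gt0// mulr_gt0.
move=> r r0 Hr.
have [n Hn] : exists n, (W + H) / 2 ^+ n < r.
  have [n Hn] : exists n : nat, (W + H) / r < n%:R.
    by exists (Num.truncn ((W + H) / r)).+1; rewrite truncnS_gt// divr_ge0// ?addr_ge0// ltW.
  exists n; rewrite ltr_pdivrMr ?exprn_gt0// mulrC -ltr_pdivrMr//.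
  by rewrite (lt_trans Hn)// -natrX ltr_nat ltn_expl.
have wr : 0 <= w n < r.
  rewrite w_ge0 (le_lt_trans _ Hn)// ler_wpM2r ?invr_ge0 ?exprn_ge0//.
  by rewrite lerDl.
have hr : 0 <= h n < r.
  rewrite h_ge0 (le_lt_trans _ Hn)// ler_wpM2r ?invr_ge0 ?exprn_ge0//.
  by rewrite lerDr.
have [] := @corner_le 0 n isT; rewrite /= /w /h expr0 !divr1 -/(w n) -/(h n).
move=> ax cy xW yH.
have := Hr _ _ _ _ ax cy wr hr xW yH (Hp n) (Hq n).
apply/negP; rewrite -ltNge; apply: lt_le_trans (Jge n).
rewrite /w /h -mulrDl expr_div_n -exprM mulnC exprM.
have -> : (2 ^+ 2 : R) = 4 by rewrite -natrX.
rewrite mulrA ltr_pM2r ?invr_gt0 ?exprn_gt0//.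
rewrite mulrAC ltr_pdivrMr ?mulr_gt0// ltr_pM2l//.
have := sqr_ge0 (W + H); lra.
Qed.

End bisection.

(** * Goursat's theorem on rectangles *)

Section goursat.
Variable R : realType.
Notation C := R[i].
Notation Re := (@complex.Re _).
Notation Im := (@complex.Im _).
Notation leb := (@lebesgue_measure R).
Implicit Types (g : C -> C) (a b c d : R).

Definition rect_continuous g a b c d := forall x y,
  a <= x <= b -> c <= y <= d -> {for x +i* y, continuous g}.

(** The counterclockwise contour integral along the boundary, opposite sides being paired; ['i]
    comes from [dw = 'i dy] on vertical sides. *)
Definition rect_int g a b c d :=
  cint leb `[a, b]%classic (fun x => g (x +i* c) - g (x +i* d)) +
  'i * cint leb `[c, d]%classic (fun y => g (b +i* y) - g (a +i* y)).

Lemma horizontal_cbmf g a b y :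
  (forall x, a <= x <= b -> {for x +i* y, continuous g}) ->
  cbmf `[a, b]%classic (fun x => g (x +i* y)).
Proof. by move=> cg; apply: continuous_cbmf => x /cg; exact: horizontal_continuous. Qed.

Lemma vertical_cbmf g c d x :
  (forall y, c <= y <= d -> {for x +i* y, continuous g}) ->
  cbmf `[c, d]%classic (fun y => g (x +i* y)).
Proof. by move=> cg; apply: continuous_cbmf => y /cg; exact: vertical_continuous. Qed.

Lemma rect_int_splitx g a m b c d : a <= m -> m <= b -> c <= d ->
  rect_continuous g a b c d ->
  rect_int g a b c d = rect_int g a m c d + rect_int g m b c d.
Proof.
move=> am mb cd cg; have ab := le_trans am mb.
have hc y : c <= y <= d -> cbmf `[a, b]%classic (fun x => g (x +i* y)).
  by move=> cyd; apply: horizontal_cbmf => x axb; exact: cg.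
have vc x : a <= x <= b -> cbmf `[c, d]%classic (fun y => g (x +i* y)).
  by move=> axb; apply: vertical_cbmf => y cyd; exact: cg.
rewrite /rect_int (cint_split am mb); last first.
  by apply: cbmfB; apply: hc; rewrite ?lexx ?cd.
rewrite [X in 'i * X](_ : _ =
    cint leb `[c, d]%classic (fun y => g (m +i* y) - g (a +i* y)) +
    cint leb `[c, d]%classic (fun y => g (b +i* y) - g (m +i* y))).
  by rewrite mulrDr addrACA.
rewrite -cintD//; last 3 first.
- exact: segment_fin.
- by apply: cbmfB; apply: vc; rewrite ?lexx ?am ?mb ?ab.
- by apply: cbmfB; apply: vc; rewrite ?lexx ?am ?mb ?ab.
by apply: eq_cint => y _; ring.
Qed.

Lemma rect_int_splity g a b c m d : a <= b -> c <= m -> m <= d ->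
  rect_continuous g a b c d ->
  rect_int g a b c d = rect_int g a b c m + rect_int g a b m d.
Proof.
move=> ab cm md cg; have cd := le_trans cm md.
have hc y : c <= y <= d -> cbmf `[a, b]%classic (fun x => g (x +i* y)).
  by move=> cyd; apply: horizontal_cbmf => x axb; exact: cg.
have vc x : a <= x <= b -> cbmf `[c, d]%classic (fun y => g (x +i* y)).
  by move=> axb; apply: vertical_cbmf => y cyd; exact: cg.
rewrite /rect_int (cint_split cm md); last first.
  by apply: cbmfB; apply: vc; rewrite ?lexx ?ab.
rewrite [X in X + _](_ : _ =
    cint leb `[a, b]%classic (fun x => g (x +i* c) - g (x +i* m)) +
    cint leb `[a, b]%classic (fun x => g (x +i* m) - g (x +i* d))).
  by rewrite mulrDr addrACA.
rewrite -cintD//; last 3 first.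
- exact: segment_fin.
- by apply: cbmfB; apply: hc; rewrite ?lexx ?cm ?md ?cd.
- by apply: cbmfB; apply: hc; rewrite ?lexx ?cm ?md ?cd.
by apply: eq_cint => y _; ring.
Qed.

Lemma segment_cint_cst (z : C) a b : a <= b ->
  cint leb `[a, b]%classic (fun=> z) = z * (b - a)%:C.
Proof.
move=> ab; rewrite cint_cst//; congr (_ * (_)%:C).
by rewrite -[RHS]/(fine (b - a)%:E) -segment_measure.
Qed.

Lemma segment_cint_le (u : R -> C) a b (M : R) : a <= b ->
  cbmf `[a, b]%classic u -> (forall x, a <= x <= b -> cabs (u x) <= M) ->
  cabs (cint leb `[a, b]%classic u) <= 2 * M * (b - a).
Proof.
move=> ab bu uM; rewrite -[b - a]/(fine (b - a)%:E) -segment_measure//.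
by apply: cint_norm_le => //; exact: segment_fin.
Qed.

Lemma rect_int_affine (al be : C) a b c d : a <= b -> c <= d ->
  rect_int (fun w => al + be * w) a b c d = 0.
Proof.
move=> ab cd; rewrite /rect_int.
rewrite (_ : cint _ _ _ = cint leb `[a, b]%classic (fun=> be * ('i * (c - d)%:C))); last first.
  apply: eq_cint => x _.
  have -> : 'i * (c - d)%:C = (x +i* c) - (x +i* d).
    by simpc; apply: complex_ext => /=; ring.
  by ring.
rewrite [X in _ + 'i * X](_ : _ = cint leb `[c, d]%classic (fun=> be * (b - a)%:C)); last first.
  apply: eq_cint => y _.
  have -> : (b - a)%:C = (b +i* y) - (a +i* y).
    by apply: complex_ext => /=; ring.
  by ring.
rewrite !segment_cint_cst//.
have -> : (d - c)%:C = - (c - d)%:C by rewrite -rmorphN opprB.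
ring.
Qed.

Lemma rect_int_le g a b c d (M : R) : a <= b -> c <= d ->
  rect_continuous g a b c d ->
  (forall x y, a <= x <= b -> c <= y <= d -> cabs (g (x +i* y)) <= M) ->
  cabs (rect_int g a b c d) <= 4 * M * ((b - a) + (d - c)).
Proof.
move=> ab cd cg gM.
have hc y : c <= y <= d -> cbmf `[a, b]%classic (fun x => g (x +i* y)).
  by move=> cyd; apply: horizontal_cbmf => x axb; exact: cg.
have vc x : a <= x <= b -> cbmf `[c, d]%classic (fun y => g (x +i* y)).
  by move=> axb; apply: vertical_cbmf => y cyd; exact: cg.
apply: (le_trans (cabsD _ _)); rewrite cabsM.
have -> : cabs 'i = 1 :> R by rewrite /cabs /= expr0n expr1n add0r sqrtr1.
rewrite mul1r mulrDr; apply: lerD.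
  apply: (le_trans (@segment_cint_le _ _ _ (2 * M) _ _ _)) => //.
  - by apply: cbmfB; apply: hc; rewrite ?lexx ?cd.
  - move=> x xab; rewrite (le_trans (cabsD _ _))// cabsN.
    by rewrite mulrDl mul1r lerD// gM// lexx cd.
  by rewrite mulrA -natrM.
apply: (le_trans (@segment_cint_le _ _ _ (2 * M) _ _ _)) => //.
- by apply: cbmfB; apply: vc; rewrite ?lexx ?ab.
- move=> x xab; rewrite (le_trans (cabsD _ _))// cabsN.
  by rewrite mulrDl mul1r lerD// gM// lexx ab.
by rewrite mulrA -natrM.
Qed.

Lemma rect_intB g g' a b c d : a <= b -> c <= d ->
  rect_continuous g a b c d -> rect_continuous g' a b c d ->
  rect_int (fun w => g w - g' w) a b c d = rect_int g a b c d - rect_int g' a b c d.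
Proof.
move=> ab cd cg cg'.
have hc h y : rect_continuous h a b c d -> c <= y <= d ->
    cbmf `[a, b]%classic (fun x => h (x +i* y)).
  by move=> ch cyd; apply: horizontal_cbmf => x axb; exact: ch.
have vc h x : rect_continuous h a b c d -> a <= x <= b ->
    cbmf `[c, d]%classic (fun y => h (x +i* y)).
  by move=> ch axb; apply: vertical_cbmf => y cyd; exact: ch.
rewrite /rect_int opprD addrACA -mulrBr -!cintB//.
- congr (_ + 'i * _); apply: eq_cint => x _; ring.
- exact: segment_fin.
- by apply: cbmfB; apply: vc; rewrite ?lexx ?ab.
- by apply: cbmfB; apply: vc; rewrite ?lexx ?ab.
- exact: segment_fin.
- by apply: cbmfB; apply: hc; rewrite ?lexx ?cd.
- by apply: cbmfB; apply: hc; rewrite ?lexx ?cd.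
Qed.

(* The affine part of [g] at a point of differentiability integrates to 0. *)
Theorem goursat g a b c d : a <= b -> c <= d ->
  (forall x y, a <= x <= b -> c <= y <= d -> derivable g (x +i* y) 1) ->
  rect_int g a b c d = 0.
Proof.
move=> ab cd dg.
have cg a' b' c' d' : a <= a' -> b' <= b -> c <= c' -> d' <= d ->
    rect_continuous g a' b' c' d'.
  move=> aa bb cc dd x y /andP[ax xb] /andP[cy yd].
  apply: cder_continuous; apply: dg.
    by rewrite (le_trans aa) ?(le_trans xb).
  by rewrite (le_trans cc) ?(le_trans yd).
suff : cabs (rect_int g a b c d) <= 0.
  by move=> h; apply/eqP; rewrite -cabs_eq0 eq_le h cabs_ge0.
have Eb : b = a + (b - a) by ring.
have Ed : d = c + (d - c) by ring.
rewrite Eb Ed; apply: (bisection (J := fun a b c d => cabs (rect_int g a b c d))).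
- by rewrite subr_ge0.
- by rewrite subr_ge0.
- move=> x y w h ax cy w0 h0; rewrite -Eb -Ed => xb yd.
  rewrite (@rect_int_splity _ _ _ _ (y + h)) ?lerDl//; first last.
  - by apply: cg.
  - by rewrite -addrA lerDl addr_ge0.
  have xw : x + w <= x + w + w by rewrite lerDl.
  have yh : y + h <= y + h + h by rewrite lerDl.
  rewrite !(@rect_int_splitx _ x (x + w) (x + w + w)) ?lerDl//; first last.
  - by apply: cg => //; exact: le_trans yd.
  - by apply: cg => //; rewrite (le_trans cy)// lerDl.
  by rewrite (le_trans (cabsD _ _))// lerD// cabsD.
move=> p q e; rewrite -Eb -Ed => apb cqd e0.
have /cderP[D] := dg p q apb cqd.
(* [e / 4] offsets the factor 4 of [rect_int_le]; [r / 2] keeps [w + h], which bounds the distance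
   to the limit point, below [r]. *)
move/(_ (e / 4)); case; first by rewrite divr_gt0.
move=> r r0 Hr; exists (r / 2); first by rewrite divr_gt0.
move=> x y w h ax cy /andP[w0 wr] /andP[h0 hr] xb yd /andP[xp px] /andP[yq qy].
have xw : x <= x + w by rewrite lerDl.
have yh : y <= y + h by rewrite lerDl.
pose P := p +i* q.
have caff (al be : C) : rect_continuous (fun z => al + be * z) x (x + w) y (y + h).
  move=> x' y' _ _; apply: cder_continuous.
  under eq_fun do rewrite addrC.
  exact: derivable_affine.
have := rect_intB xw yh (cg _ _ _ _ ax xb cy yd) (caff (g P - D * P) D).
rewrite rect_int_affine// subr0 => <-.
have -> : e * (w + h) ^+ 2 = 4 * (e / 4 * (w + h)) * ((x + w - x) + (y + h - y)).
  by field.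
apply: rect_int_le => //.
  move=> x' y' x'h y'h.
  have -> : (fun z => g z - (g P - D * P + D * z)) =
      (fun z => g z + (- D * z - (g P - D * P))).
    by apply/funext => z; ring.
  apply: cder_continuous; apply: cderD; last exact: derivable_affine.
  move: x'h y'h => /andP[xx' x'w] /andP[yy' y'h].
  apply: dg; first by rewrite (le_trans ax)//= (le_trans x'w).
  by rewrite (le_trans cy)//= (le_trans y'h).
move=> x' y' /andP[xx' x'w] /andP[yy' y'h].
have -> : g (x' +i* y') - (g P - D * P + D * (x' +i* y')) =
  g (x' +i* y') - g P - D * (x' +i* y' - P) by ring.
have dist : cabs (x' +i* y' - P) <= w + h.
  apply: (le_trans (cabs_le_ReIm _)) => /=.
  by apply: lerD; rewrite ler_norml; apply/andP; split; lra.
apply: le_trans (Hr _ _) _; last by rewrite ler_wpM2l// divr_ge0// ltW.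
by apply: (le_lt_trans dist); lra.
Qed.

End goursat.

(** * Functions on the circle and integration by angle *)

Section circle_integral.
Variable R : realType.
Notation C := R[i].
Notation Re := (@complex.Re _).
Notation Im := (@complex.Im _).
Notation leb := (@lebesgue_measure R).
Notation sigma := (@arc_length R : {measure set (circle R) -> \bar R}).
Notation val := (@circle_val R).
Implicit Types (t : circle R).

Lemma cabs_circle t : cabs (val t) = 1.
Proof. by apply: complexI; rewrite -normcE; exact: (set_mem (valP t)). Qed.

Lemma circle_neq0 t : val t != 0.
Proof. by rewrite -cabs_gt0 cabs_circle. Qed.

Lemma circle_inj t t' : val t = val t' -> t = t'.
Proof. by move=> tt; apply: val_inj. Qed.

Lemma expi_surj t : exists2 x : R, 0 <= x <= 2 * pi & expi x = t.
Proof.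
have := cabs_sqr (val t); rewrite cabs_circle expr1n => /esym xy1.
set x := Re _ in xy1; set y := Im _ in xy1.
have x1 : -1 <= x <= 1.
  rewrite -ler_norml -(@ler_pXn2r _ 2) ?nnegrE// expr1n real_normK ?num_real//.
  by rewrite -xy1 lerDl sqr_ge0.
have sy : sin (acos x) = `|y|.
  rewrite sin_acos//; have -> : 1 - x ^+ 2 = y ^+ 2 by rewrite -xy1; ring.
  by rewrite sqrtr_sqr.
have /andP[a0 api] : 0 <= acos x <= pi by rewrite acos_ge0// acos_lepi.
have xe : cos (acos x) = x by rewrite acosK.
have [y0|y0] := leP 0 y.
  exists (acos x); first by rewrite a0 (le_trans api)// ler_peMl ?pi_ge0// ler1n.
  by apply: circle_inj; apply: complex_ext => //=; rewrite sy ger0_norm.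
have pi0 := pi_gt0 R.
exists (2 * pi - acos x); first by apply/andP; split; lra.
apply: circle_inj; apply: complex_ext => /=.
  by rewrite cosB mulr_natl cos2pi sin2pi mul1r mul0r addr0.
by rewrite sinB mulr_natl cos2pi sin2pi mul0r mul1r sub0r sy ltr0_norm// opprK.
Qed.

Lemma continuous_circle_measurable (f : circle R -> R) :
  continuous f -> measurable_fun setT f.
Proof.
move=> cf; apply: (measurability (@RGenOpens.G R)); first exact: RGenOpens.measurableE.
move=> _ [_ [a [b ->] <-]]; rewrite setTI.
apply: sub_sigma_algebra; move/continuousP : cf; apply; exact: interval_open.
Qed.

(** Boundedness is obtained on the compact segment [[0, 2 * pi]], through [expi]. *)
Lemma continuous_circle_bmf (f : circle R -> R) : continuous f -> bmf setT f.
Proof.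
move=> cf; split; first exact: continuous_circle_measurable.
have [_ [M fM]] : bmf `[0, 2 * pi]%classic (fun x : R => f (expi x)).
  apply: continuous_bmf => x _; apply: continuous_comp; last exact: cf.
  exact: continuous_expi.
by exists M => t _; have [x x2 <-] := expi_surj t; apply: fM; rewrite /= in_itv.
Qed.

Lemma circle_val_continuous : continuous val.
Proof. exact: initial_continuous. Qed.

Lemma continuous_circle_cbmf (u : circle R -> C) : continuous u -> cbmf setT u.
Proof.
move=> cu; split; apply: continuous_circle_bmf => t;
  have /(@cvg_cabs _ _ (nbhs t)) H := cu t;
  apply/(@cvgrPdist_lt _ _ _ (nbhs t)) => e /H; apply: filterS => y; apply: le_lt_trans.
  by rewrite distrC /= -ReN -ReD; exact: ler_Re_cabs.
by rewrite distrC /= -ImN -ImD; exact: ler_Im_cabs.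
Qed.

(* [f] need only be continuous along the circle of radius [`|s|]. *)
Lemma circle_cbmf (f : C -> C) (s : C) :
  (forall t, {for s * val t, continuous f}) ->
  cbmf setT (fun t => f (s * val t)).
Proof.
move=> cf; apply: continuous_circle_cbmf => t.
apply: (@continuous_comp _ _ _ val (fun z => f (s * z))).
  exact: circle_val_continuous.
apply: (@continuous_comp _ _ _ (fun z => s * z) f); last exact: cf.
by apply: cder_continuous; apply: cderM; [exact: cder_cst|exact: cder_id].
Qed.

(** The half-open interval in [arc_length] becomes closed, its endpoint being null, to match the
    segments of [rect_int]. *)
Lemma integral_arc_length (f : circle R -> R) : bmf setT f ->
  \int[sigma]_t f t = \int[leb]_(x in `[0, 2 * pi]%classic) f (expi x).
Proof.
move=> bf; have [mf _] := bf.
have mfe : measurable_fun setT (fun x : measurableTypeR R => f (expi x)).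
  by apply: measurableT_comp => //; exact: measurable_expi.
have bfe : bmf setT (fun x : measurableTypeR R => f (expi x)).
  by split=> //; have [_ [M fM]] := bf; exists M => x _; exact: fM.
have mI : measurable `[(0 : R), 2 * pi[%classic by exact: measurable_itv.
pose lI : {measure set (measurableTypeR R) -> \bar R} := mrestr leb mI.
have lIE A : lI A = leb (A `&` `[0, 2 * pi[%classic) by [].
have fin : (lI setT < +oo)%E.
  rewrite lIE setTI lebesgue_measure_itv /=.
  by case: ifP => // _; rewrite ltry.
have ife : lI.-integrable setT (EFin \o (fun x => f (expi x))).
  exact: bmf_integrable.
rewrite /Rintegral; congr fine.
have mfE : measurable_fun setT (EFin \o f) by exact/measurable_EFinP.
apply: etrans (integral_pushforward (@measurable_expi R) mfE ife measurableT) _.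
have N0 : lI (~` `[0, 2 * pi[%classic) = 0%E by rewrite lIE setICl measure0.
have NI := negligible_integral
  (measurableC (mI : @measurable _ (measurableTypeR R) _)) measurableT ife N0.
transitivity (\int[lI]_(x in setT) (f (expi x))%:E)%E; first by [].
rewrite NI.
rewrite setDE setTI setCK.
rewrite (eq_measure_integral leb); last first.
  by move=> A mA AI; rewrite lIE (setIidl AI).
rewrite integral_itv_bndo_bndc//.
by apply/measurable_funTS/measurable_EFinP.
Qed.

Lemma cint_arc_length (u : circle R -> C) : cbmf setT u ->
  cint sigma setT u = cint leb `[0, 2 * pi]%classic (fun x => u (expi x)).
Proof. by move=> [ru iu]; rewrite /cint !integral_arc_length. Qed.

Lemma arc_lengthT : sigma setT = (2 * pi)%:E.
Proof.
rewrite (_ : _ setT = leb (setT `&` `[0, 2 * pi[%classic))// setTI.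
by rewrite lebesgue_measure_itv /= lte_fin mulr_gt0 ?pi_gt0// oppr0 adde0.
Qed.

Lemma fin_arc_length : (sigma setT < +oo)%E.
Proof. by rewrite arc_lengthT ltry. Qed.

End circle_integral.

(** * Mean values, Cauchy and Poisson formulas *)

Section poisson.
Variable R : realType.
Notation C := R[i].
Notation Re := (@complex.Re _).
Notation Im := (@complex.Im _).
Notation leb := (@lebesgue_measure R).
Notation sigma := (@arc_length R : {measure set (circle R) -> \bar R}).
Notation val := (@circle_val R).
Implicit Types (t : circle R) (z w : C) (f k : C -> C).

Lemma cint_norm_le_int d (T : measurableType d) (mu : {measure set T -> \bar R})
    (D : set T) (mD : measurable D) (finD : (mu D < +oo)%E) (u : T -> C) (G : T -> R) :
  cbmf D u -> bmf D G -> (forall x, D x -> cabs (u x) <= G x) ->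
  cabs (cint mu D u) <= 2 * \int[mu]_(x in D) G x.
Proof.
move=> [ru iu] bG uG; apply: (le_trans (cabs_le_ReIm _)) => /=.
rewrite mulrDl mul1r; apply: lerD.
  apply: (le_trans (le_normr_Rintegral _ (bmf_integrable _ _ ru))) => //.
  apply: Rint_le => //; first exact: bmf_norm.
  by move=> x /uG; apply: le_trans; exact: ler_Re_cabs.
apply: (le_trans (le_normr_Rintegral _ (bmf_integrable _ _ iu))) => //.
apply: Rint_le => //; first exact: bmf_norm.
by move=> x /uG; apply: le_trans; exact: ler_Im_cabs.
Qed.

Lemma cabs_le_eps (z : C) (K : R) :
  (forall e : R, 0 < e -> cabs z <= K * e) -> z = 0.
Proof.
move=> H; apply/eqP; rewrite -cabs_eq0 eq_le cabs_ge0 andbT leNgt; apply/negP => z0.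
have K1 : 0 < `|K| + 1 by rewrite ltr_wpDl.
have := H (cabs z / (2 * (`|K| + 1))).
rewrite divr_gt0// ?mulr_gt0// => /(_ isT).
rewrite mulrCA -ler_pdivrMl// mulVf ?gt_eqF// ler_pdivlMr ?mulr_gt0// mul1r.
have := ler_norm K; lra.
Qed.

Lemma circle_cbmf1 f : (forall t, derivable f (val t) 1) ->
  cbmf setT (fun t => f (val t)).
Proof.
move=> df; have -> : (fun t => f (val t)) = (fun t => f (1 * val t)).
  by apply/funext => t; rewrite mul1r.
by apply: circle_cbmf => t; rewrite mul1r; exact: cder_continuous.
Qed.

Lemma cint_unit k : cint sigma setT (fun t => k (1%:C * val t)) =
  cint sigma setT (fun t => k (val t)).
Proof. by apply: eq_cint => t _; rewrite mul1r. Qed.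

Lemma cabs_scale (s : R) t : 0 <= s -> cabs (s%:C * val t) = s.
Proof. by move=> s0; rewrite cabsM cabs_real cabs_circle mulr1 ger0_norm. Qed.

(** Goursat for the composite of [k] and [cexp] on the rectangle [[ln s, ln s'] x [0, 2 * pi]],
    which [cexp] wraps around the annulus: the horizontal sides cancel by periodicity and the
    vertical ones give the two means. *)
Lemma circle_mean_annulus k (s s' : R) : 0 < s -> s <= s' ->
  (forall w, s <= cabs w <= s' -> derivable k w 1) ->
  cint sigma setT (fun t => k (s%:C * val t)) =
  cint sigma setT (fun t => k (s'%:C * val t)).
Proof.
move=> s0 ss' dk; have s'0 := lt_le_trans s0 ss'.
have bk (r : R) : s <= r <= s' -> cbmf setT (fun t => k (r%:C * val t)).
  move=> rs; apply: circle_cbmf => t; apply: cder_continuous; apply: dk.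
  by rewrite cabs_scale// (le_trans (ltW s0))//; case/andP: rs.
have ces (r y : R) : 0 < r -> r%:C * val (expi y) = cexp (ln r +i* y).
  by move=> r0; rewrite /cexp /= lnK.
rewrite !cint_arc_length; [|by apply: bk; rewrite ss' lexx..].
have pi2 : 0 <= 2 * pi :> R by rewrite mulr_ge0// pi_ge0.
pose g w := k (cexp w).
have lns : ln s <= ln s' by rewrite ler_ln.
have dg x y : ln s <= x <= ln s' -> derivable g (x +i* y) 1.
  move=> xs; apply: cder_comp; first exact: derivable_cexp.
  by apply: dk; rewrite cabs_cexp /= -[s]lnK// -[s']lnK// !ler_expR.
have := @goursat _ g (ln s) (ln s') 0 (2 * pi) lns pi2 (fun x y xs _ => dg x y xs).
rewrite /rect_int (@eq_cint _ _ _ _ _ _ (fun=> 0)); last first.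
  move=> x _; rewrite /g /cexp /= mulr_natl cos2pi sin2pi cos0 sin0 subrr.
  by [].
rewrite cint_cst// mul0r add0r => /eqP; rewrite mulf_eq0.
have /negPf -> : ('i : C) != 0 by rewrite eq_complex /= oner_eq0 andbF.
have vc r : s <= r <= s' -> cbmf `[0, 2 * pi]%classic (fun y => g (ln r +i* y)).
  move=> /andP[sr rs]; apply: vertical_cbmf => y _; apply: cder_continuous; apply: dg.
  by have r0 := lt_le_trans s0 sr; rewrite !ler_ln// sr.
rewrite cintB//; last 3 first.
- exact: segment_fin.
- by apply: vc; rewrite ss' lexx.
- by apply: vc; rewrite ss' lexx.
rewrite subr_eq0 => /eqP E.
transitivity (cint leb `[0, 2 * pi]%classic (fun y => g (ln s +i* y))).
  by apply: eq_cint => y _; rewrite ces.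
by rewrite -E; apply: eq_cint => y _; rewrite ces.
Qed.

Lemma cint_circle_cst (z : C) : cint sigma setT (fun=> z) = (2 * pi)%:C * z.
Proof.
rewrite cint_cst// mulrC; congr ((_)%:C * _).
by rewrite -[RHS]/(fine (2 * pi)%:E) -arc_lengthT.
Qed.

Lemma int_circle_cst (r : R) : \int[sigma]_t r = 2 * pi * r.
Proof. by have [] := cint_circle_cst r%:C; rewrite mul0r subr0. Qed.

Lemma circle_cint_le (u : circle R -> C) (M : R) : cbmf setT u ->
  (forall t, cabs (u t) <= M) -> cabs (cint sigma setT u) <= 4 * pi * M.
Proof.
move=> bu uM; have -> : 4 * pi * M = 2 * M * fine (sigma setT).
  by rewrite arc_lengthT /=; ring.
by apply: cint_norm_le => //; exact: fin_arc_length.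
Qed.

(** By [circle_mean_annulus] the radius may shrink until [k] is within [e] of [k 0] on the
    circle. *)
Lemma circle_mean_value k (s : R) : 0 <= s ->
  (forall w, cabs w <= s -> derivable k w 1) ->
  cint sigma setT (fun t => k (s%:C * val t)) = (2 * pi)%:C * k 0.
Proof.
rewrite le_eqVlt => /predU1P[<- _|s0 dk].
  rewrite -cint_circle_cst; apply: eq_cint => t _; by rewrite mul0r.
apply/eqP; rewrite -subr_eq0; apply/eqP; apply: (@cabs_le_eps _ (4 * pi)) => e e0.
have /cder_continuous/continuous_cabsP/(_ e e0)[d d0 Hd] : derivable k 0 1.
  by apply: dk; rewrite cabs0 ltW.
pose r := Num.min s (d / 2).
have r0 : 0 < r by rewrite lt_min s0 divr_gt0.
have rs : r <= s by rewrite ge_min lexx.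
have rd : r < d by rewrite gt_min ltr_pdivrMr// ltr_pMr// ltr1n orbT.
rewrite -(circle_mean_annulus r0 rs); last first.
  by move=> w /andP[_]; exact: dk.
have bk : cbmf setT (fun t => k (r%:C * val t)).
  apply: circle_cbmf => t; apply: cder_continuous; apply: dk.
  by rewrite cabs_scale// ltW.
rewrite -cint_circle_cst -cintB//; last 2 first.
- exact: fin_arc_length.
- exact: cbmf_cst.
apply: circle_cint_le; first by apply: cbmfB => //; exact: cbmf_cst.
by move=> t; apply/ltW/Hd; rewrite subr0 cabs_scale// ltW.
Qed.

(** The kernel is holomorphic for [|w| > |z|], so the radius may grow, and the kernel tends to 1 at
    infinity. On the radius [s] chosen below it differs from 1 by [z / (w - z)] with
    [|w - z| >= 1 + 1/e], hence by at most [e]. *)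
Lemma cint_cauchy_kernel z : cabs z < 1 ->
  cint sigma setT (fun t => val t / (val t - z)) = (2 * pi)%:C.
Proof.
move=> z1; apply/eqP; rewrite -subr_eq0; apply/eqP.
apply: (@cabs_le_eps _ (4 * pi)) => e e0.
pose k w := w / (w - z).
have dk w : cabs z < cabs w -> derivable k w 1.
  move=> zw; have wz : w - z != 0.
    by rewrite subr_eq0; apply/eqP => wz; rewrite wz ltxx in zw.
  apply: cderM; first exact: cder_id.
  by apply: (cderV (f := fun w => w - z)) => //; apply: cderB.
pose s := 1 + e^-1 + cabs z.
have ei : 0 < e^-1 by rewrite invr_gt0.
have s1 : 1 <= s by rewrite /s -addrA lerDl addr_ge0 ?cabs_ge0// ltW.
have s0 : 0 < s by apply: lt_le_trans s1.
have := @circle_mean_annulus k 1 s ltr01 s1.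
rewrite (@eq_cint _ _ _ _ _ (fun t => k (1%:C * val t)) (fun t => k (val t))); last first.
  by move=> t _; rewrite mul1r.
move=> ->; last by move=> w /andP[w1 _]; apply: dk; exact: lt_le_trans w1.
have bk : cbmf setT (fun t => k (s%:C * val t)).
  apply: circle_cbmf => t; apply: cder_continuous; apply: dk.
  by rewrite cabs_scale ?(lt_le_trans z1)// ltW.
rewrite -[X in _ - X]mulr1 -cint_circle_cst -cintB//; last 2 first.
- exact: fin_arc_length.
- exact: cbmf_cst.
apply: circle_cint_le; first by apply: cbmfB => //; exact: cbmf_cst.
move=> t; have sz : 1 + e^-1 <= cabs (s%:C * val t - z).
  by apply: le_trans (cabsD_dist _ _); rewrite (cabs_scale _ (ltW s0)) /s addrK.
have sz0 : s%:C * val t - z != 0.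
  by rewrite -cabs_gt0 (lt_le_trans _ sz)// addr_gt0.
have -> : k (s%:C * val t) - 1 = z / (s%:C * val t - z).
  by rewrite /k; field.
rewrite cabsM cabsV ler_pdivrMr ?cabs_gt0//.
apply: (le_trans (ltW z1)); rewrite -ler_pdivrMl// mulr1 (le_trans _ sz)//.
by rewrite lerDr.
Qed.

(** Defined as the real part of the kernel in the exponent of a singular function, so that
    [Re_herglotz] holds by computation; the usual quotient is [poisson_kernelE]. *)
Definition poisson_kernel z t : R := Re ((val t + z) / (val t - z)).

Lemma disk_sub_neq0 z t : cabs z < 1 -> val t - z != 0.
Proof.
move=> z1; rewrite subr_eq0; apply/eqP => tz.
by move: z1; rewrite -tz cabs_circle ltxx.
Qed.

Lemma poisson_kernelE z t : cabs z < 1 ->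
  poisson_kernel z t = (1 - cabs z ^+ 2) / cabs (val t - z) ^+ 2.
Proof.
move=> /(disk_sub_neq0 t); rewrite -cabs_gt0.
have := cabs_sqr (val t); rewrite cabs_circle expr1n /poisson_kernel.
rewrite !cabs_sqr; case: (val t) => a b; case: z => x y /= t1 tz.
have n0 : (a - x) ^+ 2 + (b - y) ^+ 2 != 0.
  have := cabs_sqr ((a +i* b) - (x +i* y)) => /= <-.
  by rewrite expf_neq0// gt_eqF.
by rewrite t1; field.
Qed.

Lemma poisson_kernel_ge0 z t : cabs z < 1 -> 0 <= poisson_kernel z t.
Proof.
move=> z1; rewrite poisson_kernelE// divr_ge0 ?sqr_ge0//.
by rewrite subr_ge0 expr_le1// ?cabs_ge0// ltW.
Qed.

(** The Poisson kernel is the Cauchy kernel plus the conjugate of [z / (t - z)]. Since the conjugate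
    of [t] is its inverse, that term is the value at [t] of a function holomorphic on the closed
    disk and vanishing at 0. *)
Lemma poisson_kernel_cauchy z t : cabs z < 1 -> (poisson_kernel z t)%:C =
  val t / (val t - z) + z^*%C * val t / (1 - z^*%C * val t).
Proof.
move=> z1; have tz := disk_sub_neq0 t z1.
have tt : val t * (val t)^*%C = 1.
  have := cabs_sqr (val t); rewrite cabs_circle expr1n.
  case: (val t) => a b /= t1; apply: complex_ext => /=; last by ring.
  by rewrite t1; ring.
have t0 := circle_neq0 t.
have -> : z^*%C * val t / (1 - z^*%C * val t) = (z / (val t - z))^*%C.
  rewrite rmorphM /= fmorphV /= rmorphB /=.
  have -> : (val t)^*%C = (val t)^-1 by rewrite -[RHS]mulr1 -tt mulKf.
  have zt : 1 - z^*%C * val t != 0.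
    rewrite -cabs_gt0 (lt_le_trans _ (cabsD_dist _ _))// cabsM cabs_circle mulr1 cabs1.
    rewrite subr_gt0; apply: le_lt_trans z1.
    by rewrite /cabs; case: z {tz} => a b /=; rewrite sqrrN.
  move: (z^*%C) (val t) zt t0 => c w cw w0.
  have -> : w^-1 - c = (1 - c * w) / w by field.
  by field; rewrite cw w0.
have -> : (poisson_kernel z t)%:C =
    ((val t + z) / (val t - z) + ((val t + z) / (val t - z))^*%C) / 2.
  by rewrite -ReJ_add.
have -> : (val t + z) / (val t - z) = 1 + 2 * (z / (val t - z)) by field.
have -> : val t / (val t - z) = 1 + z / (val t - z) by field.
move: (z / (val t - z)) => B.
have -> : (1 + 2 * B)^*%C = 1 + 2 * B^*%C.
  by case: B => a b; apply: complex_ext => /=; ring.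
by field.
Qed.

Lemma cabs_conj z : cabs z^*%C = cabs z.
Proof. by rewrite /cabs; case: z => a b /=; rewrite sqrrN. Qed.

Lemma derivable_conj_kernel (c : C) w : cabs (c * w) < 1 ->
  derivable (fun w => c * w / (1 - c * w)) w 1.
Proof.
move=> cw; have cw0 : 1 - c * w != 0.
  by rewrite -cabs_gt0 (lt_le_trans _ (cabsD_dist _ _))// cabs1 subr_gt0.
have d : derivable (fun w => c * w) w 1.
  by apply: cderM; [exact: cder_cst|exact: cder_id].
have dV : derivable (fun w => (1 - c * w)^-1) w 1.
  apply: (cderV (f := fun w => 1 - c * w) cw0).
  exact: (cderB (cder_cst 1 w) d).
exact: (cderM d dV).
Qed.

Lemma derivable_cauchy_kernel z w : w - z != 0 ->
  derivable (fun w => w / (w - z)) w 1.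
Proof.
move=> wz; apply: cderM; first exact: cder_id.
by apply: (cderV (f := fun w => w - z)) => //; apply: cderB.
Qed.

Lemma poisson_kernel_cbmf z : cabs z < 1 ->
  cbmf setT (fun t => (poisson_kernel z t)%:C).
Proof.
move=> z1; rewrite (_ : (fun t => _) =
    fun t => val t / (val t - z) + z^*%C * val t / (1 - z^*%C * val t)); last first.
  by apply/funext => t; rewrite poisson_kernel_cauchy.
apply: cbmfD.
  apply: (circle_cbmf1 (f := fun w => w / (w - z))) => t.
  by apply: derivable_cauchy_kernel; exact: disk_sub_neq0.
apply: (circle_cbmf1 (f := fun w => z^*%C * w / (1 - z^*%C * w))) => t.
by apply: derivable_conj_kernel; rewrite cabsM cabs_conj cabs_circle mulr1.
Qed.

Lemma poisson_kernel_bmf z : cabs z < 1 -> bmf setT (poisson_kernel z).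
Proof. by move=> /poisson_kernel_cbmf[]. Qed.

(** By [poisson_kernel_cauchy] the two integrands differ by a function holomorphic on the closed
    disk and vanishing at 0, whose mean is 0. *)
Lemma cauchy_poisson f z : cabs z < 1 ->
  (forall w, cabs w <= 1 -> derivable f w 1) ->
  cint sigma setT (fun t => f (val t) * (val t / (val t - z))) =
  cint sigma setT (fun t => (poisson_kernel z t)%:C * f (val t)).
Proof.
move=> z1 df.
pose h w := f w * (z^*%C * w / (1 - z^*%C * w)).
have dh w : cabs w <= 1 -> derivable h w 1.
  move=> w1; apply: cderM; first exact: df.
  apply: derivable_conj_kernel; rewrite cabsM cabs_conj.
  by rewrite (le_lt_trans _ z1)// ler_piMr ?cabs_ge0.
have := circle_mean_value ler01 dh.
rewrite {2}/h mulr0 mul0r mulr0 mulr0 => h0.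
have h0' : cint sigma setT (fun t => h (val t)) = 0.
  by rewrite -h0; apply: eq_cint => t _; rewrite mul1r.
rewrite -[LHS]addr0 -h0' -cintD//; last 3 first.
- exact: fin_arc_length.
- apply: cbmfM.
    by apply: circle_cbmf1 => t; apply: df; rewrite cabs_circle.
  apply: (circle_cbmf1 (f := fun w => w / (w - z))) => t.
  by apply: derivable_cauchy_kernel; exact: disk_sub_neq0.
- by apply: circle_cbmf1 => t; apply: dh; rewrite cabs_circle.
apply: eq_cint => t _; rewrite poisson_kernel_cauchy// /h; ring.
Qed.

Lemma cint_poisson_kernel z : cabs z < 1 ->
  cint sigma setT (fun t => (poisson_kernel z t)%:C) = (2 * pi)%:C.
Proof.
move=> z1; rewrite -(cint_cauchy_kernel z1).
transitivity (cint sigma setT (fun t => (poisson_kernel z t)%:C * 1)).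
  by apply: eq_cint => t _; rewrite mulr1.
rewrite -(@cauchy_poisson (fun=> 1))//.
by apply: eq_cint => t _; rewrite mul1r.
Qed.

Lemma int_poisson_kernel z : cabs z < 1 ->
  \int[sigma]_t poisson_kernel z t = 2 * pi.
Proof. by move=> /cint_poisson_kernel; rewrite /cint => -[]. Qed.

(* Letting the radius decrease to [`|z|], the Cauchy integral, which does not
   depend on the radius, becomes a Poisson integral concentrating at [z]. *)
Theorem poisson_formula f (R0 M : R) z : 1 < R0 ->
  (forall w, cabs w < R0 -> derivable f w 1) ->
  (forall w, cabs w < R0 -> cabs (f w) <= M) -> cabs z < 1 ->
  cint sigma setT (fun t => (poisson_kernel z t)%:C * f (val t)) =
  (2 * pi)%:C * f z.
Proof.
move=> R1 df fM z1.
rewrite -cauchy_poisson//; last by move=> w w1; apply: df; exact: le_lt_trans R1.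
apply/eqP; rewrite -subr_eq0; apply/eqP; apply: (@cabs_le_eps _ (8 * pi)) => e e0.
have /cder_continuous/continuous_cabsP/(_ e e0)[d d0 Hd] : derivable f z 1.
  by apply: df; exact: lt_trans R1.
have M0 : 0 <= M by apply: le_trans (fM 0 _); rewrite ?cabs_ge0// cabs0 (lt_trans ltr01).
have M1 : 0 < M + 1 by rewrite ltr_wpDl.
(* The first bound keeps [r = cabs z + ka] below 1. Where [r%:C * val t] is at distance at least [d]
   from [z], the integrand is at most [4 * ka * (M + 1) / d ^+ 2], which the second bound makes at
   most [e]. *)
pose ka : R := Num.min ((1 - cabs z) / 2) (e * d ^+ 2 / (4 * (M + 1))).
have ka0 : 0 < ka.
  by rewrite lt_min !divr_gt0 ?subr_gt0// ?mulr_gt0// exprn_gt0.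
have ka1 : ka <= (1 - cabs z) / 2 by rewrite ge_min lexx.
have kae : ka <= e * d ^+ 2 / (4 * (M + 1)) by rewrite ge_min lexx orbT.
clearbody ka.
pose r := cabs z + ka.
have z0 := cabs_ge0 z.
have r0 : 0 < r by rewrite ltr_wpDl.
have r1 : r < 1 by rewrite /r; lra.
have zr : cabs z < r by rewrite ltrDl.
pose z' := z / r%:C.
have rC0 : r%:C != 0 by rewrite -cabs_gt0 cabs_real gtr0_norm.
have z'1 : cabs z' < 1.
  by rewrite cabsM cabsV cabs_real gtr0_norm// ltr_pdivrMr// mul1r.
have -> : cint sigma setT (fun t => f (val t) * (val t / (val t - z))) =
    cint sigma setT (fun t => (poisson_kernel z' t)%:C * f (r%:C * val t)).
  rewrite -(@cauchy_poisson (fun w => f (r%:C * w)))//; last first.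
    move=> w w1; apply: (cder_comp (f := fun w => r%:C * w)).
      by apply: cderM; [exact: cder_cst|exact: cder_id].
    apply: df; apply: lt_trans R1; rewrite cabsM cabs_real gtr0_norm//.
    by apply: le_lt_trans r1; rewrite ler_piMr// ltW.
  rewrite -(cint_unit (fun w => f w * (w / (w - z)))).
  rewrite -(@circle_mean_annulus (fun w => f w * (w / (w - z))) r 1 r0 (ltW r1)); last first.
    move=> w /andP[rw w1]; apply: cderM.
      by apply: df; exact: le_lt_trans R1.
    apply: derivable_cauchy_kernel; rewrite subr_eq0; apply/eqP => wz.
    by move: (lt_le_trans zr rw); rewrite wz ltxx.
  apply: eq_cint => t _; have := disk_sub_neq0 t z'1; rewrite /z' => tz.
  congr (_ * _).
  have -> : r%:C * val t - z = r%:C * (val t - z / r%:C) by field.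
  by rewrite invfM mulrACA divff// mul1r.
rewrite -(cint_poisson_kernel z'1) mulrC -cintZ//; last 2 first.
- exact: fin_arc_length.
- exact: poisson_kernel_cbmf.
have bfr : cbmf setT (fun t => f (r%:C * val t)).
  apply: circle_cbmf => t; apply: cder_continuous; apply: df.
  by rewrite cabs_scale ?(lt_trans r1)// ltW.
have bP := poisson_kernel_cbmf z'1.
have bPr := poisson_kernel_bmf z'1.
rewrite -cintB//; last 3 first.
- exact: fin_arc_length.
- exact: cbmfM.
- by apply: cbmfM => //; exact: cbmf_cst.
(* The first summand dominates where [r%:C * val t] is near [z], by continuity of [f], and the
   second elsewhere. Its integral is [4 * pi * e], and the factor 2 of [cint_norm_le_int] gives
   [8 * pi * e]. *)
pose G t := e * poisson_kernel z' t + e.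
have bG : bmf setT G.
  by apply: bmfD; [apply: bmfM => //; exact: bmf_cst|exact: bmf_cst].
apply: (le_trans (@cint_norm_le_int _ _ sigma setT _ _ _ G _ _ _)) => //.
- exact: fin_arc_length.
- by apply: cbmfB; apply: cbmfM => //; exact: cbmf_cst.
- move=> t _; rewrite [f z * _]mulrC -mulrBr cabsM cabs_real.
  rewrite ger0_norm ?poisson_kernel_ge0//.
  have Pz : poisson_kernel z' t = (r ^+ 2 - cabs z ^+ 2) / cabs (r%:C * val t - z) ^+ 2.
    rewrite poisson_kernelE// /z' cabsM cabsV cabs_real gtr0_norm//.
    have -> : r%:C * val t - z = r%:C * (val t - z / r%:C) by field.
    rewrite [cabs (r%:C * _)]cabsM cabs_real gtr0_norm// exprMn.
    have := disk_sub_neq0 t z'1; rewrite -cabs_gt0 /z' => tz.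
    by field; rewrite !gt_eqF.
  have [rtz|rtz] := ltP (cabs (r%:C * val t - z)) d.
    rewrite /G mulrC (le_trans _ (_ : e * poisson_kernel z' t <= _))//.
      by rewrite ler_wpM2r ?poisson_kernel_ge0// ltW// Hd.
    by rewrite lerDl ltW.
  rewrite /G (le_trans _ (_ : e <= _))//; last first.
    by rewrite lerDr mulr_ge0 ?poisson_kernel_ge0// ltW.
  have fz2 : cabs (f (r%:C * val t) - f z) <= 2 * (M + 1).
    rewrite (le_trans (cabsD _ _))// cabsN mulrDr mulrDl mul1r.
    rewrite -[leLHS]addr0 lerD ?mulr_ge0// lerD ?fM//.
      by rewrite cabs_scale ?(lt_trans r1)// ltW.
    exact: lt_trans R1.
  have rz2 : r ^+ 2 - cabs z ^+ 2 <= 2 * ka.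
    have -> : r ^+ 2 - cabs z ^+ 2 = (r + cabs z) * ka by rewrite /r; ring.
    by rewrite ler_wpM2r ?ltW//; lra.
  have rz0 : 0 <= r ^+ 2 - cabs z ^+ 2.
    by rewrite subr_ge0 ler_pXn2r// ?nnegrE ltW.
  have c0 : 0 < cabs (r%:C * val t - z) by apply: lt_le_trans rtz.
  rewrite Pz mulrAC ler_pdivrMr ?exprn_gt0//.
  apply: (le_trans (ler_pM _ _ rz2 fz2)); rewrite ?cabs_ge0//.
  apply: (@le_trans _ _ (e * d ^+ 2)).
    by move: kae; rewrite ler_pdivlMr ?mulr_gt0//; apply: le_trans; lra.
  by rewrite (ler_pM2l e0) ler_pXn2r// nnegrE ltW.
rewrite RintD//; last 3 first.
- exact: fin_arc_length.
- by apply: bmfM => //; exact: bmf_cst.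
- exact: bmf_cst.
rewrite RintZ//; last exact: fin_arc_length.
by rewrite int_poisson_kernel// int_circle_cst; lra.
Qed.

End poisson.

(** * Inner regularity of finite measures on the circle *)

Section regularity.
Variable R : realType.
Notation C := R[i].
Notation val := (@circle_val R).
Implicit Types (t : circle R).

Definition circle_ball t (r : R) : set (circle R) := [set t' | cabs (val t' - val t) < r].

Lemma circle_ball_open t r : open (circle_ball t r).
Proof.
exists [set w | cabs (w - val t) < r] => //.
rewrite openE => w /= wr; apply/nbhs_cabs; exists (r - cabs (w - val t)).
  by rewrite subr_gt0.
move=> w' ww /=; have -> : w' - val t = (w' - w) + (w - val t) by ring.
by rewrite (le_lt_trans (cabsD _ _))// -ltrBrDr.
Qed.

Lemma circle_ball_center t r : 0 < r -> circle_ball t r t.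
Proof. by rewrite /circle_ball /= subrr cabs0. Qed.

Lemma open_circle_ball (U : set (circle R)) t : open U -> U t ->
  exists2 r : R, 0 < r & circle_ball t r `<=` U.
Proof.
move=> [V oV <-] Vt; have : nbhs (val t) V by exact: open_nbhs_nbhs.
by move=> /nbhs_cabs[r r0 H]; exists r => // t' /= /H.
Qed.

Lemma open_circle_measurable (U : set (circle R)) : open U -> measurable U.
Proof. exact: sub_sigma_algebra. Qed.

Lemma closed_circle_measurable (K : set (circle R)) : closed K -> measurable K.
Proof.
move=> cK; rewrite -[K]setCK; apply: measurableC.
by apply: open_circle_measurable; exact: closed_openC.
Qed.

Lemma measure_decreasing_small d (T : measurableType d)
    (mu : {finite_measure set T -> \bar R}) (F : (set T)^nat) (e : R) :
  (forall n, measurable (F n)) -> nonincreasing_seq F -> \bigcap_n F n = set0 ->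
  0 < e -> exists n, (mu (F n) < e%:E)%E.
Proof.
move=> mF niF F0 e0.
have := @nonincreasing_cvg_mu _ _ _ mu F.
have fin : (mu (F 0%N) < +oo)%E by rewrite ltey_eq fin_num_measure.
rewrite F0 measure0 => /(_ fin mF measurable0 niF) H.
have /H[N _ HN] : nbhs (0%E : \bar R) [set x | (x < e%:E)%E].
  exact: (@nbhs_open_ereal_lt _ 0 (fun=> e)).
by exists N; exact: (HN N (leqnn N)).
Qed.

Section inner.
Variable mu : {finite_measure set (circle R) -> \bar R}.

(** Approximation from both sides is stable under complement, as inner regularity alone is not; this
    makes the regular sets a sigma-algebra. *)
Definition regular_set (A : set (circle R)) := forall e : R, 0 < e ->
  exists K U, [/\ closed K, open U, K `<=` A, A `<=` U & (mu (U `\` K) < e%:E)%E].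

(** An open set is exhausted by the closed sets of points at distance at least [1 / (n + 1)] from
    its complement. *)
Let open_regular U : open U -> regular_set U.
Proof.
move=> oU e e0.
pose F n := U `\` ~` \bigcup_(t in ~` U) circle_ball t n.+1%:R^-1.
have oB n : open (\bigcup_(t in ~` U) circle_ball t n.+1%:R^-1).
  by apply: bigcup_open => t _; exact: circle_ball_open.
have [|||n Hn] := @measure_decreasing_small _ _ mu F e _ _ _ e0.
- move=> n; apply: measurableD; first exact: open_circle_measurable.
  by apply: measurableC; exact: open_circle_measurable.
- move=> m n mn; apply/subsetPset => t [Ut /contrapT[t' Ut' tt']]; split=> //.
  apply; exists t' => //; apply: (lt_le_trans tt').
  by rewrite lef_pV2 ?posrE// ler_nat.
- rewrite -subset0 => t Ft; have [Ut _] := Ft 0%N I.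
  have [r r0 rU] := open_circle_ball oU Ut.
  have [n Hn] : exists n : nat, r^-1 < n.+1%:R.
    by exists (Num.truncn r^-1); rewrite truncnS_gt// invr_ge0 ltW.
  have [_ /contrapT[t' Ut' tt']] := Ft n I; apply: Ut'; apply: rU.
  rewrite /circle_ball /= cabsB; apply: (lt_trans tt').
  by rewrite invf_plt ?posrE.
exists (~` \bigcup_(t in ~` U) circle_ball t n.+1%:R^-1), U; split=> //.
- exact: open_closedC.
- move=> t nt; apply: contrapT => Ut; apply: nt; exists t => //.
  exact: circle_ball_center.
Qed.

Let regular_sigma_algebra : sigma_algebra setT regular_set.
Proof.
split.
- exact/open_regular/open0.
- move=> A rA e /rA[K [U [cK oU KA AU UK]]]; exists (~` U), (~` K); split.
  + exact: open_closedC.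
  + exact: closed_openC.
  + by rewrite setTD; exact: subsetC.
  + by rewrite setTD; exact: subsetC.
  + by rewrite setDE setCK setIC -setDE.
move=> A rA e e0.
have e2 n : 0 < e / 2 / (2 ^ n.+1)%:R by rewrite !divr_gt0// ltr0n expn_gt0.
have /choice[KU HKU] : forall n, exists KU : set (circle R) * set (circle R),
    [/\ closed KU.1, open KU.2, KU.1 `<=` A n, A n `<=` KU.2 &
      (mu (KU.2 `\` KU.1) < (e / 2 / (2 ^ n.+1)%:R)%:E)%E].
  by move=> n; have [K [U H]] := rA n _ (e2 n); exists (K, U).
pose U := \bigcup_n (KU n).2; pose K n := \bigcup_(i < n) (KU i).1.
(* [K'] need not be closed. The finite union [K N] is, and replacing [K'] by it costs less than
   [e / 2]. *)
pose K' := \bigcup_n (KU n).1.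
have oU : open U by apply: bigcup_open => n _; have [] := HKU n.
have cK n : closed (K n).
  by apply: closed_bigcup => [|i _]; [exact: finite_II|have [] := HKU i].
have mKU n : measurable ((KU n).2 `\` (KU n).1).
  have [cKn oUn _ _ _] := HKU n.
  by apply: measurableD; [exact: open_circle_measurable|exact: closed_circle_measurable].
have mU := open_circle_measurable oU.
have mK n := closed_circle_measurable (cK n).
have mK' : measurable K'.
  by apply: bigcup_measurable => n _; apply: closed_circle_measurable; have [] := HKU n.
have ee : 0 < e / 2 by rewrite divr_gt0.
have [|||N HN] := @measure_decreasing_small _ _ mu (fun n => K' `\` K n) (e / 2) _ _ _ ee.
- by move=> n; apply: measurableD.
- move=> m n mn; apply/subsetPset => t [K't Knt]; split=> // -[i /= im Kit]; apply: Knt.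
  by exists i => //=; exact: leq_trans mn.
- rewrite -subset0 => t Ft; have [[n _ Knt] _] := Ft 0%N I.
  by have [_] := Ft n.+1 I; apply; exists n => /=.
exists (K N), U; split=> //.
- by move=> t [i _ Kit]; exists i => //; have [_ _ + _ _] := HKU i; apply.
- by move=> t [i _ Ait]; exists i => //; have [_ _ _ + _] := HKU i; apply.
have sub : U `\` K N `<=` (\bigcup_n ((KU n).2 `\` (KU n).1)) `|` (K' `\` K N).
  move=> t [[n _ Unt] KNt]; have [K't|K't] := pselect (K' t); first by right.
  by left; exists n => //; split=> // Knt; apply: K't; exists n.
have mB : measurable (\bigcup_n ((KU n).2 `\` (KU n).1)) by exact: bigcup_measurable.
have mD : measurable (K' `\` K N) by exact: measurableD.
apply: (le_lt_trans (le_measure mu _ _ sub)); rewrite ?inE.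
- by apply: measurableD.
- exact: measurableU.
apply: (le_lt_trans (measureU2 mu mB mD)).
rewrite [e]splitr EFinD lee_ltD// ?fin_num_measure//.
apply: (le_trans (measure_sigma_subadditive mu mKU mB (@subset_refl _ _))).
apply: le_trans (epsilon_trick0 xpredT (ltW ee)); apply: lee_nneseries => // n _.
by have [_ _ _ _ /ltW] := HKU n.
Qed.

Lemma closed_inner_regular (A : set (circle R)) (e : R) : measurable A -> 0 < e ->
  exists K, [/\ closed K, K `<=` A & (mu (A `\` K) < e%:E)%E].
Proof.
move=> mA e0; have rA : regular_set A.
  exact: (smallest_sub regular_sigma_algebra open_regular).
have [K [U [cK oU KA AU UK]]] := rA e e0; exists K; split=> //.
apply: le_lt_trans UK; apply: le_measure; rewrite ?inE.
- by apply: measurableD => //; exact: closed_circle_measurable.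
- by apply: measurableD; [exact: open_circle_measurable|exact: closed_circle_measurable].
- exact: setSD.
Qed.

End inner.
End regularity.

(** * Herglotz integrals and their exponentials *)

Section singular_functions.
Variable R : realType.
Notation C := R[i].
Notation Re := (@complex.Re _).
Notation Im := (@complex.Im _).
Notation val := (@circle_val R).
Implicit Types (t : circle R) (z w : C).

Definition herglotz_kernel z t : C := (val t + z) / (val t - z).

Lemma herglotz_kernelE z t : cabs z < 1 ->
  herglotz_kernel z t = 2 * (val t / (val t - z)) - 1.
Proof.
by move=> /(disk_sub_neq0 t) tz; rewrite /herglotz_kernel; field.
Qed.

Lemma cauchy_kernel_cbmf z n : cabs z < 1 ->
  cbmf setT (fun t => val t / (val t - z) ^+ n).
Proof.
move=> z1; apply: (circle_cbmf1 (f := fun w => w / (w - z) ^+ n)) => t.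
have tz := disk_sub_neq0 t z1.
apply: cderM; first exact: cder_id.
apply: (cderV (f := fun w => (w - z) ^+ n)); first by rewrite expf_neq0.
elim: n => [|n IH]; first exact: cder_cst.
have -> : (fun w => (w - z) ^+ n.+1) = (fun w => (w - z) * (w - z) ^+ n).
  by apply/funext => w; rewrite exprS.
exact: (cderM (cderB (cder_id _) (cder_cst _ _)) IH).
Qed.

Lemma herglotz_kernel_cbmf z : cabs z < 1 -> cbmf setT (herglotz_kernel z).
Proof.
move=> z1; rewrite (_ : herglotz_kernel z = fun t => 2 * (val t / (val t - z) ^+ 1) - 1).
  apply: cbmfB; last exact: cbmf_cst.
  by apply: cbmfM; [exact: cbmf_cst|exact: cauchy_kernel_cbmf].
by apply/funext => t; rewrite herglotz_kernelE// expr1.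
Qed.

Variable mu : {finite_measure set (circle R) -> \bar R}.

Lemma finite_measure_lty (D : set (circle R)) : measurable D -> (mu D < +oo)%E.
Proof. by move=> mD; rewrite ltey_eq fin_num_measure. Qed.

Definition herglotz (D : set (circle R)) z : C := cint mu D (herglotz_kernel z).

(** The set and the constant cover all uses: [theta] has [D = setT] and [c = 1], the common divisor
    has [D = E] and [c = e], and splitting [D] factors the function. *)
Definition singular_fun (D : set (circle R)) (c : R) z : C :=
  cexp (- (c%:C * herglotz D z)).

Variable D : set (circle R).
Hypothesis mD : measurable D.
Let fD := finite_measure_lty mD.

Lemma Re_herglotz z : Re (herglotz D z) = \int[mu]_(t in D) poisson_kernel z t.
Proof. by []. Qed.

Lemma Re_herglotz_ge0 z : cabs z < 1 -> 0 <= Re (herglotz D z).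
Proof.
by move=> z1; rewrite Re_herglotz; apply: Rintegral_ge0 => t _; exact: poisson_kernel_ge0.
Qed.

Lemma herglotz0 : herglotz D 0 = (fine (mu D))%:C.
Proof.
rewrite /herglotz (@eq_cint _ _ _ _ _ _ (fun=> 1)).
  by rewrite cint_cst// mul1r.
by move=> t _; rewrite /herglotz_kernel addr0 subr0 divff// circle_neq0.
Qed.

Let cbmfD' z : cabs z < 1 -> cbmf D (herglotz_kernel z).
Proof. by move=> z1; apply: cbmfS (herglotz_kernel_cbmf z1). Qed.

(** Differentiation under the integral sign: the second-order remainder of the kernel is
    [2 t h^2 / ((t - z - h) (t - z)^2)], at most [4 |h|^2 / r^3] when [|h| < r / 2] with
    [r = 1 - |z|]. *)
Lemma derivable_herglotz z : cabs z < 1 -> derivable (herglotz D) z 1.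
Proof.
move=> z1; pose r := 1 - cabs z; have r0 : 0 < r by rewrite subr_gt0.
have rt t : r <= cabs (val t - z).
  by apply: le_trans (cabsD_dist _ _); rewrite cabs_circle.
have b2 : cbmf D (fun t => 2 * (val t / (val t - z) ^+ 2)).
  apply: cbmfM; first exact: cbmf_cst.
  by apply: cbmfS (cauchy_kernel_cbmf 2 z1).
apply: (@cder_quadratic _ _ _ (cint mu D (fun t => 2 * (val t / (val t - z) ^+ 2)))
  (2 * (4 / r ^+ 3) * fine (mu D)) (r / 2)); first by rewrite divr_gt0.
move=> h hr; have zh1 : cabs (z + h) < 1.
  by apply: (le_lt_trans (cabsD _ _)); rewrite /r in hr; lra.
rewrite /herglotz -cintB//; [|exact: cbmfD'|exact: cbmfD'].
rewrite mulrC -cintZ// -cintB//; last 2 first.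
- by apply: cbmfB; exact: cbmfD'.
- by apply: cbmfM => //; exact: cbmf_cst.
have -> : 2 * (4 / r ^+ 3) * fine (mu D) * cabs h ^+ 2 =
  2 * (4 / r ^+ 3 * cabs h ^+ 2) * fine (mu D) by ring.
apply: cint_norm_le => //.
  by apply: cbmfB; [apply: cbmfB; exact: cbmfD'|apply: cbmfM => //; exact: cbmf_cst].
move=> t _; have tz := disk_sub_neq0 t z1; have tzh := disk_sub_neq0 t zh1.
rewrite !herglotz_kernelE//.
have -> : 2 * (val t / (val t - (z + h))) - 1 - (2 * (val t / (val t - z)) - 1) -
    h * (2 * (val t / (val t - z) ^+ 2)) =
    2 * val t * h ^+ 2 / ((val t - (z + h)) * (val t - z) ^+ 2).
  by field; rewrite tz tzh.
have -> : cabs (2 * val t * h ^+ 2 / ((val t - (z + h)) * (val t - z) ^+ 2)) =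
    2 * cabs h ^+ 2 / (cabs (val t - (z + h)) * cabs (val t - z) ^+ 2).
  rewrite [LHS]cabsM cabsV; congr (_ / _); last by rewrite cabsM cabsX.
  rewrite [LHS]cabsM cabsX; congr (_ * _); rewrite cabsM cabs_circle mulr1.
  by rewrite -(rmorph_nat (real_complex R) 2) cabs_real ger0_norm.
have rh : r / 2 <= cabs (val t - (z + h)).
  have -> : val t - (z + h) = (val t - z) - h by ring.
  apply: le_trans (cabsD_dist _ _); have := rt t; lra.
have c0 : 0 < cabs (val t - (z + h)) * cabs (val t - z) ^+ 2.
  by rewrite mulr_gt0 ?exprn_gt0 ?cabs_gt0.
have c3 : r / 2 * r ^+ 2 <= cabs (val t - (z + h)) * cabs (val t - z) ^+ 2.
  apply: ler_pM; rewrite ?divr_ge0 ?exprn_ge0 ?(ltW r0)//.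
  by rewrite ler_pXn2r// nnegrE ?(ltW r0)// cabs_ge0.
rewrite ler_pdivrMr// mulrAC ler_wpM2r ?exprn_ge0 ?cabs_ge0//.
rewrite mulrAC ler_pdivlMr ?exprn_gt0//; apply: le_trans (ler_wpM2l _ c3); last by [].
by rewrite le_eqVlt; apply/orP; left; apply/eqP; field.
Qed.

Variable c : R.

Lemma derivable_singular_fun z : cabs z < 1 -> derivable (singular_fun D c) z 1.
Proof.
move=> z1; apply: (cder_comp (f := fun z => - (c%:C * herglotz D z))); last first.
  exact: derivable_cexp.
have -> : (fun z => - (c%:C * herglotz D z)) = (fun z => (- c%:C) * herglotz D z).
  by apply/funext => w; rewrite mulNr.
exact: (cderM (cder_cst _ _) (derivable_herglotz z1)).
Qed.

Lemma cabs_singular_fun z :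
  cabs (singular_fun D c z) = expR (- (c * Re (herglotz D z))).
Proof. by rewrite cabs_cexp ReN ReM /= mul0r subr0. Qed.

Lemma singular_fun0 : singular_fun D c 0 = (expR (- (c * fine (mu D))))%:C.
Proof.
rewrite /singular_fun herglotz0 -rmorphM -rmorphN /cexp /= cos0 sin0.
by apply: complex_ext => /=; ring.
Qed.

Lemma singular_fun_le1 z : 0 <= c -> cabs z < 1 -> cabs (singular_fun D c z) <= 1.
Proof.
move=> c0 z1; rewrite cabs_singular_fun -expR0 ler_expR oppr_le0.
by rewrite mulr_ge0// Re_herglotz_ge0.
Qed.

Lemma singular_fun_neq0 z : singular_fun D c z != 0.
Proof. exact: cexp_neq0. Qed.

Lemma singular_fun_split (K : set (circle R)) z : measurable K -> cabs z < 1 ->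
  singular_fun D c z = singular_fun (D `&` K) c z * singular_fun (D `\` K) c z.
Proof.
move=> mK z1; rewrite /singular_fun -cexpD; congr cexp.
rewrite -opprD -mulrDr; congr (- (_ * _)).
have [ru iu] := cbmfD' z1.
have dis : [disjoint D `&` K & D `\` K] by apply/disj_setPS => t [[_ ?] [_ []]].
have mDK : measurable (D `&` K) by exact: measurableI.
have mDK' : measurable (D `\` K) by exact: measurableD.
have eD : D `&` K `|` D `\` K = D by rewrite setUIDK.
rewrite /herglotz /cint; apply: complex_ext => /=.
  rewrite -[in LHS]eD Rintegral_setU// eD; exact: bmf_integrable.
by rewrite -[in LHS]eD Rintegral_setU// eD; exact: bmf_integrable.
Qed.

End singular_functions.

(** * Existence and modulus of radial limits *)

Section radial_limits.
Variable R : realType.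
Notation C := R[i].
Notation Re := (@complex.Re _).
Notation Im := (@complex.Im _).
Notation val := (@circle_val R).
Implicit Types (t : circle R).

Lemma at_left_cauchy_cvg (h : R -> R) :
  (forall e : R, 0 < e -> exists2 s : R, s < 1 &
    forall r r', s < r < 1 -> s < r' < 1 -> `|h r - h r'| <= e) ->
  cvg (h r @[r --> (1 : R)^'-]).
Proof.
move=> H; apply/cauchy_cvgP/cauchy_exP => e e0.
have [|s s1 Hs] := H (e / 2); first by rewrite divr_gt0.
exists (h ((s + 1) / 2)); rewrite /= near_simpl; near=> r.
rewrite /ball /=; apply: (@le_lt_trans _ _ (e / 2)); last first.
  by rewrite ltr_pdivrMr// ltr_pMr// ltr1n.
apply: Hs; first by apply/andP; split; lra.
by apply/andP; split; near: r; [exact: nbhs_left_gt|exact: nbhs_left_lt].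
Unshelve. all: by end_near. Qed.

Lemma at_left_nearP (P : R -> Prop) (s : R) : s < 1 ->
  (forall r, s < r < 1 -> P r) -> \forall r \near (1 : R)^'-, P r.
Proof.
move=> s1 H; near=> r; apply: H.
by apply/andP; split; near: r; [exact: nbhs_left_gt|exact: nbhs_left_lt].
Unshelve. all: by end_near. Qed.

(** Oscillation estimates are used instead of limits because each [e] will be served by a different
    factorization of the function. *)
Lemma radial_limit_unimodular (f : C -> C) t :
  (forall e : R, 0 < e -> exists2 s : R, s < 1 &
    forall r r', s < r < 1 -> s < r' < 1 ->
      cabs (f (r%:C * val t) - f (r'%:C * val t)) <= e /\
      `|1 - cabs (f (r%:C * val t))| <= e) ->
  exists2 l : C, f (r%:C * circle_val t) @[r --> (1 : R)^'-] --> l & `|l| = 1.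
Proof.
move=> H.
have cR : cvg (Re (f (r%:C * val t)) @[r --> (1 : R)^'-]).
  apply: at_left_cauchy_cvg => e /H[s s1 Hs]; exists s => // r r' h1 h2.
  have [+ _] := Hs _ _ h1 h2; apply: le_trans.
  by rewrite -ReN -ReD; exact: ler_Re_cabs.
have cI : cvg (Im (f (r%:C * val t)) @[r --> (1 : R)^'-]).
  apply: at_left_cauchy_cvg => e /H[s s1 Hs]; exists s => // r r' h1 h2.
  have [+ _] := Hs _ _ h1 h2; apply: le_trans.
  by rewrite -ImN -ImD; exact: ler_Im_cabs.
move: cR cI => /cvg_ex[a Ha] /cvg_ex[b Hb].
have cl : f (r%:C * circle_val t) @[r --> (1 : R)^'-] --> a +i* b.
  apply/(@cvg_cabs _ _ ((1 : R)^'-)) => e e0; have e2 : 0 < e / 2 by rewrite divr_gt0.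
  move/cvgrPdist_lt : Ha => /(_ _ e2) Ha; move/cvgrPdist_lt : Hb => /(_ _ e2) Hb.
  near=> r; apply: (le_lt_trans (cabs_le_ReIm _)).
  rewrite ReD ReN ImD ImN /= [e]splitr.
  by apply: ltrD; rewrite distrC; near: r; [exact: Ha|exact: Hb].
exists (a +i* b) => //; rewrite normcE; congr (_%:C).
apply/eqP; rewrite eq_sym -subr_eq0 -normr_le0 leNgt; apply/negP => l0.
have e0 : 0 < `|1 - cabs (a +i* b)| / 3 by rewrite divr_gt0.
have [s s1 Hs] := H _ e0.
have : \forall r \near (1 : R)^'-, False; last first.
  by move=> /filter_ex[].
move/(@cvg_cabs _ _ ((1 : R)^'-)) : cl => /(_ _ e0) cl.
near=> r.
have sr : s < r < 1.
  by apply/andP; split; near: r; [exact: nbhs_left_gt|exact: nbhs_left_lt].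
have [_] := Hs _ _ sr sr.
have : cabs (f (r%:C * val t) - (a +i* b)) < `|1 - cabs (a +i* b)| / 3 by near: r; exact: cl.
have := cabsD_dist (f (r%:C * val t)) (a +i* b).
have := cabsD_dist (a +i* b) (f (r%:C * val t)).
rewrite [cabs (a +i* b - _)]cabsB.
move: (cabs (f _)) (cabs (f _ - _)) (cabs (a +i* b)) l0 => x y u l0 h1 h2 h3.
have h4 : `|1 - u| <= `|1 - x| + `|x - u|.
  have -> : 1 - u = (1 - x) + (x - u) by ring.
  exact: ler_normD.
have h5 : `|x - u| <= y by rewrite ler_norml; apply/andP; split; lra.
lra.
Unshelve. all: by end_near. Qed.

Variable mu : {finite_measure set (circle R) -> \bar R}.

(** Seen from the radius ending at a point off the carrier [K], the Poisson kernel is [O(1 - r)] on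
    [D], and the Herglotz kernels at [r] and [r'] differ by [O(|r - r'|)]. *)
Lemma singular_fun_off_support (D K : set (circle R)) (c : R) t (e : R) :
  measurable D -> D `<=` K -> closed K -> ~ K t -> 0 <= c -> 0 < e ->
  exists s : R, [/\ 0 <= s, s < 1 & forall r r', s < r < 1 -> s < r' < 1 ->
    cabs (singular_fun mu D c (r%:C * val t) -
          singular_fun mu D c (r'%:C * val t)) <= e /\
    1 - e <= cabs (singular_fun mu D c (r%:C * val t))].
Proof.
move=> mD DK cK Kt c0 e0.
have [d d0 dK] := open_circle_ball (closed_openC cK) Kt.
have far t' : D t' -> d <= cabs (val t' - val t).
  by move=> /DK Kt'; rewrite leNgt; apply/negP => /dK.
have far2 t' r : D t' -> 1 - d / 2 < r < 1 -> d / 2 <= cabs (val t' - r%:C * val t).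
  move=> Dt' /andP[dr r1].
  have -> : val t' - r%:C * val t = (val t' - val t) - (r - 1)%:C * val t.
    by rewrite rmorphB /=; ring.
  apply: le_trans (cabsD_dist _ _); rewrite cabsM cabs_circle mulr1 cabs_real.
  by have := far t' Dt'; rewrite ltr0_norm ?subr_lt0//; lra.
have /cder_continuous/continuous_cabsP/(_ e e0)[q q0 Hq] := derivable_cexp (0 : C).
pose m := fine (mu D) : R; have m0 : 0 <= m by exact: fine_ge0.
(* [B] bounds [2 / |(t' - r t) (t' - r' t)|], both distances being at least [d / 2]. *)
have [B [B0 BE]] : exists B : R, 0 < B /\ B * (d / 2 * (d / 2)) = 2.
  exists (8 / d ^+ 2); split; first by rewrite divr_gt0// exprn_gt0.
  by field; rewrite gt_eqF.
have [cmB cmB0 cmBge] : exists2 cmB : R, 0 < cmB & c * (2 * B * m) <= cmB.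
  exists (c * (2 * B * m) + 1); last by rewrite lerDl.
  by rewrite ltr_wpDl// mulr_ge0// mulr_ge0// mulr_ge0// ltW.
(* Beyond [s], the radius stays at distance [d / 2] from [D], and [cmB * (1 - r)] is below [q], for
   the continuity of [cexp] at 0, and below [e], for the lower bound on the modulus. *)
pose s := Num.max (1 - d / 2) (Num.max 0 (1 - Num.min q e / cmB)).
have s1 : s < 1.
  by rewrite !gt_max ltr01 !gtrBl !divr_gt0// lt_min q0.
have s0 : 0 <= s by rewrite !le_max lexx orbT.
have sd : 1 - d / 2 <= s by rewrite le_max lexx.
have sq : 1 - Num.min q e / cmB <= s by rewrite !le_max lexx !orbT.
exists s; split=> // r r' /andP[sr r1] /andP[sr' r'1].
have disk u : s < u -> u < 1 -> cabs (u%:C * val t) < 1.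
  by move=> su u1; rewrite cabs_scale//; lra.
have cl u : s < u -> u < 1 -> cmB * (1 - u) < Num.min q e.
  by move=> su u1; rewrite mulrC -ltr_pdivlMr//; lra.
have z1 := disk _ sr r1; have z1' := disk _ sr' r'1.
have bk u : s < u -> u < 1 -> cbmf D (herglotz_kernel (u%:C * val t)).
  by move=> su u1; apply: cbmfS (herglotz_kernel_cbmf (disk _ su u1)).
have dr : 1 - d / 2 < r < 1 by apply/andP; split; lra.
have dr' : 1 - d / 2 < r' < 1 by apply/andP; split; lra.
have fD := finite_measure_lty mu mD.
split.
  rewrite /singular_fun.
  set a := - (c%:C * herglotz mu D (r%:C * val t)).
  set b := - (c%:C * herglotz mu D (r'%:C * val t)).
  (* The factor [cexp b] has modulus at most 1, so continuity of [cexp] at 0 suffices, although the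
     exponents vary. *)
  have -> : cexp a - cexp b = cexp b * (cexp (a - b) - cexp 0).
    by rewrite cexp0 mulrBr -cexpD [b + _]addrC subrK mulr1.
  rewrite cabsM -[leRHS]mul1r ler_pM ?cabs_ge0//.
    rewrite cabs_cexp -expR0 ler_expR /b ReN ReM /= mul0r subr0 oppr_le0.
    by rewrite mulr_ge0// Re_herglotz_ge0.
  apply/ltW/Hq; rewrite subr0.
  have -> : a - b = - (c%:C * (herglotz mu D (r%:C * val t) - herglotz mu D (r'%:C * val t))).
    by rewrite /a /b; ring.
  rewrite cabsN cabsM cabs_real ger0_norm// /herglotz -cintB//; [|exact: bk|exact: bk].
  have rr : `|r - r'| <= Num.max (1 - r) (1 - r').
    rewrite le_max; apply/orP; case: (leP r r') => rr'; [left|right].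
      by rewrite ler0_norm; lra.
    by rewrite gtr0_norm; lra.
  have small : cmB * `|r - r'| < q.
    apply: (@le_lt_trans _ _ (cmB * Num.max (1 - r) (1 - r'))); first by rewrite ler_pM2l.
    rewrite maxr_pMr ?ltW// gt_max.
    by apply/andP; split; apply: lt_le_trans (cl _ _ _) _ => //; rewrite ge_min lexx.
  apply: le_lt_trans small; apply: le_trans (ler_wpM2r _ cmBge); last by [].
  rewrite -[leRHS]mulrA ler_wpM2l//.
  have -> : 2 * B * m * `|r - r'| = 2 * (B * `|r - r'|) * m by ring.
  apply: (cint_norm_le mD fD); first by apply: cbmfB; exact: bk.
  move=> t' Dt'; have n1 := disk_sub_neq0 t' z1; have n1' := disk_sub_neq0 t' z1'.
  have -> : herglotz_kernel (r%:C * val t) t' - herglotz_kernel (r'%:C * val t) t' =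
      ((r - r') *+ 2)%:C * (val t' * val t) /
       ((val t' - r%:C * val t) * (val t' - r'%:C * val t)).
    by rewrite !herglotz_kernelE// rmorphMn rmorphB /=; field; rewrite n1 n1'.
  rewrite cabsM cabsV ler_pdivrMr; last by rewrite cabs_gt0 mulf_neq0.
  rewrite !cabsM !cabs_circle cabs_real !mulr1 normrMn.
  have -> : `|r - r'| *+ 2 = B * `|r - r'| * (d / 2 * (d / 2)).
    by rewrite mulrAC BE mulr_natl.
  apply: ler_wpM2l; first by rewrite mulr_ge0// ltW.
  have d2 : 0 <= d / 2 by rewrite divr_ge0// ltW.
  by apply: ler_pM => //; exact: far2.
rewrite cabs_singular_fun; apply: le_trans (expR_ge1Dx _); rewrite lerD2l lerN2 Re_herglotz.
have bP : bmf D (poisson_kernel (r%:C * val t)).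
  exact: bmfS (poisson_kernel_bmf z1).
apply: (@le_trans _ _ (cmB * (1 - r))); last first.
  by apply/ltW; apply: lt_le_trans (cl _ sr r1) _; rewrite ge_min lexx orbT.
apply: le_trans (ler_wpM2r _ cmBge); last by rewrite subr_ge0 ltW.
rewrite -[leRHS]mulrA ler_wpM2l//.
have -> : 2 * B * m * (1 - r) = \int[mu]_(t' in D) (2 * B * (1 - r)).
  by rewrite Rintegral_cst// /m; ring.
apply: Rint_le => //; first exact: bmf_cst.
move=> t' Dt'; rewrite poisson_kernelE//.
rewrite ler_pdivrMr; last by rewrite exprn_gt0// cabs_gt0 disk_sub_neq0.
rewrite cabs_scale; last lra.
have -> : 1 - r ^+ 2 = (1 + r) * (1 - r) by ring.
rewrite mulrAC; apply: ler_wpM2r; first by rewrite subr_ge0 ltW.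
apply: (@le_trans _ _ (2 * B * (d / 2) ^+ 2)).
  have -> : 2 * B * (d / 2) ^+ 2 = 4 by rewrite -mulrA expr2 BE -natrM.
  lra.
apply: ler_wpM2l; first by rewrite mulr_ge0// ltW.
by rewrite ler_pXn2r ?nnegrE ?cabs_ge0 ?divr_ge0 ?(ltW d0)//; exact: far2.
Qed.

End radial_limits.

(** * Kernels on the line bounded by averages over intervals *)

Section maximal_function.
Variable R : realType.
Notation leb := (@lebesgue_measure R).
Implicit Types (g Q : R -> R).

Lemma measurable_ballR (x r : R) : measurable (ball x r : set (measurableTypeR R)).
Proof. exact: measurable_ball. Qed.

Section dyadic.
Variables (a b th de B H : R) (Q g : R -> R).
Hypotheses (de0 : 0 < de) (B0 : 0 <= B) (H0 : 0 <= H).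
Let D : set (measurableTypeR R) := `[a, b]%classic.
Let mD : measurable D. Proof. exact: measurable_itv. Qed.
Let fD : (leb D < +oo)%E. Proof. exact: segment_fin. Qed.
Hypotheses (bQ : bmf D Q) (bg : bmf D g).
Hypotheses (g0 : forall s, D s -> 0 <= g s).
Hypothesis Q1 : forall s, D s -> Q s <= B / de.
Hypothesis Q2 : forall s, D s -> Q s * (s - th) ^+ 2 <= B * de / 4.
Hypothesis gH : forall r, 0 < r -> \int[leb]_(s in D `&` ball th r) g s <= 2 * r * H.

(** The weight [B / 4 ^+ j / de] is the bound on [Q] given by [Q1] for [j = 0], and by [Q2] on the
    annulus between the radii [2 ^+ j.-1 * de] and [2 ^+ j * de]. Full balls replace annuli because
    [gH] speaks of balls. *)
Let S n s : R := \sum_(j < n) B / 4 ^+ j / de * (g s * \1_(ball th (2 ^+ j * de)) s).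

Let bterm (c r : R) : bmf D (fun s => c * (g s * \1_(ball th r) s)).
Proof.
apply: bmfM; first exact: bmf_cst.
by apply: bmfM => //; apply: bmf_indic; exact: measurable_ballR.
Qed.

Let bS n : bmf D (S n).
Proof.
elim: n => [|n IH].
  rewrite (_ : S 0 = fun=> 0); first exact: bmf_cst.
  by apply/funext => s; rewrite /S big_ord0.
rewrite (_ : S n.+1 = fun s => S n s +
    B / 4 ^+ n / de * (g s * \1_(ball th (2 ^+ n * de)) s)); first exact: bmfD.
by apply/funext => s; rewrite /S big_ord_recr.
Qed.

(** Term [j] contributes at most [2 * B * H * 2 ^- j]: the radius doubles while the weight is
    divided by 4. *)
Let int_S n : \int[leb]_(s in D) S n s <= 4 * B * H * (1 - 2 ^- n).
Proof.
elim: n => [|n IH].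
  rewrite expr0 invr1 subrr mulr0 (@eq_Rintegral _ _ _ leb D (fun=> 0)).
    by rewrite Rintegral_cst// mul0r.
  by move=> s _; rewrite /S big_ord0.
rewrite (@eq_Rintegral _ _ _ leb D (fun s => S n s +
    B / 4 ^+ n / de * (g s * \1_(ball th (2 ^+ n * de)) s))); last first.
  by move=> s _; rewrite /S big_ord_recr.
rewrite RintD// RintZ//; last first.
  by apply: bmfM => //; apply: bmf_indic; exact: measurable_ballR.
have -> : \int[leb]_(s in D) (g s * \1_(ball th (2 ^+ n * de)) s) =
    \int[leb]_(s in D `&` ball th (2 ^+ n * de)) g s.
  rewrite Rintegral_mkcondr; apply: eq_Rintegral => s _.
  by rewrite patchE indicE; case: ifPn => _; rewrite ?mulr1 ?mulr0.
have r0 : 0 < 2 ^+ n * de by rewrite mulr_gt0// exprn_gt0.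
have c0 : 0 <= B / 4 ^+ n / de by rewrite divr_ge0 ?divr_ge0 ?exprn_ge0 ?(ltW de0).
apply: (le_trans (lerD IH (ler_wpM2l c0 (gH r0)))).
have -> : (4 : R) ^+ n = 2 ^+ n * 2 ^+ n by rewrite -exprMn -natrM.
rewrite le_eqVlt; apply/orP; left; apply/eqP; rewrite exprS; field.
by rewrite expf_neq0// gt_eqF.
Qed.

Let S_ge N s : D s -> `|th - s| < 2 ^+ N * de -> Q s * g s <= S N.+1 s.
Proof.
move=> Ds sN.
have term0 (j : nat) : 0 <= B / 4 ^+ j / de * (g s * \1_(ball th (2 ^+ j * de)) s).
  apply: mulr_ge0; last by rewrite mulr_ge0// g0.
  by rewrite divr_ge0 ?divr_ge0 ?exprn_ge0 ?(ltW de0).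
(* The least [n] puts [s] in the [n]-th ball and, if [n > 0], outside the previous one, where [Q2]
   bounds [Q s]. *)
case: (@ex_minnP (fun n => `|th - s| < 2 ^+ n * de)); first by exists N.
move=> n Hn min_n; have nN := min_n _ sN.
rewrite /S (bigD1 (Ordinal (nN : (n < N.+1)%N)))//=.
have ind1 : \1_(ball th (2 ^+ n * de)) s = 1 :> R by rewrite indicE mem_set.
apply: (@le_trans _ _ (B / 4 ^+ n / de * (g s * \1_(ball th (2 ^+ n * de)) s))).
  rewrite ind1 mulr1; apply: ler_wpM2r; first exact: g0.
  case: n Hn min_n {nN ind1} => [|n] Hn min_n.
    by rewrite expr0 divr1; exact: Q1.
  have far : 2 ^+ n * de <= `|th - s|.
    by rewrite leNgt; apply/negP => /min_n; rewrite ltnn.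
  have sq : (2 ^+ n * de) ^+ 2 <= (s - th) ^+ 2.
    rewrite -[leRHS]real_normK ?num_real// distrC ler_pXn2r// nnegrE.
    by rewrite mulr_ge0 ?exprn_ge0 ?(ltW de0).
  have [Q0|Q0] := leP (Q s) 0.
    by apply: (le_trans Q0); rewrite divr_ge0 ?divr_ge0 ?exprn_ge0 ?(ltW de0).
  have := le_trans (ler_wpM2l (ltW Q0) sq) (Q2 Ds).
  have p0 : 0 < (2 ^+ n * de) ^+ 2 by rewrite exprn_gt0// mulr_gt0// exprn_gt0.
  rewrite -ler_pdivlMr// => /le_trans; apply.
  rewrite le_eqVlt; apply/orP; left; apply/eqP.
  have -> : (4 : R) ^+ n.+1 = 4 * (2 ^+ n * 2 ^+ n) by rewrite exprS -exprMn -natrM.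
  by field; rewrite expf_neq0// gt_eqF.
by rewrite lerDl sumr_ge0.
Qed.

(* [Q] is the Poisson kernel seen on the line, at distance [de] from the
   boundary: [S] decomposes it into dyadic annuli around [th]. *)
Lemma dyadic_maximal_bound : \int[leb]_(s in D) (Q s * g s) <= 4 * B * H.
Proof.
have [N HN] : exists N, forall s, D s -> `|th - s| < 2 ^+ N * de.
  have [n Hn] : exists n : nat, (`|th| + (`|a| + `|b|)) / de < n%:R.
    by exists (Num.truncn ((`|th| + (`|a| + `|b|)) / de)).+1;
      rewrite truncnS_gt// divr_ge0 ?(ltW de0)// !addr_ge0.
  exists n => s; rewrite /D /= in_itv /= => /andP[as_ sb].
  rewrite -ltr_pdivrMr//; apply: (@lt_trans _ _ n%:R); last first.
    by rewrite -natrX ltr_nat ltn_expl.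
  apply: le_lt_trans Hn; rewrite ler_pM2r ?invr_gt0//.
  apply: (le_trans (ler_normD _ _)); rewrite normrN lerD2l ler_norml.
  have := ler_norm b; have := ler_norm (- a); rewrite normrN.
  by have := normr_ge0 a; have := normr_ge0 b; lra.
apply: (@le_trans _ _ (\int[leb]_(s in D) S N.+1 s)).
  by apply: Rint_le => //; [exact: bmfM|move=> s Ds; exact: S_ge (HN _ Ds)].
by apply: (le_trans (int_S _)); rewrite ler_piMr ?mulr_ge0.
Qed.

End dyadic.
End maximal_function.

(** * The Poisson kernel in the angular variable *)

Section poisson_maximal.
Variable R : realType.
Notation C := R[i].
Notation Re := (@complex.Re _).
Notation Im := (@complex.Im _).
Notation leb := (@lebesgue_measure R).
Notation val := (@circle_val R).
Implicit Types (g : R -> R).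

(** Up to 1 the mean value theorem gives the slope [cos 1]; beyond, [sin] is at least the smaller of
    [sin 1] and [sin e] while [y] is at most [pi]. *)
Lemma sin_ge_linear (e : R) : 0 < e <= 1 ->
  exists2 ka : R, 0 < ka & forall y, 0 <= y <= pi - e -> ka * y <= sin y.
Proof.
move=> /andP[e0 e1]; have pi2 := pi_ge2 R; have pi0 := pi_gt0 R.
have sin_mono (x y : R) : 0 <= x -> x <= y -> y <= pi / 2 -> sin x <= sin y.
  move=> x0; rewrite le_eqVlt => /predU1P[->//|xy yp].
  by rewrite ltW// ltr_sin// in_itv /=; apply/andP; split; lra.
have s1 : 0 < sin 1 :> R by apply: sin_gt0_pi; rewrite ltr01; lra.
have se : 0 < sin e by apply: sin_gt0_pi; rewrite e0; lra.
have c1 := @cos1_gt0 R.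
exists (Num.min (cos 1) (Num.min (sin 1) (sin e) / pi)).
  by rewrite lt_min c1 divr_gt0// lt_min s1.
move=> y /andP[y0 ype]; have [y1|y1] := leP y 1.
  have [|z zI E] := @MVT_segment R sin cos 0 y y0.
    by apply: continuous_subspaceT; exact: continuous_sin.
  move: zI; rewrite in_itv /= => /andP[z0 zy].
  rewrite sin0 !subr0 in E; rewrite E ler_wpM2r//.
  apply: (@le_trans _ _ (cos 1)); first by rewrite ge_min lexx.
  have [->|z1] := eqVneq z 1; first exact: lexx.
  rewrite ltW// ltr_cos ?in_itv /=; first by rewrite lt_neqAle z1 (le_trans zy).
    by apply/andP; split; lra.
  by apply/andP; split; lra.
apply: (@le_trans _ _ (Num.min (sin 1) (sin e))).
  apply: (@le_trans _ _ (Num.min (sin 1) (sin e) / pi * y)).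
    by rewrite ler_wpM2r// ge_min lexx orbT.
  rewrite mulrAC ler_pdivrMr// ler_wpM2l//; last lra.
  by rewrite le_min (ltW s1) ltW.
have [yp|yp] := leP y (pi / 2).
  by rewrite ge_min sin_mono//; lra.
have -> : sin y = sin (pi - y) by rewrite sinB sinpi cospi; lra.
by rewrite ge_min; apply/orP; right; apply: sin_mono; lra.
Qed.

Lemma chordE (x y : R) :
  cabs (val (expi x) - val (expi y)) ^+ 2 = 4 * sin ((x - y) / 2) ^+ 2.
Proof.
rewrite cabs_sqr /=.
have -> : (cos x - cos y) ^+ 2 + (sin x - sin y) ^+ 2 =
    (cos x ^+ 2 + sin x ^+ 2) + (cos y ^+ 2 + sin y ^+ 2) -
    2 * (cos x * cos y + sin x * sin y) by ring.
rewrite !cos2Dsin2 -cosB.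
have {1}-> : x - y = (x - y) / 2 *+ 2 by rewrite -mulr_natr; field.
by rewrite cos_mulr2n sin2cos2; ring.
Qed.

(** The angular difference must stay away from [2 * pi], where the chord closes up while the
    difference does not. *)
Lemma chord_ge (e : R) : 0 < e <= 1 -> exists2 ka : R, 0 < ka &
  forall x y, `|x - y| <= 2 * pi - e -> ka * `|x - y| <= cabs (val (expi x) - val (expi y)).
Proof.
move=> /andP[e0 e1]; have [|ka ka0 Hka] := @sin_ge_linear (e / 2).
  by rewrite divr_gt0//=; lra.
exists ka => // x y xy.
rewrite -(@ler_pXn2r _ 2) ?nnegrE ?cabs_ge0 ?mulr_ge0 ?(ltW ka0)// chordE.
have -> : sin ((x - y) / 2) ^+ 2 = sin (`|x - y| / 2) ^+ 2.
  by case: (ger0P (x - y)) => _ //; rewrite mulNr sinN sqrrN.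
have n0 := normr_ge0 (x - y).
have h : ka * (`|x - y| / 2) <= sin (`|x - y| / 2) by apply: Hka; apply/andP; split; lra.
have h0 : 0 <= ka * (`|x - y| / 2) by rewrite mulr_ge0 ?(ltW ka0)// divr_ge0.
have -> : (ka * `|x - y|) ^+ 2 = 4 * (ka * (`|x - y| / 2)) ^+ 2 by field.
by rewrite ler_pM2l// ler_pXn2r// nnegrE (le_trans h0).
Qed.

(** In the angle, the kernel at radius [r] satisfies [Q1] and [Q2] with [de = 1 - r]. Keeping [th]
    at distance [e] from both ends makes [|s - th| <= 2 * pi - e], as [chord_ge] requires. *)
Lemma poisson_kernel_maximal (e : R) : 0 < e <= 1 -> exists2 B : R, 0 < B &
  forall g (th r H : R), bmf `[0, 2 * pi]%classic g ->
  (forall s, 0 <= s <= 2 * pi -> 0 <= g s) -> 0 <= r < 1 ->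
  e <= th <= 2 * pi - e -> 0 <= H ->
  (forall q, 0 < q -> \int[leb]_(s in `[0, 2 * pi]%classic `&` ball th q) g s <= 2 * q * H) ->
  \int[leb]_(s in `[0, 2 * pi]%classic)
    (poisson_kernel (r%:C * val (expi th)) (expi s) * g s) <= B * H.
Proof.
move=> e01; have [ka ka0 Hka] := chord_ge e01; have /andP[e0 e1] := e01.
(* The 4 is that of [dyadic_maximal_bound]; the summand 2 serves [Q1] and [32 / ka ^+ 2] serves
   [Q2]. *)
exists (4 * (2 + 32 / ka ^+ 2)).
  by rewrite mulr_gt0// ltr_wpDr// divr_ge0// exprn_ge0 ?(ltW ka0).
move=> g th r H bg g0 /andP[r0 r1] /andP[eth the] H0 gH.
pose z := r%:C * val (expi th).
have z1 : cabs z < 1 by rewrite cabs_scale.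
have zr : cabs z = r by rewrite cabs_scale.
have d0 : 0 < 1 - r by rewrite subr_gt0.
have B0 : 0 <= 2 + 32 / ka ^+ 2 by rewrite addr_ge0// divr_ge0// exprn_ge0 ?(ltW ka0).
have dist s : 1 - r <= cabs (val (expi s) - z).
  by apply: le_trans (cabsD_dist _ _); rewrite cabs_circle zr.
have dist0 s : 0 < cabs (val (expi s) - z) by apply: lt_le_trans (dist s).
apply: (@dyadic_maximal_bound _ _ _ th (1 - r)) => //.
- have [mP [M PM]] := poisson_kernel_bmf z1; split.
    apply: measurable_funTS; apply: measurableT_comp => //.
    exact: measurable_expi.
  by exists M => s _; exact: PM.
- move=> s _; rewrite poisson_kernelE// zr.
  apply: (@le_trans _ _ (2 / (1 - r))); last first.
    by rewrite ler_pM2r ?invr_gt0// lerDl divr_ge0// exprn_ge0 ?(ltW ka0).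
  rewrite ler_pdivrMr ?exprn_gt0// mulrAC ler_pdivlMr//.
  apply: (@le_trans _ _ (2 * (1 - r) ^+ 2)).
    have -> : (1 - r ^+ 2) * (1 - r) = (1 + r) * (1 - r) ^+ 2 by ring.
    by rewrite ler_wpM2r ?sqr_ge0//; lra.
  by rewrite ler_pM2l// ler_pXn2r// nnegrE ?cabs_ge0// ltW.
move=> s; rewrite /= in_itv /= => /andP[s0 s2]; rewrite poisson_kernelE// zr.
rewrite -/z; have /Hka : `|s - th| <= 2 * pi - e.
  by rewrite ler_norml; apply/andP; split; lra.
have -> : cabs (val (expi s) - val (expi th)) =
    cabs ((val (expi s) - z) - (1 - r)%:C * val (expi th)).
  by congr cabs; rewrite /z rmorphB /=; ring.
move=> h1; have h2 : ka * `|s - th| <= 2 * cabs (val (expi s) - z).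
  apply: (le_trans h1); apply: (le_trans (cabsD _ _)); rewrite cabsN.
  rewrite cabs_scale ?(ltW d0)//; have := dist s; lra.
have h3 : (ka * `|s - th|) ^+ 2 <= 4 * cabs (val (expi s) - z) ^+ 2.
  have -> : 4 * cabs (val (expi s) - z) ^+ 2 = (2 * cabs (val (expi s) - z)) ^+ 2 by ring.
  by rewrite ler_pXn2r// nnegrE ?mulr_ge0 ?cabs_ge0 ?(ltW ka0).
rewrite exprMn real_normK ?num_real// in h3.
rewrite mulrAC ler_pdivrMr ?exprn_gt0//.
have k2 : 0 < ka ^+ 2 by rewrite exprn_gt0.
rewrite -(ler_pM2l k2).
apply: (@le_trans _ _ ((1 - r ^+ 2) * (4 * cabs (val (expi s) - z) ^+ 2))).
  by rewrite mulrCA ler_wpM2l// subr_ge0 expr_le1// ltW.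
apply: (@le_trans _ _ (8 * (1 - r) * cabs (val (expi s) - z) ^+ 2)).
  rewrite mulrA ler_wpM2r ?sqr_ge0//.
  have -> : (1 - r ^+ 2) * 4 = 4 * (1 + r) * (1 - r) by ring.
  by rewrite ler_wpM2r ?(ltW d0)//; lra.
have -> : ka ^+ 2 * ((2 + 32 / ka ^+ 2) * (1 - r) / 4 * cabs (val (expi s) - z) ^+ 2) =
    (ka ^+ 2 / 2 + 8) * (1 - r) * cabs (val (expi s) - z) ^+ 2.
  by field; rewrite gt_eqF.
rewrite ler_wpM2r ?sqr_ge0// ler_wpM2r ?(ltW d0)// lerDr.
by rewrite divr_ge0// ltW.
Qed.

End poisson_maximal.

(** * Continuity of functions on the circle *)

Section continuity_on_circle.
Variable R : realType.
Notation C := R[i].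
Notation Re := (@complex.Re _).
Notation Im := (@complex.Im _).
Notation val := (@circle_val R).
Implicit Types (u : circle R -> C).

Lemma circle_continuous (f : C -> C) (s : C) :
  (forall t, {for s * val t, continuous f}) -> continuous (fun t => f (s * val t)).
Proof.
move=> cf t; apply: (@continuous_comp _ _ _ val (fun z => f (s * z))).
  exact: circle_val_continuous.
apply: (@continuous_comp _ _ _ (fun z => s * z) f); last exact: cf.
by apply: cder_continuous; exact: (cderM (cder_cst _ _) (cder_id _)).
Qed.

Lemma continuous_Re u : continuous u -> continuous (fun t => Re (u t)).
Proof.
move=> cu t; have /(@cvg_cabs _ _ (nbhs t)) H := cu t.
apply/(@cvgrPdist_lt _ _ _ (nbhs t)) => e /H; apply: filterS => y; apply: le_lt_trans.
by rewrite distrC /= -ReN -ReD; exact: ler_Re_cabs.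
Qed.

Lemma continuous_cabs u : continuous u -> continuous (fun t => cabs (u t)).
Proof.
move=> cu t; have /(@cvg_cabs _ _ (nbhs t)) H := cu t.
apply/(@cvgrPdist_lt _ _ _ (nbhs t)) => e /H; apply: filterS => y; apply: le_lt_trans.
rewrite distrC ler_norml cabsD_dist andbT.
by rewrite lerNl opprB cabsB cabsD_dist.
Qed.

Lemma open_circle_gt (h : circle R -> R) (a : R) :
  continuous h -> open [set t | a < h t].
Proof.
move=> ch; have -> : [set t | a < h t] = h @^-1` `]a, +oo[%classic.
  by apply/seteqP; split => t /=; rewrite in_itv /= andbT.
by move/continuousP : ch; apply; exact: rray_open.
Qed.

End continuity_on_circle.

(** * Weak-type estimate for the radial maximal function *)

Section weak_type.
Variable R : realType.
Notation C := R[i].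
Notation Re := (@complex.Re _).
Notation Im := (@complex.Im _).
Notation leb := (@lebesgue_measure R).
Notation val := (@circle_val R).
Notation sigma := (@arc_length R : {measure set (circle R) -> \bar R}).

(** Turns distance from the point 1 into distance of the angle from both ends of [[0, 2 * pi]]. *)
Lemma chord1_le (x : R) : 0 <= x <= 2 * pi ->
  cabs (val (expi x) - 1) <= x /\ cabs (val (expi x) - 1) <= 2 * pi - x.
Proof.
move=> /andP[x0 x2]; have E1 : val (expi (0 : R)) = 1.
  by apply: complex_ext => /=; rewrite ?cos0 ?sin0.
have sin_le (y : R) : 0 <= y -> sin y <= y.
  move=> y0; have [|z _ E] := @MVT_segment R sin cos 0 y y0.
    by apply: continuous_subspaceT; exact: continuous_sin.
  by rewrite sin0 !subr0 in E; rewrite E ler_piMl// cos_le1.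
have := chordE x 0; rewrite E1 subr0 => E.
have s0 : 0 <= sin (x / 2) by apply: sin_ge0_pi; apply/andP; split; lra.
have -> : cabs (val (expi x) - 1) = 2 * sin (x / 2).
  apply/eqP; rewrite -(@eqrXn2 _ 2) ?cabs_ge0 ?mulr_ge0// E.
  by apply/eqP; ring.
split; first by have := sin_le (x / 2); lra.
have -> : sin (x / 2) = sin (pi - x / 2) by rewrite sinB sinpi cospi; lra.
by have := sin_le (pi - x / 2); lra.
Qed.

Section one_function.
Variables (mu : {finite_measure set (circle R) -> \bar R}) (D : set (circle R)) (c : R).
Hypotheses (mD : measurable D) (c0 : 0 <= c).

(** Being the real part of a holomorphic function, it obeys the mean value and Poisson formulas,
    unlike the modulus of [1 - singular_fun], which it still controls by [radial_gap_sqr]. *)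
Definition radial_gap z : R := 1 - Re (singular_fun mu D c z).
Notation k := radial_gap.

Lemma radial_gap_ge0 z : cabs z < 1 -> 0 <= k z.
Proof.
move=> z1; rewrite subr_ge0 (le_trans (ler_norm _))// (le_trans (ler_Re_cabs _))//.
exact: singular_fun_le1.
Qed.

Lemma radial_gap0 : k 0 = 1 - expR (- (c * fine (mu D))).
Proof. by rewrite /k singular_fun0. Qed.

(** With [S] the singular function, [|1 - S|^2 = 1 - 2 Re S + |S|^2] and [|S| <= 1]. *)
Lemma radial_gap_sqr z : cabs z < 1 -> cabs (1 - singular_fun mu D c z) ^+ 2 <= 2 * k z.
Proof.
move=> z1; have := singular_fun_le1 mu D c0 z1.
rewrite -(@ler_pXn2r _ 2) ?nnegrE ?cabs_ge0// expr1n !cabs_sqr /k.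
by case: (singular_fun _ _ _ _) => a b /=; nra.
Qed.

Lemma continuous_radial_gap (r : R) : 0 <= r < 1 ->
  continuous (fun t => k (r%:C * val t)).
Proof.
move=> /andP[r0 r1].
have -> : (fun t => k (r%:C * val t)) =
  fun t => Re ((fun z => 1 - singular_fun mu D c z) (r%:C * val t)).
  by apply/funext => t; rewrite /k ReD ReN.
apply: continuous_Re; apply: (@circle_continuous _ (fun z => 1 - singular_fun mu D c z)) => t.
apply: cder_continuous.
apply: (cderB (cder_cst _ _)); apply: derivable_singular_fun => //.
by rewrite cabs_scale.
Qed.

(** The dilation by [q < 1] supplies the holomorphy past the unit circle that [poisson_formula]
    requires. *)
Lemma poisson_radial_gap (q : R) z : 0 < q < 1 -> cabs z < 1 ->
  \int[leb]_(s in `[0, 2 * pi]%classic)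
    (poisson_kernel z (expi s) * k (q%:C * val (expi s))) = 2 * pi * k (q%:C * z).
Proof.
move=> /andP[q0 q1] z1.
pose f w := 1 - singular_fun mu D c (q%:C * w).
have qw w : cabs w < q^-1 -> cabs (q%:C * w) < 1.
  by rewrite cabsM cabs_real gtr0_norm// -ltr_pdivlMl// mulr1.
have df w : cabs w < q^-1 -> derivable f w 1.
  move=> wq; apply: (cderB (cder_cst _ _)).
  apply: (cder_comp (f := fun w => q%:C * w)).
    exact: (cderM (cder_cst _ _) (cder_id _)).
  exact: (@derivable_singular_fun _ mu _ mD c _ (qw _ wq)).
have fM w : cabs w < q^-1 -> cabs (f w) <= 2.
  move=> wq; apply: (le_trans (cabsD _ _)); rewrite cabs1 cabsN.
  by rewrite -[2]/(1 + 1) lerD2l singular_fun_le1// qw.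
have q1' : 1 < q^-1 by rewrite invf_gt1.
have Rf w : Re (f w) = k (q%:C * w) by rewrite /f ReD ReN.
have RM (x : R) (w : C) : Re (x%:C * w) = x * Re w by rewrite ReM /= mul0r subr0.
have /(congr1 Re) := poisson_formula q1' df fM z1.
rewrite RM Rf => <-.
have bk : bmf setT (fun t => k (q%:C * val t)).
  by apply: continuous_circle_bmf; apply: continuous_radial_gap; rewrite (ltW q0).
rewrite -(@integral_arc_length _ (fun t => poisson_kernel z t * k (q%:C * val t))).
  by apply: eq_Rintegral => t _; rewrite RM Rf.
by apply: bmfM => //; exact: poisson_kernel_bmf.
Qed.

Lemma integral_radial_gap (q : R) : 0 < q < 1 ->
  \int[leb]_(s in `[0, 2 * pi]%classic) k (q%:C * val (expi s)) = 2 * pi * k 0.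
Proof.
move=> q01; have := @poisson_radial_gap q 0 q01; rewrite cabs0 mulr0 => <-//.
apply: eq_Rintegral => s _; rewrite poisson_kernelE ?cabs0//.
by rewrite subr0 cabs_circle expr0n expr1n subr0 divr1 mul1r.
Qed.

Lemma HL_maximal_ball (g : R -> R) (th H : R) :
  bmf `[0, 2 * pi]%classic g -> (forall s, 0 <= s <= 2 * pi -> 0 <= g s) ->
  (HL_maximal (g \_ `[0%R, (2 * pi)%R]%classic) th <= H%:E)%E ->
  forall q, 0 < q -> \int[leb]_(s in `[0, 2 * pi]%classic `&` ball th q) g s <= 2 * q * H.
Proof.
move=> bg g0 HLH q q0.
have mI : measurable (`[0, 2 * pi]%classic : set (measurableTypeR R)) by exact: measurable_itv.
have mB : measurable (ball th q : set (measurableTypeR R)) by exact: measurable_ballR.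
have : (iavg (g \_ `[0%R, (2 * pi)%R]%classic) (ball th q) <= H%:E)%E.
  apply: le_trans HLH; apply: ereal_sup_ubound; exists q => //.
  by rewrite /= in_itv /= q0.
rewrite iavg_restrict// (lebesgue_measure_ball _ (ltW q0)).
rewrite inver mulrn_eq0 /= gt_eqF//.
have -> : (\int[leb]_(y in `[0%R, (2 * pi)%R] `&` ball th q) `|g y|%:E)%E =
    (\int[leb]_(s in `[0, 2 * pi]%classic `&` ball th q) g s)%:E.
  rewrite /Rintegral fineK.
    apply: eq_integral => s /set_mem[]; rewrite /= in_itv /= => /g0 gs _.
    by rewrite ger0_norm.
  apply: integrable_fin_num; first exact: measurableI.
  apply: bmf_integrable; first exact: measurableI.
    by apply: le_lt_trans (le_measure leb _ _ (@subIsetl _ _ _)) (segment_fin 0 (2 * pi));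
      rewrite inE//; exact: measurableI.
  exact: bmfS mI (@subIsetl _ _ _) bg.
rewrite -EFinM lee_fin ler_pdivrMl ?mulrn_wgt0// => /le_trans; apply.
by rewrite -[q *+ 2]mulr_natl.
Qed.

Lemma segment_norm1 (g : R -> R) :
  bmf `[0, 2 * pi]%classic g -> (forall s, 0 <= s <= 2 * pi -> 0 <= g s) ->
  (\int[leb]_s `|((g \_ `[0%R, (2 * pi)%R]%classic) s)%:E|)%E =
  (\int[leb]_(s in `[0, 2 * pi]%classic) g s)%:E.
Proof.
move=> bg g0; have mI : measurable (`[0, 2 * pi]%classic : set (measurableTypeR R)).
  exact: measurable_itv.
rewrite /Rintegral fineK; last first.
  by apply: integrable_fin_num => //; apply: bmf_integrable => //; exact: segment_fin.
rewrite [RHS]integral_mkcond; apply: eq_integral => s _.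
rewrite !patchE; case: ifPn => [/set_mem|_]; last by rewrite abse0.
by rewrite /= in_itv /= => /g0 gs; rewrite ger0_norm.
Qed.

Lemma radial_gap_circle_bmf (q : R) : 0 <= q < 1 ->
  bmf `[0, 2 * pi]%classic (fun s : R => k (q%:C * val (expi s))).
Proof.
move=> q01; have [mk [M kM]] := continuous_circle_bmf (continuous_radial_gap q01).
split; last by exists M => s _; exact: kM.
by apply: measurable_funTS; exact: (measurableT_comp mk (@measurable_expi R)).
Qed.

(** The cutoff [q] keeps the radii below the dilation parameter to which the Poisson formula is
    applied; [q = 1] is reached as an increasing union. *)
Definition radial_exceeds (q la : R) : set (circle R) :=
  [set t | exists r : R, 0 <= r < q /\ la < k (r%:C * val t)].

Lemma open_radial_exceeds (q la : R) : q <= 1 -> open (radial_exceeds q la).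
Proof.
move=> q1; have -> : radial_exceeds q la =
    \bigcup_(r in [set r : R | 0 <= r < q]) [set t | la < k (r%:C * val t)].
  by apply/seteqP; split => [t [r [rq kr]]|t [r rq kr]]; exists r.
apply: bigcup_open => r /andP[r0 rq]; apply: open_circle_gt.
by apply: continuous_radial_gap; rewrite r0 (lt_le_trans rq).
Qed.

End one_function.

Definition away_from1 (e : R) : set (circle R) := [set t | e < cabs (val t - 1)].

Lemma open_away_from1 (e : R) : open (away_from1 e).
Proof.
apply: open_circle_gt; apply: (@continuous_cabs _ (fun t => val t - 1)).
move=> t; apply: (@continuous_comp _ _ _ val (fun z => z - 1)).
  exact: circle_val_continuous.
by apply: cder_continuous; exact: (cderB (cder_id _) (cder_cst _ _)).
Qed.

(* The point 1, where the arc-length parametrization is cut, is avoided so that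
   the maximal function on the circle becomes one on the line. *)
Lemma radial_gap_weak_type (e : R) : 0 < e <= 1 -> exists2 B : R, 0 < B &
  forall mu D c la, measurable D -> 0 <= c -> 0 < la ->
  (sigma (away_from1 e `&` radial_exceeds mu D c 1 la) <=
    (B * radial_gap mu D c 0 / la)%:E)%E.
Proof.
move=> e01; have [B B0 HB] := poisson_kernel_maximal e01.
have pi0 := pi_gt0 R.
(* The 3 is the constant of [maximal_inequality]. *)
exists (3 * B) => [|mu D c la mD c0 la0]; first by rewrite mulr_gt0.
pose k := radial_gap mu D c.
pose rho n : R := 1 - n.+2%:R^-1.
have rho01 n : 0 < rho n < 1.
  rewrite subr_gt0 invf_lt1 ?ltr0n// ltr1n /= ltrBlDr ltrDl invr_gt0 ltr0n.
  by [].
pose V n := away_from1 e `&` radial_exceeds mu D c (rho n) la.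
have oV n : open (V n).
  apply: openI; first exact: open_away_from1.
  by apply: open_radial_exceeds => //; have /andP[_ /ltW] := rho01 n.
have mV n : measurable (V n) by exact: open_circle_measurable.
have VE : away_from1 e `&` radial_exceeds mu D c 1 la = \bigcup_n V n.
  apply/seteqP; split => t.
    move=> [te [r [/andP[r0 r1] kr]]].
    have r1' : 0 < 1 - r by rewrite subr_gt0.
    pose n := Num.truncn (1 - r)^-1.
    have Hn : (1 - r)^-1 < n.+2%:R.
      apply: (@lt_trans _ _ n.+1%:R); last by rewrite ltr_nat.
      by rewrite truncnS_gt// invr_ge0 ltW.
    exists n => //; split=> //; exists r; split=> //; rewrite r0 /rho /=.
    by rewrite ltrBrDl -ltrBrDr invf_plt ?posrE.
  move=> [n _ [te [r [/andP[r0 rn] kr]]]]; split=> //; exists r; split=> //.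
  by rewrite r0 (lt_trans rn)//; have /andP[] := rho01 n.
have bound n : (sigma (V n) <= (3 * B * k 0 / la)%:E)%E.
  pose g s := k ((rho n)%:C * val (expi s)).
  have /andP[q0 q1] := rho01 n.
  have q01 : 0 <= rho n < 1 by rewrite (ltW q0).
  have bg : bmf `[0, 2 * pi]%classic g by exact: radial_gap_circle_bmf.
  have g0 s : 0 <= s <= 2 * pi -> 0 <= g s.
    by move=> _; apply: radial_gap_ge0 => //; rewrite cabs_scale// ltW.
  (* At an angle where the maximal function is at most [a], the Poisson integral is at most
     [B * a = 2 * pi * la], so the gap does not exceed [la]. *)
  pose a := 2 * pi * la / B.
  have a0 : 0 < a by rewrite divr_gt0// !mulr_gt0.
  have lg : locally_integrable setT (g \_ `[0%R, (2 * pi)%R]%classic).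
    apply: integrable_locally; first exact: measurable_itv.
    apply: bmf_integrable => //; exact: segment_fin.
  have mHL : measurable ([set x | (a%:E < HL_maximal (g \_ `[0%R, (2 * pi)%R]%classic) x)%E]
      : set (measurableTypeR R)).
    rewrite -[X in measurable X]setTI; apply: emeasurable_fun_o_infty => //.
    exact: measurable_HL_maximal.
  have -> : (3 * B * k 0 / la)%:E = ((3 / a)%:E * (2 * pi * k 0)%:E)%E.
    rewrite -EFinM /a; congr (_%:E).
    move: (pi : R) pi0 (k 0) => p p0 k0.
    by field; rewrite !gt_eqF.
  have <- := @integral_radial_gap mu D c mD c0 (rho n) (rho01 n); rewrite -segment_norm1//.
  apply: le_trans (maximal_inequality lg a0).
  rewrite (_ : sigma (V n) = leb ((@expi R @^-1` V n) `&` `[0, 2 * pi[%classic))//.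
  apply: le_measure; rewrite ?inE//.
    apply: measurableI; last exact: measurable_itv.
    by rewrite -[X in measurable X]setTI; apply: measurable_expi.
  move=> th [[te [r [/andP[r0 rn] kr]]]]; rewrite /= in_itv /= => /andP[th0 th2] /=.
  rewrite ltNge; apply/negP => HLa.
  have th02 : 0 <= th <= 2 * pi by rewrite th0 ltW.
  have [c1 c2] := chord1_le th02; rewrite /away_from1 /= in te.
  (* The gap at radius [r] is the Poisson mean, taken at radius [r / rho n], of its values on the
     circle of radius [rho n]. *)
  have := HB g th (r / rho n) a bg g0 _ _ (ltW a0) (HL_maximal_ball bg g0 HLa).
  rewrite divr_ge0 ?(ltW q0)//= ltr_pdivrMr// mul1r rn => /(_ isT).
  have -> : e <= th <= 2 * pi - e by apply/andP; split; lra.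
  move=> /(_ isT).
  have z1 : cabs ((r / rho n)%:C * val (expi th)) < 1.
    by rewrite cabs_scale ?divr_ge0 ?(ltW q0)// ltr_pdivrMr// mul1r.
  rewrite poisson_radial_gap// mulrA -rmorphM /=.
  have -> : rho n * (r / rho n) = r by field; rewrite gt_eqF.
  have -> : B * a = 2 * pi * la by rewrite /a mulrC divfK// gt_eqF.
  rewrite leNgt => /negP; apply.
  by rewrite ltr_pM2l ?mulr_gt0.
rewrite VE.
have mU : measurable (\bigcup_n V n) by exact: bigcup_measurable.
have ndV : nondecreasing_seq V.
  move=> m n mn; apply/subsetPset => t [te [r [/andP[r0 rn] kr]]]; split=> //.
  exists r; split=> //; rewrite r0 (lt_le_trans rn)// lerD2l lerN2.
  by rewrite lef_pV2 ?posrE ?ltr0n// ler_nat !ltnS.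
have H := nondecreasing_cvg_mu mV mU ndV (mu := sigma).
rewrite -(cvg_lim _ H)//; apply: lime_le; first by apply/cvg_ex; eexists; exact: H.
by apply: nearW => n; exact: bound.
Qed.

End weak_type.

(** * Singular functions are inner *)

Section singular_inner.
Variable R : realType.
Notation C := R[i].
Notation Re := (@complex.Re _).
Notation Im := (@complex.Im _).
Notation leb := (@lebesgue_measure R).
Notation val := (@circle_val R).
Notation sigma := (@arc_length R : {measure set (circle R) -> \bar R}).

Lemma arc_length_at1 : sigma (~` away_from1 (0 : R)) = 0%E.
Proof.
have mZ : measurable (~` away_from1 (0 : R)).
  by apply: measurableC; apply: open_circle_measurable; exact: open_away_from1.
apply/eqP; rewrite eq_le measure_ge0 andbT -(@lebesgue_measure_set1 R 0).
rewrite (_ : sigma _ = leb ((@expi R @^-1` ~` away_from1 0) `&` `[0, 2 * pi[%classic))//.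
apply: le_measure; rewrite ?inE//.
  apply: measurableI; last exact: measurable_itv.
  by rewrite -[X in measurable X]setTI; apply: measurable_expi.
move=> th [/negP/=]; rewrite -leNgt => c0; rewrite /= in_itv /= => /andP[th0 th2].
apply/eqP; rewrite eq_le th0 andbT leNgt; apply/negP => th1.
have s0 : 0 < sin (th / 2) by apply: sin_gt0_pi; apply/andP; split; lra.
have E1 : val (expi (0 : R)) = 1 by apply: complex_ext => /=; rewrite ?cos0 ?sin0.
have := chordE th 0; rewrite E1 subr0.
have -> : cabs (val (expi th) - 1) = 0 by apply/eqP; rewrite eq_le c0 cabs_ge0.
rewrite expr0n /= => /esym/eqP; apply/negP; rewrite mulf_neq0// expf_neq0// gt_eqF//.
Qed.

Lemma exists_inv_lt (e : R) : 0 < e -> exists n : nat, n.+1%:R^-1 < e.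
Proof.
move=> e0; exists (Num.truncn e^-1).
by rewrite invf_plt ?posrE ?ltr0n// truncnS_gt// invr_ge0 ltW.
Qed.

Variables (mu : {finite_measure set (circle R) -> \bar R}) (D A : set (circle R)) (c : R).
Hypotheses (mD : measurable D) (mA : measurable A) (c0 : 0 <= c).
Hypotheses (muA : concentrated_on mu A) (sA : sigma A = 0%E).

Let inv n : R := n.+1%:R^-1.
Let inv0 n : 0 < inv n. Proof. by rewrite invr_gt0 ltr0n. Qed.
Let inv1 n : inv n <= 1. Proof. by rewrite invf_le1 ?ltr0n// ler1n. Qed.

(* For compact [K n] in the null set [A], the factor carried by [K n] has
   unimodular radial limits off [K n]; by the weak-type inequality the other
   factor stays radially close to 1 off a set of small length. *)
Lemma singular_fun_inner : inner_function (singular_fun mu D c).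
Proof.
split; first split.
- by move=> z /cabs_lt1; exact: derivable_singular_fun.
- by exists 1 => z /cabs_lt1 z1; rewrite normcE lecR; exact: singular_fun_le1.
have /choice[K HK] n := closed_inner_regular mu mA (inv0 n).
have mK n : measurable (K n) by have [cK _ _] := HK n; exact: closed_circle_measurable.
have mDK n : measurable (D `\` K n) by exact: measurableD.
pose V m j n := away_from1 (inv m) `&` radial_exceeds mu (D `\` K n) c 1 (inv j).
have mV m j n : measurable (V m j n).
  apply: open_circle_measurable; apply: openI; first exact: open_away_from1.
  exact: open_radial_exceeds.
(* Points where no [n] makes the factor off [K n] radially close to 1 within the level [inv j]. It
   lies in every [V m j n], whose length tends to 0 with the mass of [mu] off [K n]. *)
pose N m j := \bigcap_n V m j n.
have mN m j : measurable (N m j) by exact: bigcap_measurableType.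
have N0 m j : sigma (N m j) = 0%E.
  have [|B B0 HB] := @radial_gap_weak_type R (inv m); first by rewrite inv0 inv1.
  apply/eqP; rewrite eq_le measure_ge0 andbT.
  apply/lee_addgt0Pr => e e0; rewrite add0e.
  have [n Hn] : exists n : nat, inv n < e * inv j / (B * (c + 1)).
    by apply: exists_inv_lt; rewrite divr_gt0 ?mulr_gt0// ltr_wpDl.
  apply: (@le_trans _ _ (sigma (V m j n))).
    by apply: le_measure; rewrite ?inE//; exact: bigcap_inf.
  apply: (le_trans (HB mu _ c (inv j) (mDK n) c0 (inv0 j))); rewrite lee_fin.
  rewrite ler_pdivrMr// radial_gap0; last exact: mDK.
  (* Only the mass inside [A] counts, and [K n] nearly exhausts it. *)
  have tail : fine (mu (D `\` K n)) <= inv n.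
    rewrite -lee_fin fineK ?fin_num_measure//; have [_ _ /ltW] := HK n.
    apply: le_trans; rewrite (muA (mDK n)); apply: le_measure; rewrite ?inE.
    + exact: measurableI.
    + exact: measurableD.
    + by move=> t [At [_ Kt]].
  have h1 : 1 - expR (- (c * fine (mu (D `\` K n)))) <= c * inv n.
    have := expR_ge1Dx (- (c * fine (mu (D `\` K n)))).
    have := ler_wpM2l c0 tail; lra.
  apply: (le_trans (ler_wpM2l (ltW B0) h1)).
  have cB : 0 < B * (c + 1) by rewrite mulr_gt0// ltr_wpDl.
  move: Hn; rewrite ltr_pdivlMr// => /ltW; apply: le_trans.
  rewrite mulrA mulrC ler_wpM2l ?(ltW (inv0 n))// ler_wpM2l ?(ltW B0)//.
  by rewrite lerDl.
have negl : sigma.-negligible (A `|` ~` away_from1 0 `|` \bigcup_m \bigcup_j N m j).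
  apply: negligibleU; first apply: negligibleU.
  - exact/negligibleP.
  - apply/negligibleP; last exact: arc_length_at1.
    by apply: measurableC; apply: open_circle_measurable; exact: open_away_from1.
  - apply: negligible_bigcup => m; apply: negligible_bigcup => j.
    by apply/negligibleP; [exact: mN|exact: N0].
apply: negligibleS negl => t /= Pt; apply: contrapT => bad; apply: Pt.
have nA : ~ A t by move=> At; apply: bad; left; left.
have n1 : 0 < cabs (val t - 1).
  by rewrite ltNge; apply/negP => h; apply: bad; left; right; rewrite /away_from1 /= ltNge h.
have nN m j : ~ N m j t by move=> Nt; apply: bad; right; exists m => //; exists j.
have [m Hm] := exists_inv_lt n1.
apply: radial_limit_unimodular => e e0.
(* By [radial_gap_sqr] a gap of at most [e ^+ 2 / 32] puts the factor within [e / 4] of 1. *)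
have [j Hj] : exists j : nat, inv j < e ^+ 2 / 32.
  by apply: exists_inv_lt; rewrite divr_gt0// exprn_gt0.
have [n Vn] : exists n, ~ V m j n t.
  by apply: contrapT => H; apply: (nN m j) => n _; apply: contrapT => Vn; apply: H; exists n.
have tail r : 0 <= r -> r < 1 -> cabs (1 - singular_fun mu (D `\` K n) c (r%:C * val t)) <= e / 4.
  move=> r0 r1; have z1 : cabs (r%:C * val t) < 1 by rewrite cabs_scale.
  have kj : radial_gap mu (D `\` K n) c (r%:C * val t) <= inv j.
    by rewrite leNgt; apply/negP => kj; apply: Vn; split=> //; exists r; rewrite r0 r1.
  rewrite -(@ler_pXn2r _ 2) ?nnegrE ?cabs_ge0 ?divr_ge0 ?(ltW e0)//.
  apply: (le_trans (radial_gap_sqr mu (D `\` K n) c0 z1)).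
  have -> : (e / 4) ^+ 2 = e ^+ 2 / 16 by field.
  by move: (e ^+ 2) Hj => E Hj; lra.
have [cK KA _] := HK n.
have e2 : 0 < e / 2 by rewrite divr_gt0.
have [s [s0 s1 Hs]] := @singular_fun_off_support R mu (D `&` K n) (K n) c t (e / 2)
  (measurableI _ _ mD (mK n)) (@subIsetr _ _ _) cK (fun Kt => nA (KA t Kt)) c0 e2.
exists s => // r r' sr sr'; have [osc low] := Hs r r' sr sr'.
move: sr sr' => /andP[sr r1] /andP[sr' r1'].
have r0 : 0 <= r by rewrite (le_trans s0)// ltW.
have r0' : 0 <= r' by rewrite (le_trans s0)// ltW.
have z1 : cabs (r%:C * val t) < 1 by rewrite cabs_scale.
have z1' : cabs (r'%:C * val t) < 1 by rewrite cabs_scale.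
have split_z z : cabs z < 1 -> singular_fun mu D c z =
    singular_fun mu (D `&` K n) c z * singular_fun mu (D `\` K n) c z.
  exact: singular_fun_split.
rewrite !split_z//; have := tail r r0 r1; have := tail r' r0' r1'.
have := singular_fun_le1 mu (D `\` K n) c0 z1'.
have := singular_fun_le1 mu (D `&` K n) c0 z1.
have := singular_fun_le1 mu (D `\` K n) c0 z1.
move: osc low.
move: (singular_fun mu (D `&` K n) c (r%:C * val t)) (singular_fun mu (D `\` K n) c (r%:C * val t)).
move: (singular_fun mu (D `&` K n) c (r'%:C * val t))
  (singular_fun mu (D `\` K n) c (r'%:C * val t)).
move=> a' b' a b osc low b1 a1 b1' tb' tb; split.
  have -> : a * b - a' * b' = a * ((1 - b') - (1 - b)) + (a - a') * b' by ring.
  apply: (le_trans (cabsD _ _)); rewrite !cabsM.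
  have h1 : cabs a * cabs ((1 - b') - (1 - b)) <= e / 2.
    rewrite -[leRHS]mul1r ler_pM ?cabs_ge0//.
    by apply: (le_trans (cabsD _ _)); rewrite cabsN; lra.
  have h2 : cabs (a - a') * cabs b' <= e / 2.
    by rewrite -[leRHS]mulr1 ler_pM ?cabs_ge0.
  lra.
have lb : 1 - e / 4 <= cabs b by have := cabsD_dist 1 (1 - b); rewrite subKr cabs1; lra.
rewrite cabsM; have ab1 : cabs a * cabs b <= 1 by rewrite -[leRHS]mulr1 ler_pM ?cabs_ge0.
rewrite ger0_norm ?subr_ge0//.
(* This gives [|a| |b| >= |a| + |b| - 1]. *)
have : 0 <= (1 - cabs a) * (1 - cabs b) by rewrite mulr_ge0 ?subr_ge0.
lra.
Qed.

End singular_inner.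

(** * Alternative between mutual singularity and a comparable part *)

Section comparable_part.
Context d (T : measurableType d) (R : realType).
Local Open Scope ereal_scope.

(* Hahn decompositions of [mu1 - mu2 / (n + 1)] for all [n]. *)
Lemma mutually_singular_or_comparable (mu1 mu2 : {finite_measure set T -> \bar R}) :
  mutually_singular mu1 mu2 \/
  exists (E : set T) (e : R), [/\ measurable E, (0 < e <= 1)%R, 0 < mu2 E &
    forall F, measurable F -> F `<=` E -> e%:E * mu2 F <= mu1 F].
Proof.
pose nu n := cadd (charge_of_finite_measure mu1)
  (cscale (- n.+1%:R^-1) (charge_of_finite_measure mu2)).
have nuE n A : nu n A = mu1 A - (n.+1%:R^-1)%:E * mu2 A.
  transitivity (mu1 A + (- n.+1%:R^-1)%:E * mu2 A); first by [].
  by rewrite EFinN mulNe.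
have /choice[P /choice[N HPN]] : forall n, exists P, exists N, hahn_decomposition (nu n) P N.
  by move=> n; exact: Hahn_decomposition.
have mP n : measurable (P n) by have [[]] := HPN n.
have mN n : measurable (N n) by have [_ []] := HPN n.
(* On [NN] one has [mu1 <= mu2 / (n + 1)] for all [n], so [mu1] vanishes there. Hence either [mu2]
   vanishes on [PP], and the measures are mutually singular, or [mu2] charges some [P n]. *)
pose PP := \bigcup_n P n; pose NN := \bigcap_n N n.
have mPP : measurable PP by exact: bigcup_measurable.
have mNN : measurable NN by exact: bigcap_measurableType.
have PN0 : PP `&` NN = set0.
  rewrite -subset0 => t [[n _ Pt] Nt]; have [_ _ _ <-] := HPN n.
  by split=> //; exact: Nt.
have PNT : PP `|` NN = setT.
  apply/seteqP; split=> // t _; have [Pt|Pt] := pselect (PP t); [by left|right].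
  move=> n _; have [_ _ + _] := HPN n => /seteqP[_ /(_ t I)[Pnt|//]].
  by exfalso; apply: Pt; exists n.
have [P0|P0] := eqVneq (mu2 PP) 0; [left|right].
  have N0 : mu1 NN = 0.
    apply/eqP; rewrite eq_le measure_ge0 andbT; apply/lee_addgt0Pr => e e0; rewrite add0e.
    have m0 : (0 <= fine (mu2 NN))%R by exact: fine_ge0.
    have [n Hn] : exists n : nat, (n.+1%:R^-1 < e / (fine (mu2 NN) + 1))%R.
      by apply: exists_inv_lt; rewrite divr_gt0// ltr_wpDl.
    have [_ [_ neg] _ _] := HPN n.
    have : mu1 NN - (n.+1%:R^-1)%:E * mu2 NN <= 0.
      by rewrite -nuE; exact: neg NN mNN (@bigcap_inf _ _ n setT N I).
    rewrite leeBlDr ?fin_numM ?fin_num_measure// add0e => /le_trans; apply.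
    rewrite -(@fineK _ (mu2 NN)) ?fin_num_measure// -EFinM lee_fin.
    move: Hn; rewrite ltr_pdivlMr ?ltr_wpDl// => /ltW; apply: le_trans.
    by rewrite ler_wpM2l// lerDl.
  exists PP, NN; split=> // E mE.
    apply/eqP; rewrite eq_le; apply/andP; split; last first.
      by apply: le_measure; rewrite ?inE//; exact: measurableI.
    have {1}-> : E = (PP `&` E) `|` (NN `&` E) by rewrite -setIUl PNT setTI.
    apply: (le_trans (measureU2 _ _ _)); [exact: measurableI|exact: measurableI|].
    rewrite [X in _ + X](_ : _ = 0) ?adde0//; apply/eqP.
    rewrite eq_le measure_ge0 andbT -N0; apply: le_measure; rewrite ?inE//.
    exact: measurableI.
  apply/eqP; rewrite eq_le; apply/andP; split; last first.
    by apply: le_measure; rewrite ?inE//; exact: measurableI.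
  have {1}-> : E = (NN `&` E) `|` (PP `&` E) by rewrite -setIUl setUC PNT setTI.
  apply: (le_trans (measureU2 _ _ _)); [exact: measurableI|exact: measurableI|].
  rewrite [X in _ + X](_ : _ = 0) ?adde0//; apply/eqP.
  rewrite eq_le measure_ge0 andbT -P0; apply: le_measure; rewrite ?inE//.
  exact: measurableI.
have [n Pn] : exists n, mu2 (P n) != 0.
  apply: contrapT => H; move/negP : P0; apply; apply/eqP/negligibleP => //.
  apply: negligible_bigcup => n; apply/negligibleP => //.
  by apply: contrapT => /eqP Pn; apply: H; exists n.
exists (P n), (n.+1%:R^-1)%R; split=> //.
- by rewrite invr_gt0 ltr0n invf_le1 ?ltr0n// ler1n.
- by rewrite lt_neqAle eq_sym Pn measure_ge0.
move=> F mF FP; have [[_ pos] _ _ _] := HPN n.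
have : 0 <= mu1 F - (n.+1%:R^-1)%:E * mu2 F by rewrite -nuE; exact: pos F mF FP.
by rewrite sube_ge0// fin_numM ?fin_num_measure.
Qed.

End comparable_part.

(** * Divisors of singular functions; coprimality implies singularity *)

Section inner_functions.
Variable R : realType.
Notation C := R[i].
Notation Re := (@complex.Re _).
Notation val := (@circle_val R).
Notation sigma := (@arc_length R : {measure set (circle R) -> \bar R}).

Lemma inner_quotient (f g : C -> C) : inner_function f -> inner_function g ->
  (forall z, cabs z < 1 -> g z != 0) ->
  (forall z, cabs z < 1 -> cabs (f z) <= cabs (g z)) ->
  inner_function (fun z => f z / g z).
Proof.
move=> [[df _] lf] [[dg _] lg] g0 fg; split; first split.
- move=> z z1; apply: cderM; first exact: df.
  by apply: cderV; [apply: g0; exact/cabs_lt1|exact: dg].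
- exists 1 => z /cabs_lt1 z1; rewrite normcE lecR cabsM cabsV.
  by rewrite ler_pdivrMr ?mul1r ?fg// cabs_gt0 g0.
apply: filterS2 lf lg => t [a fa a1] [b gb b1].
exists (a / b); last by rewrite normrM normfV a1 b1 invr1 mulr1.
have b0 : b != 0 by rewrite -normr_eq0 b1 oner_eq0.
exact: (cvgM fa (cvgV b0 gb)).
Qed.

(** The circle has positive length, so a unimodular radial limit exists at some point, and it can
    only be [a]. *)
Lemma inner_constant (f : C -> C) (a : C) : inner_function f ->
  (forall z, cabs z < 1 -> f z = a) -> cabs a = 1.
Proof.
move=> [_ lf] fa.
have [t [l fl l1]] : exists t, exists2 l : C,
    f (r%:C * circle_val t) @[r --> (1 : R)^'-] --> l & `|l| = 1.
  apply: contrapT => H; have : sigma setT = 0%E.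
    apply/negligibleP => //; apply: negligibleS lf => t _ /=.
    by move=> [l fl l1]; apply: H; exists t, l.
  rewrite arc_lengthT => /eqP; rewrite eqe mulf_eq0 (gt_eqF (pi_gt0 R)) orbF.
  by rewrite pnatr_eq0.
have la : cabs l = cabs a.
  have : \forall r \near (1 : R)^'-, f (r%:C * val t) = a.
    apply: (@at_left_nearP _ _ 0) => // r /andP[r0 r1].
    by apply: fa; rewrite cabs_scale// ltW.
  move=> nf; congr cabs; apply/eqP; rewrite -subr_eq0; apply/eqP.
  apply: (@cabs_le_eps _ _ 1) => e e0; rewrite mul1r.
  move/(@cvg_cabs _ _ ((1 : R)^'-)) : fl => /(_ _ e0) fl.
  have [r [fr fla]] : exists r, f (r%:C * val t) = a /\ cabs (f (r%:C * val t) - l) < e.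
    near ((1 : R)^'-) => r; exists r; split; near: r; [exact: nf|exact: fl].
  by rewrite cabsB -fr ltW.
by apply: complexI; rewrite -la -normcE l1.
Unshelve. all: by end_near. Qed.

Lemma le_poisson_integral (mu1 mu2 : {finite_measure set (circle R) -> \bar R})
    (E : set (circle R)) (e : R) z : measurable E -> 0 <= e -> cabs z < 1 ->
  (forall F, measurable F -> F `<=` E -> (e%:E * mu2 F <= mu1 F)%E) ->
  e * \int[mu2]_(t in E) poisson_kernel z t <= \int[mu1]_t poisson_kernel z t.
Proof.
move=> mE e0 z1 mu12.
have bP := poisson_kernel_bmf z1.
have bPE : bmf E (poisson_kernel z) by exact: bmfS bP.
have P0 t : 0 <= poisson_kernel z t by exact: poisson_kernel_ge0.
have mP : measurable_fun setT (EFin \o poisson_kernel z).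
  by apply/measurable_EFinP; have [] := bP.
rewrite -lee_fin EFinM /Rintegral !fineK; last 2 first.
- by apply: integrable_fin_num => //; apply: bmf_integrable => //; exact: finite_measure_lty.
- by apply: integrable_fin_num => //; apply: bmf_integrable => //; exact: finite_measure_lty.
pose m := mscale (NngNum e0) (mrestr mu2 mE).
apply: (@le_trans _ _ (\int[m]_(t in E) (poisson_kernel z t)%:E)%E).
  rewrite ge0_integral_mscale//.
  - have -> : (\int[mrestr mu2 mE]_(t in E) (poisson_kernel z t)%:E =
        \int[mu2]_(t in E) (poisson_kernel z t)%:E)%E.
      apply: eq_measure_integral => A mA AE.
      by transitivity (mu2 (A `&` E)); [|rewrite (setIidl AE)].
    exact: lexx.
  - exact: measurable_funTS.
  - by move=> t _; rewrite lee_fin.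
apply: (@le_trans _ _ (\int[mu1]_(t in E) (poisson_kernel z t)%:E)%E).
  apply: ge0_le_measure_integral => //.
  - move=> S mS; rewrite (_ : _ S = e%:E * mu2 (S `&` E))%E//.
    apply: (le_trans (mu12 _ _ _)); [exact: measurableI|exact: subIsetr|].
    by apply: le_measure; rewrite ?inE//; exact: measurableI.
by apply: ge0_subset_integral => // t _; rewrite lee_fin.
Qed.

(** Used with [nu := mu2] for both functions: once with [mu := mu1], once with [mu := mu2]. *)
Lemma singular_divisor (theta : C -> C)
    (mu nu : {finite_measure set (circle R) -> \bar R})
    (A B E : set (circle R)) (e : R) : measurable A -> measurable B -> measurable E ->
  concentrated_on mu A -> sigma A = 0%E -> concentrated_on nu B -> sigma B = 0%E ->
  0 <= e ->
  (forall F, measurable F -> F `<=` E -> (e%:E * nu F <= mu F)%E) ->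
  (forall z, cabs z < 1 -> theta z = singular_fun mu setT 1 z) ->
  inner_divisor (singular_fun nu E e) theta.
Proof.
move=> mA mB mE muA sA nuB sB e0 numu thE.
have iN : inner_function (singular_fun nu E e) by exact: (singular_fun_inner mE mB).
split=> //; exists (fun z => singular_fun mu setT 1 z / singular_fun nu E e z).
  apply: inner_quotient => //.
  - exact: (singular_fun_inner measurableT mA).
  - by move=> z _; exact: singular_fun_neq0.
  - move=> z z1; rewrite !cabs_singular_fun ler_expR lerN2 mul1r !Re_herglotz.
    exact: le_poisson_integral.
move=> z /cabs_lt1 z1; rewrite thE// mulrC divfK//; exact: singular_fun_neq0.
Qed.

(** A constant value would be unimodular by [inner_constant], whereas the value at 0 is
    [exp (- e nu(E)) < 1]. *)
Lemma singular_fun_not_constant (nu : {finite_measure set (circle R) -> \bar R})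
    (E : set (circle R)) (e : R) :
  0 < e -> measurable E -> (0 < nu E)%E -> inner_function (singular_fun nu E e) ->
  ~ constant_on_disk (singular_fun nu E e).
Proof.
move=> e0 mE nuE iN [a Ha].
have a1 : cabs a = 1 by apply: (inner_constant iN) => z /cabs_lt1; exact: Ha.
have := singular_fun0 nu mE e; rewrite Ha; last by apply/cabs_lt1; rewrite cabs0.
move=> aE; move: a1; rewrite aE cabs_real ger0_norm ?expR_ge0//.
rewrite -expR0 => /expR_inj/eqP; rewrite oppr_eq0; apply/negP.
rewrite lt0r_neq0// mulr_gt0// fine_gt0// nuE.
by rewrite ltey_eq fin_num_measure.
Qed.

Lemma coprime_mutually_singular (theta1 theta2 : C -> C)
    (mu1 mu2 : {finite_measure set (circle R) -> \bar R}) :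
  singular_inner_with theta1 mu1 -> singular_inner_with theta2 mu2 ->
  coprime_inner theta1 theta2 -> mutually_singular mu1 mu2.
Proof.
move=> [[A1 [B1 [mA1 mB1 AB1 muA1 sB1]]] th1] [[A2 [B2 [mA2 mB2 AB2 muA2 sB2]]] th2] cop.
have null A B : measurable A -> A `&` B = set0 ->
    concentrated_on (@arc_length R) B -> sigma A = 0%E.
  move=> mA AB sB; have := sB A mA; rewrite setIC AB => sA.
  transitivity (sigma (set0 : set (circle R))); last exact: measure0.
  exact: sA.
have thE (theta : C -> C) (mu : {finite_measure set (circle R) -> \bar R}) :
  (forall z, unit_disk R z -> theta z = cexp (- cintegral mu (fun t : circle R =>
    (circle_val t + z) / (circle_val t - z)))) ->
  forall z, cabs z < 1 -> theta z = singular_fun mu setT 1 z.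
  by move=> H z /cabs_lt1 /H ->; rewrite /singular_fun mul1r.
have [//|[E [e [mE /andP[e0 e1] muE cmp]]]] := mutually_singular_or_comparable mu1 mu2.
exfalso; apply: cop; exists (singular_fun mu2 E e); split.
- by apply: (singular_divisor mA1 mA2 mE muA1 (null _ _ mA1 AB1 sB1) muA2
    (null _ _ mA2 AB2 sB2) (ltW e0) cmp); exact: thE.
- apply: (singular_divisor mA2 mA2 mE muA2 (null _ _ mA2 AB2 sB2) muA2
    (null _ _ mA2 AB2 sB2) (ltW e0)); last exact: thE.
  (* Here [mu2] is compared with itself, and [e <= 1] is what is needed. *)
  move=> F mF FE; rewrite -[leRHS]mul1e lee_wpmul2r// ?measure_ge0//.
- apply: singular_fun_not_constant => //.
  exact: (singular_fun_inner mE mA2 (ltW e0) muA2 (null _ _ mA2 AB2 sB2)).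
Qed.

End inner_functions.

(** * Bounds for inner functions and Lipschitz estimates *)

Section inner_bounds.
Variable R : realType.
Notation C := R[i].
Notation Re := (@complex.Re _).
Notation Im := (@complex.Im _).
Notation val := (@circle_val R).
Notation sigma := (@arc_length R : {measure set (circle R) -> \bar R}).

Lemma bounded_convergence d (T : measurableType d) (mu : {measure set T -> \bar R})
    (D : set T) (f_ : nat -> T -> R) (f : T -> R) (M : R) :
  measurable D -> (mu D < +oo)%E ->
  (forall n, measurable_fun D (f_ n)) -> measurable_fun D f ->
  (forall n x, D x -> `|f_ n x| <= M) ->
  {ae mu, forall x, D x -> f_ n x @[n --> \oo] --> f x} ->
  \int[mu]_(x in D) f_ n x @[n --> \oo] --> \int[mu]_(x in D) f x.
Proof.
move=> mD fD mf_ mf fM ff.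
have iM : mu.-integrable D (EFin \o (fun=> M)) by apply: bmf_integrable => //; exact: bmf_cst.
have [|||||i1 _] := @dominated_convergence _ _ _ mu D mD (fun n => EFin \o f_ n) (EFin \o f)
  (EFin \o (fun=> M)).
- by move=> n; exact/measurable_EFinP.
- exact/measurable_EFinP.
- apply: filterS ff => x ff Dx; apply: cvg_EFin; last exact: ff.
  by apply: nearW.
- by [].
- by apply: aeW => x n Dx; rewrite /= lee_fin fM.
move=> H; apply: fine_cvg; rewrite fineK; last exact: integrable_fin_num.
exact: H.
Qed.

(* Rotating the integral to the positive real axis. *)
Lemma cint_norm_sharp d (T : measurableType d) (mu : {measure set T -> \bar R})
    (D : set T) (u : T -> C) (G : T -> R) : measurable D -> (mu D < +oo)%E ->
  cbmf D u -> bmf D G -> (forall x, D x -> cabs (u x) <= G x) ->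
  cabs (cint mu D u) <= \int[mu]_(x in D) G x.
Proof.
move=> mD fD bu bG uG; set I := cint mu D u.
have [I0|I0] := eqVneq (cabs I) 0.
  by rewrite I0; apply: Rintegral_ge0 => x /uG; apply: le_trans; exact: cabs_ge0.
have Ip : 0 < cabs I by rewrite lt_def I0 cabs_ge0.
rewrite -(ler_pM2l Ip) -expr2.
have -> : cabs I ^+ 2 = Re (I^*%C * I).
  by rewrite cabs_sqr; case: I {I0 Ip} => a b /=; ring.
rewrite -cintZ// -(RintZ mD)//.
have bIu : cbmf D (fun x => I^*%C * u x) by apply: cbmfM => //; exact: cbmf_cst.
apply: Rint_le => //; first by have [] := bIu.
  by apply: bmfM => //; exact: bmf_cst.
move=> x Dx; apply: (le_trans (ler_norm _)); apply: (le_trans (ler_Re_cabs _)).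
by rewrite cabsM cabs_conj ler_wpM2l ?uG// ltW.
Qed.

(** Dominated convergence is sequential, so radii run through a sequence; [n.+2] keeps the first one
    positive. *)
Definition radius_seq n : R := 1 - n.+2%:R^-1.

Lemma radius_seq_bounds n : 0 < radius_seq n < 1.
Proof.
rewrite /radius_seq subr_gt0 invf_lt1 ?ltr0n// ltr1n /=.
by rewrite ltrBlDr ltrDl invr_gt0 ltr0n.
Qed.

Lemma radius_seq_ge (s : R) : s < 1 -> exists N, forall n, (N <= n)%N -> s < radius_seq n.
Proof.
move=> s1; have [N HN] := exists_inv_lt (etrans (subr_gt0 _ _) s1).
exists N => n Nn; rewrite /radius_seq ltrBrDl -ltrBrDr.
apply: le_lt_trans HN; rewrite lef_pV2 ?posrE ?ltr0n// ler_nat.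
by rewrite ltnS (leq_trans Nn).
Qed.

Lemma radius_seq_cvg (f : R -> C) (l : C) : f r @[r --> (1 : R)^'-] --> l ->
  f (radius_seq n) @[n --> \oo] --> l.
Proof.
move=> /(@cvg_cabs _ _ ((1 : R)^'-)) H; apply/cvg_cabs => e /H [d /= d0 Hd].
have [|N HN] := @radius_seq_ge (1 - d); first by rewrite gtrBl.
exists N => // n /= /HN nd; apply: Hd; last by have /andP[] := radius_seq_bounds n.
have /andP[_ n1] := radius_seq_bounds n.
by rewrite /ball /= gtr0_norm ?subr_gt0// ltrBlDl -ltrBlDr.
Qed.

Lemma dilate_cder (f : C -> C) (q : R) w : (forall z, cabs z < 1 -> derivable f z 1) ->
  0 < q -> cabs w < q^-1 -> derivable (fun w => f (q%:C * w)) w 1.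
Proof.
move=> df q0 wq; apply: (cder_comp (f := fun w => q%:C * w)).
  exact: (cderM (cder_cst _ _) (cder_id _)).
by apply: df; rewrite cabsM cabs_real gtr0_norm// -ltr_pdivlMl// mulr1.
Qed.

Lemma dilate_lt1 (q : R) w : 0 < q -> cabs w < q^-1 -> cabs (q%:C * w) < 1.
Proof. by move=> q0 wq; rewrite cabsM cabs_real gtr0_norm// -ltr_pdivlMl// mulr1. Qed.

Lemma inner_derivable (f : C -> C) z : inner_function f -> cabs z < 1 -> derivable f z 1.
Proof. by move=> [[df _] _] /cabs_lt1; exact: df. Qed.

(** In the Poisson formula for the dilates of [f], bounded convergence replaces [|f|] by its radial
    limit 1, and the kernel has mass [2 * pi]. The constant 1 of [cint_norm_sharp] is essential
    here. *)
Lemma inner_le1 (f : C -> C) z : inner_function f -> cabs z < 1 -> cabs (f z) <= 1.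
Proof.
move=> fI z1; have pi0 := pi_gt0 R.
have df w : cabs w < 1 -> derivable f w 1 by exact: inner_derivable.
have [[_ [M fM']] lf] := fI.
have fM w : cabs w < 1 -> cabs (f w) <= M.
  by move=> /cabs_lt1 /fM'; rewrite normcE lecR.
have M0 : 0 <= M by apply: le_trans (fM 0 _); rewrite ?cabs0// cabs_ge0.
have bP := poisson_kernel_bmf z1.
have P0 t : 0 <= poisson_kernel z t by exact: poisson_kernel_ge0.
pose h n t := poisson_kernel z t * cabs (f ((radius_seq n)%:C * val t)).
have cf n : continuous (fun t => f ((radius_seq n)%:C * val t)).
  have /andP[q0 q1] := radius_seq_bounds n.
  by apply: circle_continuous => t; apply: cder_continuous; apply: df; rewrite cabs_scale ?ltW.
have bf n : bmf setT (fun t => cabs (f ((radius_seq n)%:C * val t))).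
  by apply: continuous_circle_bmf; exact: continuous_cabs.
have bh n : bmf setT (h n) by exact: bmfM.
have ineq n : 2 * pi * cabs (f ((radius_seq n)%:C * z)) <= \int[sigma]_t h n t.
  have /andP[q0 q1] := radius_seq_bounds n.
  have q1' : 1 < (radius_seq n)^-1 by rewrite invf_gt1.
  have := @poisson_formula _ (fun w => f ((radius_seq n)%:C * w)) _ M z q1'
    (fun w wq => dilate_cder df q0 wq) (fun w wq => fM _ (dilate_lt1 q0 wq)) z1.
  move=> /(congr1 (@cabs R)); rewrite cabsM cabs_real gtr0_norm ?mulr_gt0//.
  move=> <-; apply: cint_norm_sharp => //; first exact: fin_arc_length.
    by apply: cbmfM; [exact: poisson_kernel_cbmf|exact: continuous_circle_cbmf].
  by move=> t _; rewrite cabsM cabs_real ger0_norm.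
have lim1 : \int[sigma]_t h n t @[n --> \oo] --> 2 * pi.
  rewrite -(int_poisson_kernel z1).
  have [mP [B PB]] := bP.
  apply: (@bounded_convergence _ _ sigma setT h _ (B * M)) => //.
  - exact: fin_arc_length.
  - by move=> n; have [] := bh n.
  - move=> n t _; have /andP[q0 q1] := radius_seq_bounds n.
    rewrite normrM ler_pM ?PB// ger0_norm ?cabs_ge0// fM//.
    by rewrite cabs_scale// ltW.
  - apply: filterS lf => t [l fl l1] _.
    have := radius_seq_cvg fl => fl'.
    have l1' : cabs l = 1 by apply: complexI; rewrite -normcE l1.
    rewrite -[X in _ --> X]mulr1; apply: cvgMr; rewrite -l1'.
    apply/cvgrPdist_lt => e e0; move/cvg_cabs : fl' => /(_ e e0).
    apply: filterS => n; apply: le_lt_trans.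
    rewrite distrC ler_norml cabsD_dist andbT.
    by rewrite lerNl opprB cabsB cabsD_dist.
have lim2 : 2 * pi * cabs (f ((radius_seq n)%:C * z)) @[n --> \oo] --> 2 * pi * cabs (f z).
  apply: cvgMr; apply/cvgrPdist_lt => e e0.
  have /cder_continuous/continuous_cabsP/(_ e e0)[d d0 Hd] := df z z1.
  have [|N HN] := @radius_seq_ge (1 - d); first by rewrite gtrBl.
  exists N => // n /= /HN nd; have /andP[q0 q1] := radius_seq_bounds n.
  apply: (@le_lt_trans _ _ (cabs (f ((radius_seq n)%:C * z) - f z))).
    rewrite distrC ler_norml cabsD_dist andbT.
    by rewrite lerNl opprB cabsB cabsD_dist.
  apply: Hd; have -> : (radius_seq n)%:C * z - z = - ((1 - radius_seq n)%:C * z).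
    by move: (radius_seq n) => q; rewrite rmorphB /=; ring.
  rewrite cabsN cabsM cabs_real gtr0_norm ?subr_gt0//.
  apply: (@le_lt_trans _ _ (1 - radius_seq n)); last by lra.
  by apply: ler_piMr; [rewrite subr_ge0 ltW|exact: ltW].
have : 2 * pi * cabs (f z) <= 2 * pi.
  by apply: (ler_cvg_to lim2 lim1); apply: nearW => n; exact: ineq.
by rewrite -[leRHS]mulr1 ler_pM2l// mulr_gt0.
Qed.

(** The Cauchy formulas at [z] and [z'] are subtracted; both denominators are at least [1 - s] in
    modulus. *)
Lemma cauchy_lipschitz (f : C -> C) (R0 M s : R) z z' : 1 < R0 ->
  (forall w, cabs w < R0 -> derivable f w 1) ->
  (forall w, cabs w < R0 -> cabs (f w) <= M) ->
  s < 1 -> cabs z <= s -> cabs z' <= s ->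
  cabs (f z - f z') <= M / (1 - s) ^+ 2 * cabs (z - z').
Proof.
move=> R1 df fM s1 zs z's; have pi0 := pi_gt0 R.
have z1 := le_lt_trans zs s1; have z'1 := le_lt_trans z's s1.
have df1 w : cabs w <= 1 -> derivable f w 1 by move=> w1; apply: df; exact: le_lt_trans R1.
have bf : cbmf setT (fun t => f (val t)).
  by apply: circle_cbmf1 => t; apply: df1; rewrite cabs_circle.
have bk w : cabs w < 1 -> cbmf setT (fun t => f (val t) * (val t / (val t - w))).
  move=> w1; apply: cbmfM => //.
  apply: (circle_cbmf1 (f := fun z => z / (z - w))) => t.
  by apply: derivable_cauchy_kernel; exact: disk_sub_neq0.
have cauchy w : cabs w < 1 ->
    cint sigma setT (fun t => f (val t) * (val t / (val t - w))) = (2 * pi)%:C * f w.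
  by move=> w1; rewrite cauchy_poisson// (poisson_formula R1 df fM w1).
have p2 : 0 < 2 * pi :> R by rewrite mulr_gt0.
rewrite -(ler_pM2l p2).
have -> : 2 * pi * cabs (f z - f z') = cabs ((2 * pi)%:C * f z - (2 * pi)%:C * f z').
  by rewrite -mulrBr cabsM cabs_real gtr0_norm.
rewrite -!cauchy// -cintB//; [|exact: fin_arc_length|exact: bk|exact: bk].
rewrite -int_circle_cst; apply: cint_norm_sharp => //.
- exact: fin_arc_length.
- by apply: cbmfB; exact: bk.
- exact: bmf_cst.
move=> t _; have tz := disk_sub_neq0 t z1; have tz' := disk_sub_neq0 t z'1.
have -> : f (val t) * (val t / (val t - z)) - f (val t) * (val t / (val t - z')) =
  f (val t) * (val t * (z - z') / ((val t - z) * (val t - z'))).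
  by field; rewrite tz tz'.
have ds w : cabs w <= s -> 1 - s <= cabs (val t - w).
  by move=> ws; apply: le_trans (cabsD_dist _ _); rewrite cabs_circle lerB.
have s0 : 0 < 1 - s by rewrite subr_gt0.
rewrite cabsM cabsM cabsV cabsM cabs_circle mul1r cabsM.
apply: (@le_trans _ _ (M * (cabs (z - z') / (1 - s) ^+ 2))).
  apply: ler_pM; rewrite ?cabs_ge0 ?divr_ge0 ?mulr_ge0 ?cabs_ge0//.
    by apply: fM; rewrite cabs_circle.
  rewrite ler_wpM2l ?cabs_ge0// lef_pV2 ?posrE ?mulr_gt0 ?exprn_gt0 ?cabs_gt0//.
  by rewrite expr2 ler_pM ?ds// ltW.
by rewrite mulrA mulrAC.
Qed.

End inner_bounds.

(** * Means of [ln |w|] for zero-free [w] *)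

Section reverse_jensen.
Variable R : realType.
Notation C := R[i].
Notation Re := (@complex.Re _).
Notation Im := (@complex.Im _).
Notation val := (@circle_val R).
Notation sigma := (@arc_length R : {measure set (circle R) -> \bar R}).

(** This is [ln x <= x - 1] at [x = |p|^2], because [|p|^2 - 1 = 2 Re (p - 1) + |p - 1|^2]. The
    first-order term is holomorphic in [p] up to taking the real part, and the error is
    quadratic. *)
Lemma ln_cabs_le (p : C) : p != 0 -> ln (cabs p) <= Re (p - 1) + cabs (p - 1) ^+ 2 / 2.
Proof.
move=> p0; have c0 : 0 < cabs p by rewrite cabs_gt0.
have l2 : ln (cabs p) *+ 2 <= cabs p ^+ 2 - 1.
  rewrite -lnXn//; have -> : cabs p ^+ 2 = 1 + (cabs p ^+ 2 - 1) by ring.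
  rewrite [leRHS]addrC addKr; apply: le_ln1Dx.
  by rewrite ltrBrDl subrr exprn_gt0.
have E : Re (p - 1) + cabs (p - 1) ^+ 2 / 2 = (cabs p ^+ 2 - 1) / 2.
  by rewrite !cabs_sqr; case: (p) => a b /=; field.
by rewrite E ler_pdivlMr// mulr_natr.
Qed.

Variables (w : C -> C) (s m : R).
Hypotheses (dw : forall z, cabs z < 1 -> derivable w z 1).
Hypotheses (w1 : forall z, cabs z < 1 -> cabs (w z) <= 1).
Hypotheses (s0 : 0 <= s) (s1 : s < 1) (m0 : 0 < m).
Hypothesis wm : forall z, cabs z <= s -> m <= cabs (w z).

Let w_neq0 z : cabs z <= s -> w z != 0.
Proof. by move=> /wm mz; rewrite -cabs_gt0 (lt_le_trans m0). Qed.

Let lipschitz : exists2 L : R, 0 <= L &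
  forall z z', cabs z <= s -> cabs z' <= s -> cabs (w z - w z') <= L * cabs (z - z').
Proof.
have [q [sq0 q1]] : exists q : R, s < q /\ q < 1.
  by exists ((s + 1) / 2); split; [exact: (midf_lt s1).1|exact: (midf_lt s1).2].
have q0 : 0 < q := le_lt_trans s0 sq0.
have q1' : 1 < q^-1 by rewrite invf_gt1.
have sq : s / q < 1 by rewrite ltr_pdivrMr// mul1r.
have qC0 : q%:C != 0 by rewrite -cabs_gt0 cabs_real gtr0_norm.
exists (1 / (1 - s / q) ^+ 2 / q).
  by rewrite !divr_ge0// ?exprn_ge0// ?subr_ge0 ltW.
move=> z z' zs zs'.
have sc u : cabs u <= s -> cabs (u / q%:C) <= s / q.
  by move=> us; rewrite cabsM cabsV cabs_real gtr0_norm// ler_pM2r// invr_gt0.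
have := @cauchy_lipschitz _ (fun z => w (q%:C * z)) q^-1 1 (s / q) (z / q%:C) (z' / q%:C)
  q1' (fun u uq => dilate_cder dw q0 uq) (fun u uq => w1 (dilate_lt1 q0 uq)) sq
  (sc _ zs) (sc _ zs').
have qK u : q%:C * (u / q%:C) = u by field.
rewrite !qK -mulrBl cabsM cabsV cabs_real gtr0_norm// => /le_trans; apply.
by rewrite le_eqVlt; apply/orP; left; apply/eqP; ring.
Qed.

Let a (r : R) := \int[sigma]_t ln (cabs (w (r%:C * val t))).

Let w_circle r : 0 <= r <= s -> continuous (fun t => w (r%:C * val t)).
Proof.
move=> /andP[r0 rs]; apply: circle_continuous => t; apply: cder_continuous; apply: dw.
by rewrite cabs_scale// (le_lt_trans rs).
Qed.

Let bmf_ln r : 0 <= r <= s -> bmf setT (fun t => ln (cabs (w (r%:C * val t)))).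
Proof.
move=> rs; apply: continuous_circle_bmf => t.
apply: (@continuous_comp _ _ _ (fun t => cabs (w (r%:C * val t))) (@ln R)).
  by apply: continuous_cabs; exact: w_circle.
apply: continuous_ln; rewrite cabs_gt0 w_neq0//.
by move: rs => /andP[r0 rs]; rewrite cabs_scale.
Qed.

(** [ln_cabs_le] is applied to the quotient [p], for which [|p - 1| <= L * |r' - r| / m] on the
    circle. *)
Let step (L r r' : R) : (forall z z', cabs z <= s -> cabs z' <= s ->
    cabs (w z - w z') <= L * cabs (z - z')) ->
  0 <= r <= s -> 0 <= r' <= s -> a r' - a r <= pi * (L * `|r' - r| / m) ^+ 2.
Proof.
move=> HL rs rs'; rewrite /a -RintB//; [|exact: fin_arc_length|exact: bmf_ln|exact: bmf_ln].
have sc u t : 0 <= u <= s -> cabs (u%:C * val t) <= s.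
  by move=> /andP[u0 us]; rewrite cabs_scale.
have lec u z : 0 <= u <= s -> cabs z <= 1 -> cabs (u%:C * z) <= s.
  move=> /andP[u0 us] z1; rewrite cabsM cabs_real ger0_norm//.
  by apply: le_trans us; rewrite ler_piMr.
pose p z := w (r'%:C * z) / w (r%:C * z).
have dp z : cabs z <= 1 -> derivable p z 1.
  have dd u : 0 <= u <= s -> cabs z <= 1 -> derivable (fun z => w (u%:C * z)) z 1.
    move=> us z1; apply: (cder_comp (f := fun z => u%:C * z)).
      exact: (cderM (cder_cst _ _) (cder_id _)).
    by apply: dw; apply: le_lt_trans s1; exact: lec.
  move=> z1; apply: cderM; first exact: dd.
  apply: (cderV (f := fun z => w (r%:C * z))); last exact: dd.
  by apply: w_neq0; exact: lec.
have bp : cbmf setT (fun t => p (val t)).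
  by apply: circle_cbmf1 => t; apply: dp; rewrite cabs_circle.
have := circle_mean_value ler01 dp; rewrite cint_unit.
have -> : p 0 = 1 by rewrite /p !mulr0 divff// w_neq0// cabs0.
move=> mv.
have mv0 : \int[sigma]_t Re (p (val t) - 1) = 0.
  have : cint sigma setT (fun t => p (val t) - 1) = 0.
    rewrite cintB//; [|exact: fin_arc_length|exact: cbmf_cst].
    by rewrite cint_circle_cst mv subrr.
  by move=> /(congr1 Re).
have bq : bmf setT (fun t => Re (p (val t) - 1)).
  have : cbmf setT (fun t => p (val t) - 1) by apply: cbmfB => //; exact: cbmf_cst.
  by case.
pose K := (L * `|r' - r| / m) ^+ 2 / 2.
have -> : pi * (L * `|r' - r| / m) ^+ 2 =
    \int[sigma]_t (Re (p (val t) - 1) + K).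
  rewrite RintD//; [|exact: fin_arc_length|exact: bmf_cst].
  rewrite mv0 add0r int_circle_cst /K; move: (pi : R) (_ ^+ 2) => x y; by field.
apply: Rint_le => //; first exact: fin_arc_length.
- by apply: bmfB; exact: bmf_ln.
- by apply: bmfD => //; exact: bmf_cst.
move=> t _; have y0 := w_neq0 (sc _ t rs); have x0 := w_neq0 (sc _ t rs').
rewrite -ln_div ?posrE ?cabs_gt0// -cabsV -cabsM.
have p0 : w (r'%:C * val t) / w (r%:C * val t) != 0 by rewrite mulf_neq0// invr_eq0.
apply: (le_trans (ln_cabs_le p0)); rewrite lerD2l ler_pM2r ?invr_gt0//.
rewrite ler_pXn2r ?nnegrE ?cabs_ge0//; last first.
  apply: divr_ge0; last exact: ltW.
  have := HL _ _ (sc _ t rs') (sc _ t rs).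
  by rewrite -mulrBl -rmorphB cabsM cabs_circle mulr1 cabs_real; apply: le_trans; exact: cabs_ge0.
have -> : w (r'%:C * val t) / w (r%:C * val t) - 1 =
  (w (r'%:C * val t) - w (r%:C * val t)) / w (r%:C * val t) by field.
rewrite cabsM cabsV; have := HL _ _ (sc _ t rs') (sc _ t rs).
rewrite -mulrBl -rmorphB cabsM cabs_circle mulr1 cabs_real => h1.
apply: ler_pM; rewrite ?cabs_ge0 ?invr_ge0 ?cabs_ge0//.
by rewrite lef_pV2 ?posrE ?cabs_gt0// wm// sc.
Qed.

(* Summing [step] over [N] equal radial increments leaves an error [O(1/N)].  In
   [step] the quotient [p] of two dilates of [w] equals 1 at 0, so the mean of
   [Re (p - 1)] vanishes: this replaces the harmonicity of [ln |w|] and avoids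
   taking a complex logarithm of [w]. *)
Lemma reverse_jensen :
  \int[sigma]_t ln (cabs (w (s%:C * val t))) <= 2 * pi * ln (cabs (w 0)).
Proof.
have [L L0 HL] := lipschitz.
have -> : 2 * pi * ln (cabs (w 0)) = a 0.
  by rewrite -int_circle_cst; apply: eq_Rintegral => t _; rewrite mul0r.
rewrite -/(a s) -subr_le0 leNgt; apply/negP => d0.
have pi0 := pi_gt0 R.
pose K := pi * (L * s / m) ^+ 2 : R.
have K0 : 0 <= K by rewrite mulr_ge0 ?sqr_ge0 ?(ltW pi0).
have [n Hn] : exists n : nat, n.+1%:R^-1 < (a s - a 0) / (K + 1).
  by apply: exists_inv_lt; rewrite divr_gt0// ltr_wpDl.
pose N : R := n.+1%:R; have N0 : 0 < N by rewrite ltr0n.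
have rk k : (k <= n.+1)%N -> 0 <= s * k%:R / N <= s.
  move=> kn; rewrite divr_ge0 ?mulr_ge0 ?(ltW N0)//= ler_pdivrMr//.
  by rewrite ler_wpM2l// ler_nat.
have tele k : (k <= n.+1)%N -> a (s * k%:R / N) - a 0 <= k%:R * (K / N ^+ 2).
  elim: k => [_|k IH kn]; first by rewrite mulr0 mul0r subrr mul0r.
  have := step HL (rk _ (ltnW kn)) (rk _ kn).
  have -> : s * k.+1%:R / N - s * k%:R / N = s / N.
    by rewrite -mulrBl -mulrBr -natrB// subSnn mulr1.
  rewrite ger0_norm ?divr_ge0 ?(ltW N0)//.
  have -> : pi * (L * (s / N) / m) ^+ 2 = K / N ^+ 2.
    by rewrite /K; move: (pi : R) => p; field; rewrite !gt_eqF.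
  move=> h; have := lerD h (IH (ltnW kn)); rewrite addrA subrK => /le_trans; apply.
  by rewrite -[X in X + _]mul1r -mulrDl nat1r.
have := tele n.+1 (leqnn _); rewrite -/N mulfK ?gt_eqF//.
have -> : N * (K / N ^+ 2) = K * N^-1 by field; rewrite gt_eqF.
apply/negP; rewrite -ltNge.
have K1 : 0 < K + 1 by rewrite ltr_wpDl.
move: Hn; rewrite (ltr_pdivlMr _ _ K1) -/N => h; apply: le_lt_trans h.
by rewrite [leRHS]mulrC ler_wpM2r ?invr_ge0 ?(ltW N0)// lerDl.
Qed.

End reverse_jensen.

(** * Finiteness of arc length and exchange of integrals *)

HB.instance Definition _ (R : realType) :=
  @Measure_isFinite.Build _ (circle R) R (@arc_length R)
    (lty_fin_num_fun (fin_arc_length R)).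

Lemma Rintegral_swap d1 d2 (T1 : measurableType d1) (T2 : measurableType d2) (R : realType)
    (m1 : {finite_measure set T1 -> \bar R}) (m2 : {finite_measure set T2 -> \bar R})
    (h : T1 * T2 -> R) : measurable_fun setT h -> (forall p, 0 <= h p) ->
  (forall x, bmf setT (fun y => h (x, y))) -> (forall y, bmf setT (fun x => h (x, y))) ->
  \int[m1]_x \int[m2]_y h (x, y) = \int[m2]_y \int[m1]_x h (x, y).
Proof.
move=> mh h0 b1 b2.
have f1 : (m1 setT < +oo)%E by rewrite ltey_eq fin_num_measure.
have f2 : (m2 setT < +oo)%E by rewrite ltey_eq fin_num_measure.
have E1 x : (\int[m2]_y h (x, y))%:E = (\int[m2]_y (h (x, y))%:E)%E.
  by rewrite /Rintegral fineK//; apply: integrable_fin_num => //; exact: bmf_integrable.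
have E2 y : (\int[m1]_x h (x, y))%:E = (\int[m1]_x (h (x, y))%:E)%E.
  by rewrite /Rintegral fineK//; apply: integrable_fin_num => //; exact: bmf_integrable.
rewrite /Rintegral; congr fine.
under eq_integral do rewrite -/(Rintegral _ _ _) E1.
under [RHS]eq_integral do rewrite -/(Rintegral _ _ _) E2.
apply: (@fubini_tonelli _ _ _ _ _ m1 m2 (EFin \o h)); first exact/measurable_EFinP.
by move=> p; rewrite /= lee_fin.
Qed.

(** * Symmetry of the Poisson kernel and Fubini *)

Section poisson_swap.
Variable R : realType.
Notation C := R[i].
Notation Re := (@complex.Re _).
Notation Im := (@complex.Im _).
Notation val := (@circle_val R).
Notation sigma := (@arc_length R).
Implicit Types (t tau : circle R) (V : set (circle R)).

Lemma cabs_scale_lt1 (r : R) t : 0 <= r < 1 -> cabs (r%:C * val t) < 1.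
Proof. by move=> /andP[r0 r1]; rewrite cabs_scale. Qed.

(** Exhibits both the symmetry in [t] and [tau] and the joint measurability; the inverse is a real
    power so that [measurable_powR] applies. *)
Lemma poisson_kernel_radial (r : R) t tau : 0 <= r < 1 ->
  poisson_kernel (r%:C * val tau) t = (1 - r ^+ 2) *
    (1 + r ^+ 2 - 2 * r * (Re (val t) * Re (val tau) + Im (val t) * Im (val tau))) `^ (-1).
Proof.
move=> r01; have r1 := cabs_scale_lt1 tau r01.
have E : cabs (val t - r%:C * val tau) ^+ 2 =
    1 + r ^+ 2 - 2 * r * (Re (val t) * Re (val tau) + Im (val t) * Im (val tau)).
  have := cabs_sqr (val t); have := cabs_sqr (val tau); rewrite !cabs_circle expr1n.
  rewrite cabs_sqr; case: (val t) (val tau) => a b [c d] /= cd ab.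
  have -> : r ^+ 2 = r ^+ 2 * (c ^+ 2 + d ^+ 2) by rewrite -cd mulr1.
  by rewrite {1}ab; ring.
rewrite poisson_kernelE// -E powR_inv1 ?sqr_ge0//.
by have /andP[r0 _] := r01; rewrite cabs_scale.
Qed.

Lemma poisson_kernel_radialC (r : R) t tau : 0 <= r < 1 ->
  poisson_kernel (r%:C * val tau) t = poisson_kernel (r%:C * val t) tau.
Proof.
move=> r01; rewrite !poisson_kernel_radial//.
by rewrite [_ * Re (val t)]mulrC [_ * Im (val t)]mulrC.
Qed.

Lemma poisson_kernel_radial_measurable (r : R) : 0 <= r < 1 ->
  measurable_fun setT (fun p : circle R * circle R => poisson_kernel (r%:C * val p.1) p.2).
Proof.
move=> r01.
under eq_fun do rewrite poisson_kernel_radial//.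
have mre : measurable_fun setT (fun t => Re (val t)).
  by apply: continuous_circle_measurable; apply: continuous_Re; exact: circle_val_continuous.
have mim : measurable_fun setT (fun t => Im (val t)).
  have [_ [+ _]] : cbmf setT val by apply: continuous_circle_cbmf; exact: circle_val_continuous.
  by [].
apply: measurable_funM; first exact: measurable_cst.
apply: (measurableT_comp (measurable_powR _)).
apply: measurable_funB; first exact: measurable_cst.
apply: measurable_funM; first exact: measurable_cst.
apply: measurable_funD; apply: measurable_funM.
- exact: (measurableT_comp mre measurable_snd).
- exact: (measurableT_comp mre measurable_fst).
- exact: (measurableT_comp mim measurable_snd).
- exact: (measurableT_comp mim measurable_fst).
Qed.

Variable mu : {finite_measure set (circle R) -> \bar R}.

Lemma Re_herglotz_bmf (r : R) V : measurable V -> 0 <= r < 1 ->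
  bmf setT (fun t => Re (herglotz mu V (r%:C * val t))).
Proof.
move=> mV r01; apply: continuous_circle_bmf; apply: continuous_Re.
apply: circle_continuous => t; apply: cder_continuous.
by apply: derivable_herglotz => //; exact: cabs_scale_lt1.
Qed.

(** Trades the unknown boundary behaviour of the Poisson integral of [mu] for that of the Poisson
    integral of the indicator of [V], which is explicit away from [V]. *)
Lemma herglotz_swap (r : R) V : 0 <= r < 1 -> measurable V ->
  \int[sigma]_(t in V) Re (herglotz mu setT (r%:C * val t)) =
  \int[mu]_tau Re (herglotz sigma V (r%:C * val tau)).
Proof.
move=> r01 mV.
pose h (p : circle R * circle R) : R := poisson_kernel (r%:C * val p.1) p.2 * \1_V p.1.
have mh : measurable_fun setT h.
  apply: measurable_funM; first exact: poisson_kernel_radial_measurable.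
  by apply: (measurableT_comp _ measurable_fst); exact: measurable_indic.
have h0 p : 0 <= h p.
  by rewrite mulr_ge0 ?poisson_kernel_ge0 ?cabs_scale_lt1// indicE.
have bP t : bmf setT (poisson_kernel (r%:C * val t)).
  by apply: poisson_kernel_bmf; exact: cabs_scale_lt1.
rewrite Rintegral_mkcond patch_indic.
transitivity (\int[sigma]_t \int[mu]_tau h (t, tau)).
  apply: eq_Rintegral => t _; rewrite /h [LHS]mulrC.
  transitivity (\1_V t * \int[mu]_tau poisson_kernel (r%:C * val t) tau); first by [].
  rewrite -(RintZ measurableT (finite_measure_lty mu measurableT) (\1_V t) (bP t)).
  by apply: eq_Rintegral => tau _; rewrite mulrC.
rewrite (Rintegral_swap _ _ mh h0); rewrite /h.
- apply: eq_Rintegral => tau _.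
  transitivity (\int[sigma]_(t in V) poisson_kernel (r%:C * val tau) t); last by [].
  rewrite [RHS]Rintegral_mkcond patch_indic; apply: eq_Rintegral => t _.
  by rewrite poisson_kernel_radialC.
- by move=> t; apply: (bmfM (bP t)); exact: (bmf_cst _ (\1_V t)).
- move=> tau; apply: bmfM; last exact: bmf_indic.
  rewrite (_ : (fun _ => _) = poisson_kernel (r%:C * val tau))//.
  by apply/funext => t; rewrite poisson_kernel_radialC.
Qed.

End poisson_swap.

(** * Poisson integrals away from the bulk of the measure *)

Section poisson_concentration.
Variable R : realType.
Notation C := R[i].
Notation Re := (@complex.Re _).
Notation val := (@circle_val R).
Notation sigma := (@arc_length R).
Variable mu : {finite_measure set (circle R) -> \bar R}.
Variables K V : set (circle R).
Hypotheses (cK : closed K) (mV : measurable V).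
Hypothesis KV : forall tau, K tau ->
  exists2 d : R, 0 < d & forall t, V t -> d <= cabs (val t - val tau).

(** [2 * pi] times the harmonic measure of [V] seen from the point [r tau]. *)
Let G (r : R) tau := Re (herglotz sigma V (r%:C * val tau)).

Let bmf_G r : 0 <= r < 1 -> bmf setT (G r).
Proof. by move=> r01; exact: Re_herglotz_bmf. Qed.

Let G_ge0 r tau : 0 <= r < 1 -> 0 <= G r tau.
Proof. by move=> r01; apply: Re_herglotz_ge0 => //; exact: cabs_scale_lt1. Qed.

Let G_le r tau : 0 <= r < 1 -> G r tau <= 2 * pi.
Proof.
move=> r01; have r1 := cabs_scale_lt1 tau r01; have bP := poisson_kernel_bmf r1.
rewrite -(int_poisson_kernel r1) /G Re_herglotz Rintegral_mkcond patch_indic.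
apply: Rint_le => //; first exact: fin_arc_length.
  by apply: (bmfM bP); exact: bmf_indic.
move=> t _ /=; have P0 := poisson_kernel_ge0 t r1.
by rewrite indicE; case: (_ \in _); rewrite ?mulr1 ?mulr0.
Qed.

Let G_cvg0 tau : K tau -> G (radius_seq R n) tau @[n --> \oo] --> 0.
Proof.
move=> /KV[d d0 Vd]; apply/cvgrPdist_le => e e0.
have S0 : 0 <= fine (sigma V) by rewrite fine_ge0.
set S := fine (sigma V) in S0.
have S1 : 0 < S + 1 by rewrite ltr_wpDl.
(* When [1 - r < x], points of [V] are at distance at least [d / 2] from [r tau], so the kernel is
   at most [8 * x / d ^+ 2] on [V]. *)
have [x [x0 xd xe]] : exists x : R, [/\ 0 < x, x <= d / 2 & 8 * x / d ^+ 2 * S <= e].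
  exists (Num.min (d / 2) (e * d ^+ 2 / (8 * (S + 1)))); split.
  - by rewrite lt_min !divr_gt0 ?mulr_gt0 ?exprn_gt0.
  - by rewrite ge_min lexx.
  - apply: (@le_trans _ _ (8 * (e * d ^+ 2 / (8 * (S + 1))) / d ^+ 2 * S)).
      rewrite ler_wpM2r// ler_wpM2r ?invr_ge0 ?sqr_ge0// ler_wpM2l//.
      by rewrite ge_min lexx orbT.
    have -> : 8 * (e * d ^+ 2 / (8 * (S + 1))) / d ^+ 2 * S = e * (S / (S + 1)).
      by field; rewrite !gt_eqF.
    by rewrite ler_piMr ?(ltW e0)// ler_pdivrMr// mul1r lerDl.
have [|N HN] := @radius_seq_ge _ (1 - x); first by rewrite gtrBl.
exists N => // n /= /HN; have := radius_seq_bounds R n.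
move: (radius_seq R n) => r /andP[r0 r1] nd.
have r01 : 0 <= r < 1 by rewrite (ltW r0) r1.
have rt := cabs_scale_lt1 tau r01; have bP := poisson_kernel_bmf rt.
have mT := @measurableT _ (circle R).
rewrite sub0r normrN /G Re_herglotz; apply: le_trans xe.
apply: (Rint_norm_le mV (finite_measure_lty sigma mV)).
  exact: (bmfS mT _ bP).
move=> t Vt; rewrite ger0_norm ?poisson_kernel_ge0// poisson_kernelE//.
rewrite cabs_scale ?(ltW r0)//.
have dt : d / 2 <= cabs (val t - r%:C * val tau).
  have := Vd _ Vt; have -> : val t - val tau =
    (val t - r%:C * val tau) - (1 - r)%:C * val tau by rewrite rmorphB /=; ring.
  move=> /le_trans /(_ (cabsD _ _)); rewrite cabsN cabsM cabs_circle mulr1 cabs_real.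
  by rewrite gtr0_norm ?subr_gt0//; lra.
have -> : 8 * x / d ^+ 2 = (2 * x) * ((d / 2) ^+ 2)^-1 by field; rewrite gt_eqF.
apply: ler_pM.
- by rewrite subr_ge0 expr_le1// ltW.
- by rewrite invr_ge0 sqr_ge0.
- have -> : 1 - r ^+ 2 = (1 + r) * (1 - r) by ring.
  apply: ler_pM; lra.
have d2 : 0 < d / 2 by rewrite divr_gt0.
rewrite lef_pV2 ?posrE ?exprn_gt0 ?(lt_le_trans d2 dt)//.
by rewrite ler_pXn2r ?nnegrE ?(ltW d2)// cabs_ge0.
Qed.

(** After [herglotz_swap] the part over [K] tends to 0 by bounded convergence, so the distances in
    [KV] may depend on the point; off [K] the integrand is at most [2 * pi]. *)
Lemma poisson_integral_off_support (e : R) : 0 < e -> exists N, forall n, (N <= n)%N ->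
  \int[sigma]_(t in V) Re (herglotz mu setT ((radius_seq R n)%:C * val t)) <=
  2 * pi * fine (mu (~` K)) + e.
Proof.
move=> e0; have mK := closed_circle_measurable cK; have mK' := measurableC mK.
have r01 n : 0 <= radius_seq R n < 1.
  by have /andP[r0 r1] := radius_seq_bounds R n; rewrite (ltW r0) r1.
have : \int[mu]_(t in K) G (radius_seq R n) t @[n --> \oo] --> \int[mu]_(t in K) 0.
  apply: (@bounded_convergence _ _ _ _ _ _ _ (2 * pi)) => //.
  - exact: finite_measure_lty.
  - by move=> n; apply: measurable_funTS; have [] := bmf_G (r01 n).
  - by move=> n x _; rewrite ger0_norm ?G_ge0 ?G_le.
  - by apply: aeW => x; exact: G_cvg0.
rewrite Rintegral_cst// mul0r => /cvgrPdist_lt /(_ e e0)[N _ HN].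
exists N => n /HN; rewrite sub0r normrN => lte.
rewrite herglotz_swap// -(setUv K) Rintegral_setU//; last 2 first.
- by rewrite setUv; apply: bmf_integrable => //; [exact: finite_measure_lty|exact: bmf_G].
- by apply/disj_setPS => t [].
rewrite addrC lerD//; last by apply: ltW; apply: le_lt_trans lte; exact: ler_norm.
apply: (le_trans (ler_norm _)).
apply: (Rint_norm_le mK' (finite_measure_lty mu mK')).
  exact: (bmfS (@measurableT _ (circle R)) _ (bmf_G (r01 n))).
by move=> t _; rewrite ger0_norm ?G_ge0 ?G_le.
Qed.

End poisson_concentration.

(** * Common divisors; singularity implies coprimality *)

Section common_divisors.
Variable R : realType.
Notation C := R[i].
Notation Re := (@complex.Re _).
Notation val := (@circle_val R).
Notation sigma := (@arc_length R).
Implicit Types (w : C -> C) (z : C).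

(* Harnack: [1 - Re (w^* (0) * w)] is nonnegative with mean 0. *)
Lemma maximum_modulus w z : (forall z, cabs z < 1 -> derivable w z 1) ->
  (forall z, cabs z < 1 -> cabs (w z) <= 1) -> cabs (w 0) = 1 -> cabs z < 1 -> w z = w 0.
Proof.
move=> dw w1 w01 z1; have pi0 := pi_gt0 R.
pose c := (w 0)^*%C; pose k z := 1 - c * w z.
have c1 : cabs c = 1 by rewrite cabs_conj.
have cw0 : c * w 0 = 1.
  have := cabs_sqr (w 0); rewrite w01 expr1n /c; case: (w 0) => a b /= ab.
  by simpc; apply: complex_ext => /=; [rewrite ab|]; ring.
have dk x : cabs x < 1 -> derivable k x 1.
  by move=> x1; apply: cderB; [exact: cder_cst|apply: cderM; [exact: cder_cst|exact: dw]].
have cw1 x : cabs x < 1 -> cabs (c * w x) <= 1 by move=> x1; rewrite cabsM c1 mul1r w1.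
have k2 x : cabs x < 1 -> cabs (k x) <= 2.
  move=> x1; apply: (le_trans (cabsD _ _)); rewrite cabsN cabs1.
  by have := cw1 x x1; lra.
have k0 x : cabs x < 1 -> 0 <= Re (k x).
  move=> x1; rewrite ReD ReN subr_ge0; apply: le_trans (cw1 x x1).
  by apply: (le_trans (ler_norm _)); exact: ler_Re_cabs.
have [q [zq q1]] : exists q : R, cabs z < q /\ q < 1.
  by exists ((cabs z + 1) / 2); split; [exact: (midf_lt z1).1|exact: (midf_lt z1).2].
have q0 : 0 < q := le_lt_trans (cabs_ge0 z) zq.
have q1' : 1 < q^-1 by rewrite invf_gt1.
have qC0 : q%:C != 0 :> C by rewrite -cabs_gt0 cabs_real gtr0_norm.
have zq1 : cabs (z / q%:C) < 1.
  by rewrite cabsM cabsV cabs_real gtr0_norm// ltr_pdivrMr// mul1r.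
have q01 : 0 <= q < 1 by rewrite (ltW q0) q1.
have bk : cbmf setT (fun t => k (q%:C * val t)).
  apply: circle_cbmf => t; apply: cder_continuous; apply: dk; exact: cabs_scale_lt1.
have mv : \int[sigma]_t Re (k (q%:C * val t)) = 0.
  have := @circle_mean_value _ k q (ltW q0)
    (fun x xq => dk x (le_lt_trans xq q1)).
  by rewrite /k cw0 subrr mulr0 => /(congr1 Re).
have := @poisson_formula _ (fun x => k (q%:C * x)) _ 2 (z / q%:C) q1'
  (fun x xq => dilate_cder dk q0 xq) (fun x xq => k2 _ (dilate_lt1 q0 xq)) zq1.
have -> : q%:C * (z / q%:C) = z by field.
move=> /(congr1 Re); rewrite /cint /= => pf.
have bP := poisson_kernel_bmf zq1.
have [B HB] := bP.2.
have : 2 * pi * Re (k z) <= 0.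
  rewrite (_ : 2 * pi * Re (k z) = Re ((2 * pi)%:C * k z)); last by rewrite ReM /=; ring.
  rewrite -pf.
  (* The kernel is at most [B] and [Re k] is nonnegative, so the Poisson mean is at most [B] times
     the ordinary integral, which is 0. *)
  have -> : 0 = \int[sigma]_t (B * Re (k (q%:C * val t))).
    rewrite RintZ ?mv ?mulr0//; first exact: fin_arc_length.
    by have [] := bk.
  apply: Rint_le => //; first exact: fin_arc_length.
  - by have [] := cbmfM (poisson_kernel_cbmf zq1) bk.
  - by apply: bmfM; [exact: bmf_cst|have [] := bk].
  move=> t _; rewrite ReM /= mul0r subr0 ler_wpM2r//.
    by apply: k0; exact: cabs_scale_lt1.
  by apply: (le_trans (ler_norm _)); exact: HB.
rewrite pmulr_rle0 ?mulr_gt0// ReD ReN subr_le0 => /= re1.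
have cwz : c * w z = 1.
  have := cw1 z z1; have := cabs_sqr (c * w z).
  move: re1; case: (c * w z) => a b /= a1 E abs1.
  have n1 : cabs (a +i* b) ^+ 2 <= 1 by rewrite expr_le1 ?cabs_ge0.
  have a2 : 1 <= a ^+ 2 by rewrite expr_ge1// (le_trans ler01).
  have b0 : b = 0 by apply/eqP; rewrite -sqrf_eq0 eq_le sqr_ge0 andbT; lra.
  have aE : a = 1.
    apply/eqP; rewrite eq_le a1 andbT; move: abs1; apply: le_trans.
    by apply: (le_trans (ler_norm _)); have := ler_Re_cabs (a +i* b).
  by rewrite aE b0.
have c0 : c != 0 by rewrite -cabs_gt0 c1.
by apply: (mulfI c0); rewrite cwz cw0.
Qed.

Lemma closed_circle_ball (K : set (circle R)) t : closed K -> ~ K t ->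
  exists2 d : R, 0 < d & forall t', K t' -> d <= cabs (val t' - val t).
Proof.
move=> /closed_openC oK Kt; have [d d0 Hd] := open_circle_ball oK Kt.
by exists d => // t' Kt'; rewrite leNgt; apply/negP => /Hd; apply.
Qed.

(** [V] is the union of balls centred on [K1], each of radius at most half the distance from its
    centre to [K2]. *)
Lemma closed_separation (K1 K2 : set (circle R)) : closed K1 -> closed K2 ->
  K1 `&` K2 = set0 -> exists V, [/\ measurable V,
    (forall tau, K2 tau -> exists2 d : R, 0 < d &
      forall t, V t -> d <= cabs (val t - val tau)) &
    (forall tau, K1 tau -> exists2 d : R, 0 < d &
      forall t, (~` V) t -> d <= cabs (val t - val tau))].
Proof.
move=> cK1 cK2 K12.
pose I := [set p : circle R * R | K1 p.1 /\ 0 < p.2 /\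
  forall t, K2 t -> 2 * p.2 <= cabs (val t - val p.1)].
exists (\bigcup_(p in I) circle_ball p.1 p.2); split.
- by apply: open_circle_measurable; apply: bigcup_open => p _; exact: circle_ball_open.
- move=> tau K2tau; have [|d d0 Hd] := @closed_circle_ball K1 tau cK1.
    by move=> K1tau; have : set0 tau by rewrite -K12.
  exists (d / 2); first by rewrite divr_gt0.
  move=> t [[tau' r] /= [K1t [r0 Hr]]]; rewrite /circle_ball /= => tr.
  have h1 := Hr _ K2tau; have h2 := Hd _ K1t; rewrite cabsB in h2; rewrite /= in h1 h2.
  have -> : val t - val tau = (val t - val tau') - (val tau - val tau') by ring.
  by rewrite cabsB; apply: le_trans (cabsD_dist _ _); lra.
- move=> tau K1tau; have [|d d0 Hd] := @closed_circle_ball K2 tau cK2.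
    by move=> K2tau; have : set0 tau by rewrite -K12.
  exists (d / 2); first by rewrite divr_gt0.
  move=> t Vt; rewrite leNgt; apply/negP => td; apply: Vt.
  exists (tau, d / 2) => //; split=> //=; split; first by rewrite divr_gt0.
  by move=> t' /Hd; rewrite mulrC divfK.
Qed.

Lemma common_divisor_bound w (mu1 mu2 : {finite_measure set (circle R) -> \bar R})
    (K1 K2 : set (circle R)) (e : R) :
  (forall z, cabs z < 1 -> derivable w z 1) ->
  (forall z, cabs z < 1 -> cabs (w z) <= 1) ->
  (forall z, cabs z < 1 -> expR (- Re (herglotz mu1 setT z)) <= cabs (w z)) ->
  (forall z, cabs z < 1 -> expR (- Re (herglotz mu2 setT z)) <= cabs (w z)) ->
  closed K1 -> closed K2 -> K1 `&` K2 = set0 -> 0 < e ->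
  - (2 * pi * ln (cabs (w 0))) <=
    2 * pi * (fine (mu1 (~` K1)) + fine (mu2 (~` K2))) + e.
Proof.
move=> dw w1 le1 le2 cK1 cK2 K12 e0.
(* [V] stays away from each point of [K2] and its complement from each point of [K1]: the bound by
   [mu2] is used on [V], the one by [mu1] on the complement. *)
have [V [mV V2 V1]] := closed_separation cK1 cK2 K12.
have e20 : 0 < e / 2 by rewrite divr_gt0.
have [N1 HN1] := poisson_integral_off_support mu1 cK1 (measurableC mV) V1 e20.
have [N2 HN2] := poisson_integral_off_support mu2 cK2 mV V2 e20.
have := HN1 _ (leq_maxl N1 N2); have := HN2 _ (leq_maxr N1 N2).
have := radius_seq_bounds R (maxn N1 N2).
move: (radius_seq R (maxn N1 N2)) => s /andP[s0 s1] i2 i1 {HN1 HN2}.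
have s01 : 0 <= s < 1 by rewrite (ltW s0) s1.
have mT := @measurableT _ (circle R).
(* [reverse_jensen] needs a positive lower bound for [|w|]; it exists because the Poisson kernel is
   at most [(1 - s) ^- 2] on the disk of radius [s]. *)
have [m m0 wm] : exists2 m : R, 0 < m & forall z, cabs z <= s -> m <= cabs (w z).
  exists (expR (- ((1 - s) ^- 2 * fine (mu1 setT)))); first exact: expR_gt0.
  move=> z zs; have z1 := le_lt_trans zs s1.
  apply: le_trans (le1 _ z1); rewrite ler_expR lerN2 Re_herglotz.
  apply: (le_trans (ler_norm _)).
  apply: (Rint_norm_le mT (finite_measure_lty mu1 mT)); first exact: poisson_kernel_bmf.
  move=> t _; rewrite ger0_norm ?poisson_kernel_ge0// poisson_kernelE//.
  have ts : 1 - s <= cabs (val t - z).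
    by apply: le_trans (cabsD_dist _ _); rewrite cabs_circle lerB.
  have s1' : 0 < 1 - s by rewrite subr_gt0.
  rewrite -[leRHS]mul1r; apply: ler_pM.
  - by rewrite subr_ge0 expr_le1 ?cabs_ge0// ltW.
  - by rewrite invr_ge0 sqr_ge0.
  - by rewrite gerBl sqr_ge0.
  rewrite lef_pV2 ?posrE ?exprn_gt0 ?(lt_le_trans s1' ts)//.
  by rewrite ler_pXn2r ?nnegrE ?(ltW s1')// cabs_ge0.
have rj := reverse_jensen dw w1 (ltW s0) s1 m0 wm.
have wpos t : 0 < cabs (w (s%:C * val t)).
  by apply: (lt_le_trans m0); apply: wm; rewrite cabs_scale// ltW.
pose l t := ln (cabs (w (s%:C * val t))).
have bl : bmf setT l.
  apply: continuous_circle_bmf => t.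
  apply: (@continuous_comp _ _ _ (fun t => cabs (w (s%:C * val t))) (@ln R));
    last exact: continuous_ln.
  apply: continuous_cabs; apply: circle_continuous => t'; apply: cder_continuous.
  by apply: dw; exact: cabs_scale_lt1.
have le_ln (mu : {finite_measure set (circle R) -> \bar R}) t :
    (forall z, cabs z < 1 -> expR (- Re (herglotz mu setT z)) <= cabs (w z)) ->
    - l t <= Re (herglotz mu setT (s%:C * val t)).
  move=> lemu; rewrite lerNl /l -[leLHS]expRK ler_ln ?posrE ?expR_gt0//.
  by apply: lemu; exact: cabs_scale_lt1.
have bN := bmfN bl.
have part (mu : {finite_measure set (circle R) -> \bar R}) D : measurable D ->
    (forall z, cabs z < 1 -> expR (- Re (herglotz mu setT z)) <= cabs (w z)) ->
    \int[sigma]_(t in D) - l t <= \int[sigma]_(t in D) Re (herglotz mu setT (s%:C * val t)).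
  move=> mD lemu; apply: Rint_le => //; first exact: finite_measure_lty.
  - exact: (bmfS mT _ bN).
  - exact: (bmfS mT _ (Re_herglotz_bmf mu mT s01)).
  - by move=> t _; exact: le_ln.
have i3 := part _ _ mV le2; have i4 := part _ _ (measurableC mV) le1.
have E : \int[sigma]_t - l t = \int[sigma]_(t in V) - l t + \int[sigma]_(t in ~` V) - l t.
  rewrite -[X in Rintegral _ X _](setUv V) Rintegral_setU//.
  - exact: measurableC.
  - rewrite setUv; apply: bmf_integrable => //; exact: fin_arc_length.
  - by apply/disj_setPS => t [].
have E2 : \int[sigma]_t - l t = - \int[sigma]_t l t.
  rewrite -mulN1r -RintZ//; last exact: fin_arc_length.
  by apply: eq_Rintegral => t _; rewrite mulN1r.
move: rj; rewrite -/(l _) -lerN2 => /le_trans; apply.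
rewrite -E2 E; apply: (le_trans (lerD i3 i4)); apply: (le_trans (lerD i2 i1)).
rewrite le_eqVlt; apply/orP; left; apply/eqP.
by move: (2 * pi) (fine _) (fine _) => x y z; field.
Qed.

Lemma mutually_singular_coprime (theta1 theta2 : C -> C)
    (mu1 mu2 : {finite_measure set (circle R) -> \bar R}) :
  singular_inner_with theta1 mu1 -> singular_inner_with theta2 mu2 ->
  mutually_singular mu1 mu2 -> coprime_inner theta1 theta2.
Proof.
move=> [_ th1] [_ th2] [A [B [mA mB AB muA muB]]].
move=> [w [[wI [f1 f1I E1]] [_ [f2 f2I E2]] nw]]; apply: nw.
have dw z : cabs z < 1 -> derivable w z 1 by exact: inner_derivable.
have w1 z : cabs z < 1 -> cabs (w z) <= 1 by exact: inner_le1.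
have lem (theta f : C -> C) (mu : {finite_measure set (circle R) -> \bar R}) :
  (forall z, unit_disk R z -> theta z = cexp (- cintegral mu (fun t : circle R =>
    (circle_val t + z) / (circle_val t - z)))) ->
  inner_function f -> (forall z, unit_disk R z -> theta z = w z * f z) ->
  forall z, cabs z < 1 -> expR (- Re (herglotz mu setT z)) <= cabs (w z).
  move=> th fI E z z1; have zD : unit_disk R z by apply/cabs_lt1.
  rewrite -ReN -cabs_cexp (_ : cexp _ = w z * f z); last by rewrite -E// th.
  by rewrite cabsM ler_piMr ?cabs_ge0// inner_le1.
have le1 := lem _ _ _ th1 f1I E1; have le2 := lem _ _ _ th2 f2I E2.
have pi0 := pi_gt0 R.
have c0 : cabs (0 : C) < 1 by rewrite cabs0.
have w00 : 0 < cabs (w 0) by apply: lt_le_trans (le1 _ c0); exact: expR_gt0.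
have small e : 0 < e -> - (2 * pi * ln (cabs (w 0))) <= e.
  move=> e0; pose d := e / 2 / (4 * pi).
  have d0 : 0 < d by rewrite !divr_gt0// mulr_gt0.
  have conc (mu : {finite_measure set (circle R) -> \bar R}) S : measurable S ->
      concentrated_on mu S -> exists K, [/\ closed K, K `<=` S & fine (mu (~` K)) <= d].
    move=> mS muS; have [K [cK KS SK]] := closed_inner_regular mu mS d0.
    exists K; split=> //; have mK := closed_circle_measurable cK.
    have -> : mu (~` K) = mu (S `\` K) by rewrite muS//; exact: measurableC.
    have fS : mu (S `\` K) \is a fin_num by apply: fin_num_measure; exact: measurableD.
    by rewrite -lee_fin fineK// ltW.
  have [K1 [cK1 K1A m1]] := conc _ _ mA muA; have [K2 [cK2 K2B m2]] := conc _ _ mB muB.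
  have K12 : K1 `&` K2 = set0.
    by rewrite -subset0 => t [/K1A At /K2B Bt]; rewrite -AB.
  have e20 : 0 < e / 2 by rewrite divr_gt0.
  apply: (le_trans (common_divisor_bound dw w1 le1 le2 cK1 cK2 K12 e20)).
  have : 2 * pi * (fine (mu1 (~` K1)) + fine (mu2 (~` K2))) <= 2 * pi * (d + d).
    by rewrite ler_wpM2l ?lerD// mulr_ge0// ltW.
  have -> : 2 * pi * (d + d) = e / 2.
    by rewrite /d; move: pi0; move: (pi : R) => p p0; field; rewrite gt_eqF.
  lra.
have ln0 : 0 <= ln (cabs (w 0)).
  have : 0 <= 2 * pi * ln (cabs (w 0)).
    by rewrite -oppr_le0; apply/ler_addgt0Pr => e /small; rewrite add0r.
  by rewrite pmulr_rge0 ?mulr_gt0.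
have w01 : cabs (w 0) = 1.
  apply/eqP; rewrite eq_le w1//=; move: ln0; apply: contraTT.
  by rewrite -!ltNge => w01; rewrite ln_lt0// w00.
by exists (w 0) => z /cabs_lt1; exact: maximum_modulus.
Qed.

End common_divisors.

Theorem theorem3p7 (R : realType) (theta1 theta2 : R[i] -> R[i])
    (mu1 mu2 : {finite_measure set (circle R) -> \bar R})
    (theta1_Hinfty : Hinfty theta1) (theta2_Hinfty : Hinfty theta2)
    (theta1_mu1 : singular_inner_with theta1 mu1)
    (theta2_mu2 : singular_inner_with theta2 mu2) :
  coprime_inner theta1 theta2 <-> mutually_singular mu1 mu2.
Proof.
split; first exact: coprime_mutually_singular.
exact: mutually_singular_coprime.
Qed.
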